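(* Let $\{X_{j,k}\}_{j,k\in\mathbb Z}$ be a real mean-zero stationary Gaussian process with positive variance whose spectral measure satisfies $\nu=\nu_{ac}+\nu_d$, and let $W_N(i,j)=X_{i,j}+X_{j,i}$, $1\le i,j\le N$. Then there exists a random point measure $\xi$, almost surely in $\mathcal C_2$, such that $$d_4\big(\mathrm{EM}(W_N/N),\xi\big)\to0\quad\text{in probability as }N\to\infty.$$ Moreover, the distribution of $\xi$ is determined by $\nu_d$.
   Context: The spectral measure $\nu$ is the finite measure on $(-\pi,\pi]^2$ with $E(X_{0,0}X_{u,v})=\int e^{\mathrm i(ux+vy)}\nu(dx,dy)$; $\nu_{ac}$, $\nu_d$ are its Lebesgue-absolutely-continuous and discrete (countably supported) parts. $\mathcal P$ is the set of measures on $\mathbb R$ of the form $\infty\delta_0+\sum_{j\ge1}\delta_{\theta_j}$ with $(\theta_j)$ real. For an $N\times N$ symmetric matrix $A$ with eigenvalues $\lambda_1,\dots,\lambda_N$, its eigen measure is $\mathrm{EM}(A):=\infty\delta_0+\sum_{j=1}^N\delta_{\lambda_j}\in\mathcal P$. For $p\ge1$, $\mathcal C_p:=\{\mu\in\mathcal P:\int|x|^p\mu(dx)<\infty\}$. Each $\xi\in\mathcal C_p$ can be written uniquely as $\xi=\infty\delta_0+\sum_{j\ne0}\delta_{\alpha_j(\xi)}$ with $\alpha_1(\xi)\ge\alpha_2(\xi)\ge\dots\ge0$ and $\alpha_{-1}(\xi)\le\alpha_{-2}(\xi)\le\dots\le0$; the metric is $d_p(\xi_1,\xi_2):=\big[\sum_{j\ne0}|\alpha_j(\xi_1)-\alpha_j(\xi_2)|^p\big]^{1/p}$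 (note $\mathcal C_2\subset\mathcal C_4$). *)

(* Defs.v *)
From HB Require Import structures.
From mathcomp Require Import all_boot all_order all_algebra.
From mathcomp Require Import all_classical all_reals all_analysis.
Set Implicit Arguments. Unset Strict Implicit. Unset Printing Implicit Defensive.
Import Order.TTheory GRing.Theory Num.Theory.
Import numFieldNormedType.Exports.
Local Open Scope classical_set_scope.
Local Open Scope ring_scope.

Section Defs.
Context {R : realType}.

Definition lincomb {d} {T : measurableType d} (X : int -> int -> T -> R)
  (s : seq ((int * int) * R)) : T -> R :=
  fun w => \sum_(p <- s) p.2 * X p.1.1 p.1.2 w.

Definition gauss0 (v : R) : set R -> \bar R :=
  fun A => if v == 0 then \d_(0 : R) A else normal_prob 0 (Num.sqrt v) A.

Definition centered_gaussian {d} {T : measurableType d} (P : probability T R)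
  (X : int -> int -> T -> R) : Prop :=
  (forall i j, measurable_fun setT (X i j)) /\
  forall s, exists v : R, 0 <= v /\
    forall A : set R, measurable A -> P (lincomb X s @^-1` A) = gauss0 v A.

(* (second-order, equivalently for Gaussian fields strict) stationarity *)
Definition stationary {d} {T : measurableType d} (P : probability T R)
  (X : int -> int -> T -> R) : Prop :=
  forall j k u v : int,
    ('E_P[fun w => (X j k w * X (j + u) (k + v) w)%R] =
     'E_P[fun w => (X 0 0 w * X u v w)%R])%E.

Definition positive_variance {d} {T : measurableType d} (P : probability T R)
  (X : int -> int -> T -> R) : Prop :=
  (0 < 'E_P[fun w => (X 0 0 w ^+ 2)%R])%E.

(* nu is the spectral measure: a finite measure on (-pi,pi]^2 with
   E(X_{0,0} X_{u,v}) = int e^{i(ux+vy)} nu(dx,dy)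
   (real and imaginary parts written out). *)
Definition spectral_measure {d} {T : measurableType d} (P : probability T R)
  (X : int -> int -> T -> R) (nu : {measure set (R * R)%type -> \bar R}) : Prop :=
  (nu setT < +oo)%E /\
  nu (~` (`]- pi, pi] `*` `]- pi, pi])) = 0%E /\
  forall u v : int,
    ('E_P[fun w => (X 0 0 w * X u v w)%R] =
      \int[nu]_z (cos (u%:~R * z.1 + v%:~R * z.2)%R)%:E)%E /\
    (\int[nu]_z (sin (u%:~R * z.1 + v%:~R * z.2))%:E)%E = 0%E.

Definition ac_plus_discrete (nu nac nd : {measure set (R * R)%type -> \bar R}) : Prop :=
  nac `<< ((@lebesgue_measure R) \x (@lebesgue_measure R))%E /\
  (exists S : set (R * R), countable S /\ nd (~` S) = 0%E) /\
  forall A, measurable A -> nu A = (nac A + nd A)%E.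

Definition thm_hyps {d} {T : measurableType d} (P : probability T R)
  (X : int -> int -> T -> R) (nu nac nd : {measure set (R * R)%type -> \bar R}) : Prop :=
  centered_gaussian P X /\ stationary P X /\ positive_variance P X /\
  spectral_measure P X nu /\ ac_plus_discrete nu nac nd.

(* xi = infty delta_0 + sum_{j<>0} delta_{alpha_j(xi)} is encoded by the pair
   (fun j => alpha_{j+1}(xi), fun j => alpha_{-(j+1)}(xi)). *)
Definition pmseq := ((nat -> R) * (nat -> R))%type.

Definition canonical_pm (xi : pmseq) : Prop :=
  (forall j, 0 <= xi.1 j /\ xi.1 j.+1 <= xi.1 j) /\
  (forall j, xi.2 j <= 0 /\ xi.2 j <= xi.2 j.+1).

Definition in_C (p : R) (xi : pmseq) : Prop :=
  canonical_pm xi /\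
  (\sum_(0 <= j <oo) (`|xi.1 j| `^ p)%:E +
   \sum_(0 <= j <oo) (`|xi.2 j| `^ p)%:E < +oo)%E.

Definition dist_p (p : R) (xi1 xi2 : pmseq) : \bar R :=
  poweR (\sum_(0 <= j <oo) (`|xi1.1 j - xi2.1 j| `^ p)%:E +
         \sum_(0 <= j <oo) (`|xi1.2 j - xi2.2 j| `^ p)%:E)%E p^-1.

(* eigenvalues (with algebraic multiplicity) of a square matrix whose
   characteristic polynomial splits over R (e.g. symmetric); [::] otherwise *)
Definition eigseq n (A : 'M[R]_n) : seq R :=
  match pselect (exists s : seq R, char_poly A = \prod_(x <- s) ('X - x%:P)) with
  | left e => proj1_sig (cid e)
  | right _ => [::]
  end.

Definition EM n (A : 'M[R]_n) : pmseq :=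
  (fun j => nth 0 (sort (fun x y => y <= x) [seq x <- eigseq A | 0 < x]) j,
   fun j => nth 0 (sort (fun x y => x <= y) [seq x <- eigseq A | x < 0]) j).

Definition WN {T} (X : int -> int -> T -> R) (N : nat) (w : T) : 'M[R]_N :=
  \matrix_(i < N, j < N) (X (i.+1)%:Z (j.+1)%:Z w + X (j.+1)%:Z (i.+1)%:Z w).

Definition random_pm_C2 {d} {T : measurableType d} (P : probability T R)
  (xi : T -> pmseq) : Prop :=
  (forall j, measurable_fun setT (fun w => (xi w).1 j) /\
             measurable_fun setT (fun w => (xi w).2 j)) /\
  {ae P, forall w, in_C 2 (xi w)}.

Definition EM_conv_prob {d} {T : measurableType d} (P : probability T R)
  (X : int -> int -> T -> R) (xi : T -> pmseq) : Prop :=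
  forall eps : R, 0 < eps ->
    (fun N : nat => P [set w | (eps%:E < dist_p 4 (EM ((N%:R)^-1 *: WN X N w)) (xi w))%E])
      @ \oo --> 0%E.

Definition same_law {d} {T : measurableType d} (P : probability T R) (xi : T -> pmseq)
  {d'} {T' : measurableType d'} (P' : probability T' R) (xi' : T' -> pmseq) : Prop :=
  forall (n : nat) (t s : nat -> R),
    P [set w | forall j, (j < n)%N -> (xi w).1 j <= t j /\ (xi w).2 j <= s j] =
    P' [set w | forall j, (j < n)%N -> (xi' w).1 j <= t j /\ (xi' w).2 j <= s j].

End Defs.

(* Main.v *)
(* The traces of (W_N / N)^k, k >= 3, control the eigen measure: a Lipschitz function vanishing near 0
   is uniformly x^4 times a polynomial on a bounded spectrum, and ramp statistics locate each
   eigenvalue; tightness of the Frobenius norm controls the tails in d_4.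

   Fix a finite set F of frequencies, closed under negation modulo 2 pi, carrying nu_d up to delta.
   The component of X at F, estimated by Fourier averages U over an M x M window, contributes to W_N
   a matrix of rank bounded in N, whose traces converge to a polynomial in U.  By Wick's formula the
   remainder Y has E tr (Y / N)^4 bounded by averaged squared covariances, hence by the mass that
   nu outside F gives to lines parallel to the axes.  The absolutely continuous part does not
   charge lines, so this is O(delta).  Therefore the traces, and then the eigenvalues, are Cauchy
   in probability.

   The limiting covariance of U involves only the atoms, so the expectations of cosines of
   polynomials in U, and thus of linear statistics of the limit, depend on nu_d alone.  They
   determine its finite-dimensional distributions. *)
From Pilot Require Import Defs.
From HB Require Import structures.
From mathcomp Require Import all_boot all_order all_algebra.
From mathcomp Require Import all_classical all_reals all_analysis.
From mathcomp Require Import measurable_realfun ring lra zify.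
From mathcomp.real_closed Require complex.
(* boolp's EM (excluded middle) shadows the eigen measure *)
Import Pilot.Defs.
Set Implicit Arguments. Unset Strict Implicit. Unset Printing Implicit Defensive.
Import Order.TTheory GRing.Theory Num.Theory.
Import numFieldNormedType.Exports.
Local Open Scope classical_set_scope.
Local Open Scope ring_scope.

(** Second-order traces need not converge to those of the atoms: the absolutely continuous part can
    spread a Frobenius norm of order one over many eigenvalues that all tend to zero. Hence the
    exponents k >= 3, the test functions that vanish near 0, and d_4, for which a bound on the
    square sum makes the tails uniformly small.

    In the Wick expansion only one index may be averaged at a time, so squared covariances must be
    small on average in one lag, uniformly in the other. As in Wiener's lemma on atoms, the limit of
    such an average is the mass seen along lines parallel to an axis.

    Polynomials of Gaussian variables need not be determined by their moments. Laws are therefore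
    compared through cosines of polynomials: replacing each coordinate x by n sin (x / n) yields
    almost periodic functions, whose means depend only on Gaussian variances.

    Everything stays real: a phase shift by pi / 2 plays the imaginary part. A cosine carries the
    frequencies n and -n with weight one half each, so projecting onto atoms requires a set closed
    under negation. *)

(** * Symmetric matrices *)

Section SymmetricSpectrum.
Import complex.
Context {R : realType}.

Lemma char_poly_conj (F : fieldType) n (P D : 'M[F]_n) : P \in unitmx ->
  char_poly (invmx P *m D *m P) = char_poly D.
Proof.
move=> Pu; rewrite /char_poly /char_poly_mx.
have -> : 'X%:M - map_mx polyC (invmx P *m D *m P) =
    map_mx polyC (invmx P) *m ('X%:M - map_mx polyC D) *m map_mx polyC P.
  rewrite mulmxBr mulmxBl !map_mxM; congr (_ - _).
  by rewrite -[RHS]mulmxA -scalar_mxC mulmxA -map_mxM mulVmx // map_mx1 mul1mx.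
rewrite !det_mulmx mulrAC -det_mulmx -map_mxM mulVmx // map_mx1 det1 mul1r //.
Qed.

Lemma expmx_conj (F : fieldType) n (P D : 'M[F]_n) k : P \in unitmx ->
  (invmx P *m D *m P) ^+ k = invmx P *m (D ^+ k) *m P.
Proof.
move=> Pu; elim: k => [|k IH]; first by rewrite !expr0 mulmx1 mulVmx.
rewrite exprS IH [in RHS]exprS -!mulmxE !mulmxA; congr (_ *m _ *m _).
by rewrite mulmxK.
Qed.

Lemma expmx_diag (F : fieldType) n (v : 'rV[F]_n) k :
  (diag_mx v) ^+ k = diag_mx (\row_i (v 0 i ^+ k)).
Proof.
elim: k => [|k IH].
  by rewrite expr0; apply/matrixP => i j; rewrite !mxE expr0.
rewrite exprS IH -mulmxE mulmx_diag; congr diag_mx.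
by apply/rowP => i; rewrite !mxE exprS.
Qed.

(** Over [R[i]] the matrix is Hermitian, so it is unitarily diagonalizable with real diagonal. Both
    identities descend to [R] because the embedding is injective. *)
Lemma symmetric_spectrum n (A : 'M[R]_n) : A^T = A ->
  exists s : seq R, char_poly A = \prod_(x <- s) ('X - x%:P) /\
    forall k, \tr (A ^+ k) = \sum_(x <- s) x ^+ k.
Proof.
move=> symA; pose C := R[i].
pose f : {rmorphism R -> C} := real_complex R.
pose A' := map_mx f A.
have rA' : A' \is a mxOver Num.real.
  apply/mxOverP => i j; rewrite mxE /=.
  by rewrite complex_real.
have sA' : A' \is symmetricmx.
  apply/is_hermitianmxP; rewrite expr0 scale1r map_mx_id //.
  by apply/matrixP => i j; rewrite !mxE -{1}symA mxE.
have hA' := realsym_hermsym sA' rA'.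
have /orthomx_spectralP eA' := hermitian_normalmx hA'.
have /mxOverP rd := hermitian_spectral_diag_real hA'.
set P := spectralmx A' in eA'; set v := spectral_diag A' in eA' rd.
have Pu : P \in unitmx := spectral_unit A'.
exists [seq complex.Re (v 0 i) | i <- enum 'I_n]; split.
  have inj : injective (map_poly f) by exact: map_inj_poly (fmorph_inj f) (rmorph0 f).
  apply: inj; rewrite map_char_poly -/A' [in LHS]eA' char_poly_conj //.
  rewrite char_poly_trig; last exact: diag_mx_is_trig.
  rewrite rmorph_prod big_map big_enum /=; apply: eq_bigr => i _.
  rewrite rmorphB /= map_polyX map_polyC /= !mxE eqxx mulr1n.
  by rewrite RRe_real.
move=> k; apply: (fmorph_inj f).
have mX : map_mx f (A ^+ k) = A' ^+ k.
  elim: k => [|k IH]; first by rewrite !expr0 map_mx1.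
  by rewrite !exprS -!mulmxE map_mxM IH.
rewrite -trace_map_mx mX [in LHS]eA' expmx_conj // mxtrace_mulC mulmxA.
rewrite mulmxV // mul1mx expmx_diag mxtrace_diag rmorph_sum big_map big_enum /=.
apply: eq_bigr => i _; rewrite mxE rmorphXn /=.
by rewrite RRe_real.
Qed.

(** Symmetry excludes the default branch of [eigseq], and the choice made there is harmless since
    the roots of a split polynomial are unique up to order. *)
Lemma eigseqP n (A : 'M[R]_n) : A^T = A ->
  char_poly A = \prod_(x <- eigseq A) ('X - x%:P) /\
  forall k, \tr (A ^+ k) = \sum_(x <- eigseq A) x ^+ k.
Proof.
move=> symA; have [s [cs ts]] := symmetric_spectrum symA.
have ce : char_poly A = \prod_(x <- eigseq A) ('X - x%:P).
  rewrite /eigseq; case: pselect => [e|]; first by case: cid.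
  by case; exists s.
split=> // k; rewrite ts; apply: perm_big.
by apply: prod_XsubC_eq; rewrite -cs.
Qed.

End SymmetricSpectrum.

(** * Frobenius norms and perturbation of traces *)

Section Frobenius.
Context {R : realType}.

(** Lagrange's identity: the defect is half a double sum of squares. *)
Lemma cauchy_schwarz_sum (I : finType) (a b : I -> R) :
  (\sum_i a i * b i) ^+ 2 <= (\sum_i a i ^+ 2) * (\sum_i b i ^+ 2).
Proof.
rewrite -subr_ge0.
have -> : (\sum_i a i ^+ 2) * (\sum_i b i ^+ 2) - (\sum_i a i * b i) ^+ 2 =
   2^-1 * \sum_i \sum_j (a i * b j - a j * b i) ^+ 2.
  have E i j : (a i * b j - a j * b i) ^+ 2 =
    a i ^+ 2 * b j ^+ 2 - 2 * (a i * b i) * (a j * b j) + b i ^+ 2 * a j ^+ 2 by ring.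
  under [X in _ = _ * X]eq_bigr do under eq_bigr do rewrite E.
  under [X in _ = _ * X]eq_bigr do rewrite big_split /= sumrB -!mulr_sumr.
  rewrite big_split /= sumrB -!mulr_suml -mulr_sumr.
  set X := \sum_i _ ^+ 2; set Y := \sum_i _ ^+ 2; set Z := \sum_i _ * _.
  by field.
by rewrite mulr_ge0 // ?invr_ge0 // sumr_ge0 // => i _; apply: sumr_ge0 => j _; exact: sqr_ge0.
Qed.

Definition fro m n (A : 'M[R]_(m, n)) : R := \sum_i \sum_j A i j ^+ 2.

Lemma fro_ge0 m n (A : 'M[R]_(m, n)) : 0 <= fro A.
Proof. by apply: sumr_ge0 => i _; apply: sumr_ge0 => j _; exact: sqr_ge0. Qed.

Lemma fro_pair m n (A : 'M[R]_(m, n)) : fro A = \sum_p A p.1 p.2 ^+ 2.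
Proof. by rewrite /fro pair_bigA. Qed.

Lemma fro_tr m n (A : 'M[R]_(m, n)) : fro A^T = fro A.
Proof.
by rewrite /fro exchange_big; apply: eq_bigr => i _; apply: eq_bigr => j _; rewrite mxE.
Qed.

Lemma mxtrace_mul_le m n (A : 'M[R]_(m, n)) (B : 'M[R]_(n, m)) :
  (\tr (A *m B)) ^+ 2 <= fro A * fro B.
Proof.
have -> : \tr (A *m B) = \sum_p A p.1 p.2 * B^T p.1 p.2.
  rewrite -(pair_bigA _ (fun i j => A i j * B^T i j)) /=.
  by apply: eq_bigr => i _; rewrite mxE; apply: eq_bigr => j _; rewrite mxE.
by rewrite -(fro_tr B) !fro_pair; exact: cauchy_schwarz_sum.
Qed.

Lemma fro_mul m n p (A : 'M[R]_(m, n)) (B : 'M[R]_(n, p)) :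
  fro (A *m B) <= fro A * fro B.
Proof.
rewrite -(fro_tr B) /fro mulr_suml; apply: ler_sum => i _.
rewrite mulr_sumr; apply: ler_sum => j _; rewrite mxE.
apply: le_trans (cauchy_schwarz_sum _ _) _.
by under [X in _ <= _ * X]eq_bigr do rewrite mxE.
Qed.

Lemma fro_sym n (A : 'M[R]_n) : A^T = A -> fro A = \tr (A ^+ 2).
Proof.
move=> sA; rewrite expr2 -mulmxE -{3}sA /fro; apply: eq_bigr => i _.
rewrite mxE; apply: eq_bigr => j _; by rewrite !mxE -expr2.
Qed.

Lemma fro_expmx n (A : 'M[R]_n) (C : R) k : (0 < k)%N -> fro A <= C ->
  fro (A ^+ k) <= C ^+ k.
Proof.
case: k => // k _ hA; have C0 : 0 <= C by apply: le_trans (fro_ge0 A) hA.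
elim: k => [|k IH]; first by rewrite !expr1.
rewrite exprS -mulmxE [leRHS]exprS (le_trans (fro_mul _ _)) //.
by rewrite ler_pM // ?fro_ge0.
Qed.

Lemma fro_expmx2 n (A B : 'M[R]_n) (C : R) i j : (0 < i + j)%N ->
  fro A <= C -> fro B <= C -> fro (A ^+ i *m B ^+ j) <= C ^+ (i + j).
Proof.
move=> ij hA hB; have C0 : 0 <= C by apply: le_trans (fro_ge0 A) hA.
case: i ij => [|i] ij; first by rewrite expr0 mul1mx add0n fro_expmx.
case: j ij => [|j] ij; first by rewrite expr0 mulmx1 addn0 fro_expmx.
by rewrite exprD (le_trans (fro_mul _ _)) // ler_pM // ?fro_ge0 // fro_expmx.
Qed.

Lemma tr_expmx n (A : 'M[R]_n) k : (A ^+ k)^T = A^T ^+ k.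
Proof.
elim: k => [|k IH]; first by rewrite !expr0 trmx1.
by rewrite exprS -mulmxE trmx_mul IH mulmxE -exprSr.
Qed.

(** By symmetry [fro (A *m Y)] is the trace of A^2 Y^2, to which Cauchy-Schwarz applies. The gain is
    that Y enters only through tr Y^4, which becomes small for the remainder while [fro Y] does
    not. *)
Lemma fro_mul_sym n (A Y : 'M[R]_n) : A^T = A -> Y^T = Y ->
  fro (A *m Y) ^+ 2 <= fro A ^+ 2 * \tr (Y ^+ 4).
Proof.
move=> sA sY.
have -> : fro (A *m Y) = \tr ((A ^+ 2) *m (Y ^+ 2)).
  have -> : fro (A *m Y) = \tr ((A *m Y) *m (A *m Y)^T).
    apply: eq_bigr => i _; rewrite mxE; apply: eq_bigr => j _.
    by rewrite [_^T _ _]mxE expr2.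
  by rewrite trmx_mul sA sY mulmxA mxtrace_mulC !expr2 -!mulmxE !mulmxA.
apply: le_trans (mxtrace_mul_le _ _) _.
have -> : \tr (Y ^+ 4) = fro (Y ^+ 2).
  by rewrite fro_sym ?tr_expmx ?sY // -exprM.
by rewrite ler_wpM2r ?fro_ge0 // fro_expmx.
Qed.

Lemma fro_mul_sym_sqrt n (A Y : 'M[R]_n) (C : R) : A^T = A -> Y^T = Y -> fro A <= C ->
  fro (A *m Y) <= C * Num.sqrt (\tr (Y ^+ 4)).
Proof.
move=> sA sY hA; have C0 : 0 <= C by apply: le_trans (fro_ge0 A) hA.
have t0 : 0 <= \tr (Y ^+ 4).
  by rewrite (exprM Y 2 2) -fro_sym ?fro_ge0 // tr_expmx sY.
rewrite -(@ler_pXn2r _ 2) // ?nnegrE ?fro_ge0 // ?mulr_ge0 ?sqrtr_ge0 //.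
rewrite exprMn sqr_sqrtr // (le_trans (fro_mul_sym sA sY)) //.
by rewrite ler_wpM2r // ler_pXn2r // ?nnegrE ?fro_ge0.
Qed.

(** Telescoping: the factors of [A] are replaced by [B] one at a time. *)
Lemma mxtrace_expB n (A B : 'M[R]_n) k :
  \tr (A ^+ k) - \tr (B ^+ k) = \sum_(i < k) \tr (A ^+ i *m (A - B) *m B ^+ (k.-1 - i)).
Proof.
elim: k => [|k IH]; first by rewrite big_ord0 !expr0 subrr.
rewrite big_ord_recr /= subnn expr0 mulmx1.
have -> : \tr (A ^+ k.+1) - \tr (B ^+ k.+1) =
   \tr (A ^+ k *m (A - B)) + \tr ((A ^+ k - B ^+ k) *m B).
  rewrite mulmxBr mulmxBl !linearB /= !mulmxE -!exprSr.
  by rewrite addrA subrK.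
rewrite addrC; congr (_ + _).
have -> : A ^+ k - B ^+ k = \sum_(i < k) A ^+ i *m (A - B) *m B ^+ (k.-1 - i).
  clear IH; elim: k => [|k IH]; first by rewrite big_ord0 !expr0 subrr.
  rewrite big_ord_recr /= subnn expr0 mulmx1.
  have -> : A ^+ k.+1 - B ^+ k.+1 = A ^+ k *m (A - B) + (A ^+ k - B ^+ k) *m B.
    rewrite mulmxBr mulmxBl !mulmxE -!exprSr.
    by rewrite addrA subrK.
  rewrite addrC; congr (_ + _); rewrite IH mulmx_suml; apply: eq_bigr => i _.
  rewrite -mulmxA mulmxE -exprSr; congr (_ *m (B ^+ _)).
  by case: k i {IH} => [[]//|k i] /=; rewrite subSn // -ltnS.
rewrite mulmx_suml linear_sum; apply: eq_bigr => i _ /=.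
rewrite -mulmxA mulmxE -exprSr; congr (\tr (_ *m (B ^+ _))).
by case: k i {IH} => [[]//|k i] /=; rewrite subSn // -ltnS.
Qed.

(** In each telescoped term one neighbour is paired with A - B by [fro_mul_sym_sqrt], and the k - 2
    remaining factors are bounded in Frobenius norm. With k = 2 nothing would remain but the
    identity, whose norm grows with the size. *)
Lemma mxtrace_exp_diff n (A B : 'M[R]_n) (C : R) k : (2 < k)%N ->
  A^T = A -> B^T = B -> fro A <= C -> fro B <= C ->
  `|\tr (A ^+ k) - \tr (B ^+ k)| <=
    k%:R * Num.sqrt (C ^+ k.-1 * Num.sqrt (\tr ((A - B) ^+ 4))).
Proof.
move=> k2 sA sB hA hB; set Y := A - B; have C0 : 0 <= C by apply: le_trans (fro_ge0 A) hA.
have sY : Y^T = Y by rewrite /Y linearB /= sA sB.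
rewrite mxtrace_expB; apply: le_trans (ler_norm_sum _ _ _) _.
set S := Num.sqrt (_ * _).
have -> : k%:R * S = \sum_(i < k) S by rewrite sumr_const card_ord mulr_natl.
apply: ler_sum => -[i ik] _ /=.
have s0 := sqrtr_ge0 (\tr (Y ^+ 4)).
rewrite -sqrtr_sqr ler_wsqrtr //.
(* [Z] is the difference with its neighbour, [W] the product of the k - 2 other factors. *)
have main (Z W : 'M[R]_n) : fro Z <= C * Num.sqrt (\tr (Y ^+ 4)) -> fro W <= C ^+ k.-2 ->
    (\tr (Z *m W)) ^+ 2 <= C ^+ k.-1 * Num.sqrt (\tr (Y ^+ 4)).
  move=> hZ hW; apply: le_trans (mxtrace_mul_le _ _) _.
  have -> : k.-1 = k.-2.+1 by move: k2; case: (k) => // -[|[|]].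
  by rewrite exprS mulrAC ler_pM ?fro_ge0.
(* Without a factor [A] on the left, the neighbour is a [B] on the right; otherwise cyclicity of the
   trace isolates [A *m (A - B)]. *)
case: i ik => [|i] ik.
  rewrite expr0 mul1mx subn0.
  have -> : B ^+ k.-1 = B *m B ^+ k.-2 by rewrite mulmxE -exprS; move: k2; case: (k) => // -[|[|]].
  rewrite mulmxA; apply: main.
    rewrite -fro_tr trmx_mul sY sB; exact: fro_mul_sym_sqrt.
  by apply: fro_expmx => //; move: k2; case: (k) => // -[|[|]].
have -> : A ^+ i.+1 = A ^+ i *m A by rewrite mulmxE -exprSr.
rewrite -!mulmxA mxtrace_mulC -mulmxA.
have -> : (A - B) *m B ^+ (k.-1 - i.+1) *m A ^+ i = (A - B) *m (B ^+ (k.-1 - i.+1) *m A ^+ i) by rewrite mulmxA.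
set W := _ *m A ^+ i.
rewrite -/Y mulmxA.
apply: main; first exact: fro_mul_sym_sqrt.
have e : (k.-1 - i.+1 + i)%N = k.-2 by move: k2 ik; case: (k) => // -[|[|]] //= m _ im; lia.
by rewrite -e; apply: fro_expmx2 => //; rewrite e; move: k2; case: (k) => // -[|[|]].
Qed.

(** This moves the traces of a low-rank matrix of growing size to a matrix of fixed size. The zeroth
    power is excluded because its trace is the dimension. *)
Lemma mxtrace_exp_mulC m n (U : 'M[R]_(m, n)) (V : 'M[R]_(n, m)) k :
  \tr ((U *m V) ^+ k.+1) = \tr ((V *m U) ^+ k.+1).
Proof.
have E : (U *m V) ^+ k.+1 = U *m (V *m U) ^+ k *m V.
  elim: k => [|k IH]; first by rewrite expr1 expr0 mulmx1.
  by rewrite exprSr IH -mulmxE [in RHS]exprSr -mulmxE !mulmxA.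
by rewrite E mxtrace_mulC mulmxA exprS mulmxE.
Qed.

End Frobenius.

(** * Test functions *)

Section Bernstein.
Context {R : realType}.

(* [bernstein n h] evaluates at y to the expectation of h at a binomial(n, y) variable. *)
Fixpoint bernstein (n : nat) (h : nat -> R) : {poly R} :=
  if n is m.+1 then 'X * bernstein m (fun k => h k.+1) + (1 - 'X) * bernstein m h
  else (h 0%N)%:P.

Lemma bernsteinS n h (y : R) : (bernstein n.+1 h).[y] =
  y * (bernstein n (fun k => h k.+1)).[y] + (1 - y) * (bernstein n h).[y].
Proof. by rewrite /= !hornerE. Qed.

Lemma le_bernstein n h h' (y : R) : 0 <= y <= 1 -> (forall k, h k <= h' k) ->
  (bernstein n h).[y] <= (bernstein n h').[y].
Proof.
move=> /andP[y0 y1]; elim: n h h' => [|n IH] h h' hh; first by rewrite /= !hornerC.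
by rewrite !bernsteinS lerD // ler_wpM2l ?subr_ge0 // IH.
Qed.

Lemma bernstein_lin n h h' (a : R) y : (bernstein n (fun k => a * h k + h' k)).[y] =
  a * (bernstein n h).[y] + (bernstein n h').[y].
Proof.
elim: n h h' => [|n IH] h h'; first by rewrite /= !hornerC.
by rewrite !bernsteinS !IH; ring.
Qed.

Lemma bernstein_cst n (c y : R) : (bernstein n (fun=> c)).[y] = c.
Proof. by elim: n => [|n IH]; [rewrite /= hornerC | rewrite bernsteinS IH; ring]. Qed.

(** Second moment of a binomial variable about [c]: variance plus squared bias. *)
Lemma bernstein_var n (c y : R) : (bernstein n (fun k => (k%:R - c) ^+ 2)).[y] =
  n%:R * y * (1 - y) + (n%:R * y - c) ^+ 2.
Proof.
elim: n c => [|n IH] c; first by rewrite /= hornerC; ring.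
rewrite bernsteinS IH.
have -> : (fun k : nat => (k.+1%:R - c) ^+ 2) = (fun k => (k%:R - (c - 1)) ^+ 2).
  by apply/funext => k; rewrite -addn1 natrD; congr (_ ^+ 2); ring.
by rewrite IH -[in RHS]addn1 natrD; ring.
Qed.

(** Bernstein's argument: the error at [y] is at most L E|y - k/n|, which the binomial variance
    controls. *)
Lemma weierstrass_unit (g : R -> R) (L eps : R) : 0 <= L -> 0 < eps ->
  (forall x y, 0 <= x <= 1 -> 0 <= y <= 1 -> `|g x - g y| <= L * `|x - y|) ->
  exists p : {poly R}, forall y, 0 <= y <= 1 -> `|g y - p.[y]| <= eps.
Proof.
move=> L0 e0 gL.
(* The final error is at most [L * eta]; the 1 covers the case L = 0. *)
pose eta := eps / (L + 1).
have eta0 : 0 < eta by rewrite divr_gt0 // ltr_wpDl.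
pose n := (Num.truncn (eta ^- 2)).+1.
have n0 : 0 < n%:R :> R by [].
have hn : eta ^- 2 < n%:R by exact: truncnS_gt.
(* A binomial variable never exceeds [n], but [le_bernstein] compares values at every [k], so the
   sampled function is continued by [g 1]. *)
exists (bernstein n (fun k => if (k <= n)%N then g (k%:R / n%:R) else g 1)) => y y01.
have [y0 y1] := andP y01.
pose h k := (if (k <= n)%N then g (k%:R / n%:R) else g 1) : R.
(* 2 |t| <= eta + t^2 / eta *)
pose B (k : nat) : R := (L / (2 * eta * n%:R ^+ 2)) * (k%:R - n%:R * y) ^+ 2 + L * eta / 2.
have Bh k : `|g y - h k| <= B k.
  have amgm (t : R) : `|t| <= t ^+ 2 / (2 * eta) + eta / 2.
    rewrite -subr_ge0 -(real_normK (num_real t)).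
    have -> : `|t| ^+ 2 / (2 * eta) + eta / 2 - `|t| = (`|t| - eta) ^+ 2 / (2 * eta).
      by field; rewrite gt_eqF.
    by rewrite divr_ge0 ?sqr_ge0 // mulr_ge0 // ltW.
  have key (t : R) : 0 <= t <= 1 -> `|y - t| <= `|y - k%:R / n%:R| -> `|g y - g t| <= B k.
    move=> t01 tk; apply: le_trans (gL _ _ y01 t01) _.
    apply: le_trans (ler_wpM2l L0 tk) _.
    apply: le_trans (ler_wpM2l L0 (amgm _)) _.
    rewrite le_eqVlt; apply/orP; left; apply/eqP; rewrite /B.
    by field; rewrite !gt_eqF.
  rewrite /h; case: leqP => kn; apply: key => //.
  - by rewrite divr_ge0 //= ler_pdivrMr // mul1r ler_nat.
  - by rewrite ler01 lexx.
  - have k1 : 1 <= k%:R / n%:R :> R by rewrite ler_pdivlMr // mul1r ler_nat ltnW.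
    by rewrite !ler0_norm ?subr_le0 ?(le_trans y1) // lerN2 lerB.
have eB : (bernstein n B).[y] <= eps.
  rewrite /B (bernstein_lin n (fun k => (k%:R - n%:R * y) ^+ 2) (fun=> L * eta / 2)).
  rewrite bernstein_var bernstein_cst subrr expr0n /= addr0.
  apply: (@le_trans _ _ (L * eta)); last first.
    rewrite /eta mulrCA ler_piMr ?(ltW e0) // ler_pdivrMr ?ltr_wpDl // mul1r.
    by rewrite lerDl.
  have yy : y * (1 - y) <= 1.
    by rewrite -[leRHS]mulr1 ler_pM // ?subr_ge0 // lerBlDr lerDl.
  apply: (@le_trans _ _ (L / (2 * eta * n%:R ^+ 2) * n%:R + L * eta / 2)).
    rewrite lerD2r ler_wpM2l //; last by rewrite -mulrA ler_piMr.
    by rewrite divr_ge0 // mulr_ge0 ?exprn_ge0 // mulr_ge0 // ltW.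
  have -> : L / (2 * eta * n%:R ^+ 2) * n%:R = L * (eta / 2 * (eta ^- 2 / n%:R)).
    by field; rewrite !gt_eqF.
  rewrite -[L * eta / 2]mulrA -mulrDr ler_wpM2l //.
  have h1 : eta ^- 2 / n%:R <= 1 by rewrite ler_pdivrMr // mul1r ltW.
  have e2 : 0 <= eta / 2 by rewrite divr_ge0 // ltW.
  by have := ler_wpM2l e2 h1; lra.
have lin h' : g y - (bernstein n h').[y] = (bernstein n (fun k => -1 * h' k + g y)).[y].
  by rewrite (bernstein_lin n h' (fun=> g y)) bernstein_cst; ring.
rewrite -/h lin ler_norml; apply/andP; split.
  have -> : - eps = - 1 * eps by ring.
  apply: (@le_trans _ _ (-1 * (bernstein n B).[y])); first by rewrite !mulN1r lerN2.
  have -> : -1 * (bernstein n B).[y] = (bernstein n (fun k => -1 * B k + 0)).[y].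
    by rewrite (bernstein_lin n B (fun=> 0)) bernstein_cst addr0.
  apply: le_bernstein => // k; have := Bh k; rewrite ler_norml => /andP[+ _].
  by rewrite mulN1r mulN1r; lra.
apply: le_trans eB; apply: le_bernstein => // k.
by have := Bh k; rewrite ler_norml => /andP[_]; rewrite mulN1r; lra.
Qed.

Lemma weierstrass (g : R -> R) (L Q eps : R) : 0 <= L -> 0 < Q -> 0 < eps ->
  (forall x y, `|x| <= Q -> `|y| <= Q -> `|g x - g y| <= L * `|x - y|) ->
  exists p : {poly R}, forall y, `|y| <= Q -> `|g y - p.[y]| <= eps.
Proof.
move=> L0 Q0 e0 gL.
have inQ x : 0 <= x <= 1 -> `|(2 * x - 1) * Q| <= Q.
  move=> /andP[x0 x1]; rewrite normrM (gtr0_norm Q0) ler_piMl ?(ltW Q0) //.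
  by rewrite ler_norml; apply/andP; split; lra.
have [||p hp] := @weierstrass_unit (fun x => g ((2 * x - 1) * Q)) (2 * L * Q) eps _ e0.
- by rewrite !mulr_ge0 // ltW.
- move=> x y hx hy; apply: le_trans (gL _ _ (inQ _ hx) (inQ _ hy)) _.
  have -> : (2 * x - 1) * Q - (2 * y - 1) * Q = 2 * Q * (x - y) by ring.
  rewrite normrM ger0_norm ?mulr_ge0 ?(ltW Q0) //.
  by rewrite le_eqVlt; apply/orP; left; apply/eqP; ring.
exists (p \Po ((2 * Q)^-1 *: 'X + 2^-1%:P)) => y yQ.
rewrite horner_comp !hornerE.
have y01 : 0 <= (2 * Q)^-1 * y + 2^-1 <= 1.
  have : -1 <= y / Q <= 1.
    by rewrite ler_pdivlMr // ler_pdivrMr // mulN1r mul1r -ler_norml.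
  have -> : (2 * Q)^-1 * y = y / Q / 2 by field; rewrite gt_eqF.
  lra.
have := hp _ y01.
have -> : (2 * ((2 * Q)^-1 * y + 2^-1) - 1) * Q = y by field; rewrite gt_eqF.
by [].
Qed.

End Bernstein.

(** * Test functions vanishing near the origin *)

Section Vanishing.
Context {R : realType}.

(* The test functions of the point measures: a square-summable spectrum charges only finitely many terms of their statistics. *)
Definition vanish0 (t l : R) (f : R -> R) : Prop :=
  [/\ 0 < t, 0 <= l, (forall x, `|x| <= t -> f x = 0) &
      forall x y, `|f x - f y| <= l * `|x - y|].

(** f(x) / x^4 is Lipschitz on bounded sets because f vanishes near 0. The factor x^4 makes the
    error summable over a spectrum and starts the polynomial at degree 4, so that traces of order
    below 3 never occur. *)
Lemma vanish0_weierstrass t l f (Q eps : R) : vanish0 t l f -> 0 < Q -> 0 < eps ->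
  exists p : {poly R}, forall x, `|x| <= Q -> `|f x - x ^+ 4 * p.[x]| <= eps * x ^+ 4.
Proof.
move=> [t0 l0 f0 fl] Q0 e0.
pose psi x := f x / x ^+ 4.
have t4 : 0 < t ^+ 4 by rewrite exprn_gt0.
have bt y : t <= `|y| -> t ^+ 4 <= y ^+ 4.
  by move=> ty; rewrite -[y ^+ 4]ger0_norm ?exprn_even_ge0 // normrX ler_pXn2r // nnegrE ltW.
have f00 : f 0 = 0 by rewrite f0 // normr0 ltW.
have fQ y : `|y| <= Q -> `|f y| <= l * Q.
  move=> yQ; have := fl y 0; rewrite f00 !subr0 => /le_trans; apply.
  by rewrite ler_wpM2l.
(* The first term comes from the variation of f, the second from that of x^-4, with |f| <= l Q, |y^4
   - x^4| <= 4 Q^3 |x - y| and denominators at least t^8. *)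
pose L := l / t ^+ 4 + l * Q * (4 * Q ^+ 3) / t ^+ 8.
have psiS x y : `|x| < t -> `|psi x - psi y| <= L * `|x - y|.
  move=> xt; rewrite /psi (f0 x (ltW xt)) mul0r sub0r normrN.
  case: (leP `|y| t) => yt.
    by rewrite f0 // mul0r normr0 mulr_ge0 // addr_ge0 ?divr_ge0 ?mulr_ge0 ?exprn_ge0 // ltW.
  have y4 := bt _ (ltW yt).
  rewrite normrM normfV [`|y ^+ 4|]ger0_norm ?exprn_even_ge0 //.
  apply: (@le_trans _ _ (l / t ^+ 4 * `|x - y|)); last first.
    by rewrite ler_wpM2r // lerDl divr_ge0 ?mulr_ge0 ?exprn_ge0 // ltW.
  rewrite mulrAC ler_pM ?invr_ge0 ?exprn_even_ge0 //.
    have := fl y x; rewrite (f0 x (ltW xt)) subr0 distrC //.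
  by rewrite lef_pV2 // posrE (lt_le_trans t4).
have psiL x y : `|x| <= Q -> `|y| <= Q -> `|psi x - psi y| <= L * `|x - y|.
  move=> xQ yQ; case: (ltP `|x| t) => xt; first exact: psiS.
  case: (ltP `|y| t) => yt; first by rewrite distrC [X in _ * X]distrC; exact: psiS.
  have x4 := bt _ xt; have y4 := bt _ yt.
  have x4p := lt_le_trans t4 x4; have y4p := lt_le_trans t4 y4.
  have x0 : x != 0 by apply: contraTneq xt => ->; rewrite normr0 -ltNge.
  have y0 : y != 0 by apply: contraTneq yt => ->; rewrite normr0 -ltNge.
  have -> : psi x - psi y = (f x - f y) / x ^+ 4 +
     f y * ((y ^+ 3 + y ^+ 2 * x + y * x ^+ 2 + x ^+ 3) * (y - x)) / (x ^+ 4 * y ^+ 4).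
    by rewrite /psi; field; rewrite x0 y0.
  apply: le_trans (ler_normD _ _) _; rewrite /L [leRHS]mulrDl; apply: lerD.
    rewrite normrM normfV [`|x ^+ 4|]gtr0_norm // mulrAC ler_pM ?invr_ge0 ?exprn_even_ge0 //.
    by rewrite lef_pV2 // posrE.
  rewrite !normrM normfV (gtr0_norm (mulr_gt0 x4p y4p)).
  have -> : l * Q * (4 * Q ^+ 3) / t ^+ 8 * `|x - y| =
     (l * Q * (4 * Q ^+ 3 * `|x - y|)) / t ^+ 8 by ring.
  rewrite ler_pM ?invr_ge0 ?(ltW (mulr_gt0 x4p y4p)) //.
    rewrite ler_pM ?mulr_ge0 //; first exact: fQ.
    rewrite [`|y - x|]distrC ler_wpM2r //.
    have Q3 a b c : `|a| <= Q -> `|b| <= Q -> `|c| <= Q -> `|a * b * c| <= Q ^+ 3.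
      move=> ha hb hc; rewrite !normrM -[Q ^+ 3]/(Q * (Q * Q)) mulrA.
      by rewrite ler_pM ?mulr_ge0 // ler_pM.
    have -> : y ^+ 3 + y ^+ 2 * x + y * x ^+ 2 + x ^+ 3 =
      y * y * y + y * y * x + y * x * x + x * x * x by ring.
    have h1 := Q3 _ _ _ yQ yQ yQ; have h2 := Q3 _ _ _ yQ yQ xQ.
    have h3 := Q3 _ _ _ yQ xQ xQ; have h4 := Q3 _ _ _ xQ xQ xQ.
    apply: le_trans (ler_normD _ _) _.
    have := ler_normD (y * y * y + y * y * x) (y * x * x).
    have := ler_normD (y * y * y) (y * y * x); lra.
  rewrite lef_pV2 ?posrE ?(mulr_gt0 x4p y4p) ?exprn_gt0 //.
  by rewrite (exprD _ 4 4) ler_pM // (ltW t4).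
have L0 : 0 <= L by rewrite addr_ge0 ?divr_ge0 ?mulr_ge0 ?exprn_ge0 // ltW.
have [p hp] := weierstrass L0 Q0 e0 psiL.
exists p => x xQ; have [->|x0] := eqVneq x 0.
  by rewrite f00 expr0n /= mul0r subr0 normr0 mulr0.
have -> : f x - x ^+ 4 * p.[x] = x ^+ 4 * (psi x - p.[x]).
  by rewrite /psi; field.
rewrite normrM mulrC [`|x ^+ 4|]ger0_norm ?exprn_even_ge0 // ler_wpM2r ?exprn_even_ge0 //.
exact: hp.
Qed.

(** The left side vanishes unless one of the points lies beyond [t], where x^2 + y^2 >= t^2. The
    extra squares make differences of statistics summable. *)
Lemma vanish0_sqr t l f x y : vanish0 t l f ->
  `|f x - f y| <= l / t ^+ 2 * `|x - y| * (x ^+ 2 + y ^+ 2).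
Proof.
move=> [t0 l0 f0 fl].
have t2 : 0 < t ^+ 2 by rewrite exprn_gt0.
have K a : t <= `|a| -> t ^+ 2 <= a ^+ 2.
  by move=> h; rewrite -(real_normK (num_real a)) ler_pXn2r // nnegrE ltW.
case: (ltP `|x| t) => xt; last first.
  apply: le_trans (fl _ _) _.
  have -> : l / t ^+ 2 * `|x - y| * (x ^+ 2 + y ^+ 2) =
    l * `|x - y| * (t ^- 2 * (x ^+ 2 + y ^+ 2)) by ring.
  rewrite ler_peMr ?mulr_ge0 //.
  by rewrite ler_pdivlMl // mulr1 (le_trans (K _ xt)) // lerDl sqr_ge0.
case: (ltP `|y| t) => yt; last first.
  apply: le_trans (fl _ _) _.
  have -> : l / t ^+ 2 * `|x - y| * (x ^+ 2 + y ^+ 2) =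
    l * `|x - y| * (t ^- 2 * (x ^+ 2 + y ^+ 2)) by ring.
  rewrite ler_peMr ?mulr_ge0 //.
  by rewrite ler_pdivlMl // mulr1 (le_trans (K _ yt)) // lerDr sqr_ge0.
rewrite (f0 x (ltW xt)) (f0 y (ltW yt)) subrr normr0 !mulr_ge0 // ?addr_ge0 ?sqr_ge0 //.
by rewrite invr_ge0 ltW.
Qed.

Lemma vanish0_0 : vanish0 1 0 (fun=> 0 : R).
Proof. by split => // x y; rewrite subrr normr0 mul0r. Qed.

Lemma vanish0_lin t l f t' l' f' (a : R) : vanish0 t l f -> vanish0 t' l' f' ->
  vanish0 (Num.min t t') (`|a| * l + l') (fun x => a * f x + f' x).
Proof.
move=> [t0 l0 f0 fl] [t0' l0' f0' fl']; split.
- by rewrite lt_min t0.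
- by rewrite addr_ge0 // mulr_ge0.
- by move=> x; rewrite le_min => /andP[h h']; rewrite f0 // f0' // mulr0 addr0.
- move=> x y.
  have -> : a * f x + f' x - (a * f y + f' y) = a * (f x - f y) + (f' x - f' y) by ring.
  apply: le_trans (ler_normD _ _) _; rewrite mulrDl lerD //.
  by rewrite normrM -mulrA ler_wpM2l.
Qed.

Definition ramp (t h x : R) : R := Num.min 1 (Num.max 0 ((x - t) / h)).

Lemma ramp_ge0 t h x : 0 <= ramp t h x.
Proof. by rewrite /ramp le_min ler01 le_max lexx. Qed.

Lemma ramp_le1 t h x : ramp t h x <= 1.
Proof. by rewrite /ramp ge_min lexx. Qed.

Lemma ramp0 t h x : 0 < h -> x <= t -> ramp t h x = 0.
Proof.
move=> h0 xt; rewrite /ramp.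
have -> : Num.max 0 ((x - t) / h) = 0.
  by apply/max_idPl; rewrite ler_pdivrMr // mul0r subr_le0.
by apply/min_idPr.
Qed.

Lemma ramp1 t h x : 0 < h -> t + h <= x -> ramp t h x = 1.
Proof.
move=> h0 xt; rewrite /ramp; apply/min_idPl.
by rewrite le_max ler_pdivlMr // mul1r lerBrDl xt orbT.
Qed.

Lemma ramp_lip t h x y : 0 < h -> `|ramp t h x - ramp t h y| <= h^-1 * `|x - y|.
Proof.
move=> h0.
have -> : h^-1 * `|x - y| = `|(x - t) / h - (y - t) / h|.
  by rewrite -mulrBl normrM mulrC [`|h^-1|]gtr0_norm ?invr_gt0 //; congr (`|_| * _); ring.
rewrite /ramp; move: ((x - t) / h) ((y - t) / h) => u v.
have mx (a b : R) : `|Num.max 0 a - Num.max 0 b| <= `|a - b|.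
  wlog ab : a b / b <= a => [H|].
    have [ba|/ltW ba] := leP b a; first exact: H.
    by rewrite -(normrN (Num.max 0 a - _)) -(normrN (a - b)) !opprB; exact: H.
  rewrite [leRHS]ger0_norm ?subr_ge0 //.
  have [a0|a0] := leP 0 a; last first.
    have b0 := le_lt_trans ab a0.
    by rewrite (max_l (ltW b0)) subrr normr0 subr_ge0.
  have [b0|b0] := leP 0 b; first by rewrite ger0_norm // subr_ge0.
  by rewrite subr0 ger0_norm // lerBrDr gerDl ltW.
have mn (a b : R) : `|Num.min 1 a - Num.min 1 b| <= `|a - b|.
  wlog ab : a b / b <= a => [H|].
    have [ba|/ltW ba] := leP b a; first exact: H.
    by rewrite -(normrN (Num.min 1 a - _)) -(normrN (a - b)) !opprB; exact: H.
  rewrite [leRHS]ger0_norm ?subr_ge0 //.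
  have [b1|b1] := leP 1 b.
    by rewrite (min_l (le_trans b1 ab)) subrr normr0 subr_ge0.
  have [a1|a1] := leP 1 a; last by rewrite ger0_norm // subr_ge0.
  by rewrite ger0_norm ?subr_ge0 ?(ltW b1) // lerD2r.
exact: le_trans (mn _ _) (mx _ _).
Qed.

Definition sgnR (s : bool) : R := if s then 1 else -1.

Lemma vanish0_ramp s t h : 0 < t -> 0 < h ->
  vanish0 t h^-1 (fun x => ramp t h (sgnR s * x)).
Proof.
move=> t0 h0; split => //; first by rewrite invr_ge0 ltW.
- move=> x xt; apply: ramp0 => //; apply: le_trans (ler_norm _) _.
  by rewrite normrM; case: s; rewrite /= ?normrN normr1 mul1r.
- move=> x y; apply: le_trans (ramp_lip _ _ _ _) _ => //.
  by rewrite -mulrBr normrM; case: s; rewrite /= ?normrN normr1 mul1r.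
Qed.

End Vanishing.

(** * Point measures and eigenvalue statistics *)

Section PointMeasures.
Context {R : realType}.
Implicit Types xi : @pmseq R.

Definition pL (f : R -> R) xi J : R := \sum_(j < J) (f (xi.1 j) + f (xi.2 j)).

(** Membership in C_2 with an explicit bound, stated by partial sums so that no series has to be
    manipulated. *)
Definition l2pm (C : R) xi : Prop :=
  canonical_pm xi /\ forall J, pL (fun x => x ^+ 2) xi J <= C.

(** Turns both halves into nonincreasing nonnegative sequences, so that one argument serves both. *)
Definition side (s : bool) xi (j : nat) : R := if s then xi.1 j else - xi.2 j.

Lemma sum_nth0 (f : R -> R) (s : seq R) J : f 0 = 0 -> (size s <= J)%N ->
  \sum_(j < J) f (nth 0 s j) = \sum_(x <- s) f x.
Proof.
move=> f0; elim: J s => [|J IH] [|x s] //= sJ.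
- by rewrite big_nil big_ord0.
- by rewrite big_nil big1 // => j _; rewrite nth_nil.
- by rewrite big_cons big_ord_recl /= IH.
Qed.

(** [EM] drops the zero eigenvalues and pads with zeros; neither matters when [f 0 = 0]. *)
Lemma pL_EM n (A : 'M[R]_n) (f : R -> R) J : f 0 = 0 -> (size (eigseq A) <= J)%N ->
  pL f (EM A) J = \sum_(x <- eigseq A) f x.
Proof.
move=> f0 sJ; rewrite /pL /EM /= big_split /= !sum_nth0 //; last 2 first.
- by rewrite size_sort size_filter (leq_trans (count_size _ _)).
- by rewrite size_sort size_filter (leq_trans (count_size _ _)).
rewrite (perm_big _ (permEl (perm_sort _ _))) [X in _ + X](perm_big _ (permEl (perm_sort _ _))) /=.
rewrite !big_filter [RHS](bigID (fun x => 0 < x)) /=; congr (_ + _).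
rewrite [RHS](bigID (fun x => x < 0)) /= [X in _ = _ + X]big1 ?addr0; last first.
  by move=> x; rewrite -!leNgt -eq_le => /eqP ->.
by apply: eq_bigl => x; rewrite -leNgt; case: ltgtP.
Qed.

Lemma canonical_EM n (A : 'M[R]_n) : canonical_pm (EM A).
Proof.
split=> j.
- rewrite /EM /=; set s := sort _ _.
  have s0 i : 0 <= nth 0 s i.
    case: (ltnP i (size s)) => h; last by rewrite nth_default.
    by have := mem_nth 0 h; rewrite mem_sort mem_filter => /andP[/ltW].
  split=> //; case: (ltnP j.+1 (size s)) => h; last by rewrite [X in X <= _]nth_default.
  have ss : sorted (fun x y : R => y <= x) s by apply: sort_sorted => x y; exact: le_total.
  by move/(sortedP 0) : ss; exact.
- rewrite /EM /=; set s := sort _ _.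
  have s0 i : nth 0 s i <= 0.
    case: (ltnP i (size s)) => h; last by rewrite nth_default.
    by have := mem_nth 0 h; rewrite mem_sort mem_filter => /andP[/ltW].
  split=> //; case: (ltnP j.+1 (size s)) => h; last by rewrite [X in _ <= X]nth_default.
  have ss : sorted (fun x y : R => x <= y) s by apply: sort_sorted => x y; exact: le_total.
  by move/(sortedP 0) : ss; exact.
Qed.

Lemma pL_mono f xi J J' : (forall x, 0 <= f x) -> (J <= J')%N -> pL f xi J <= pL f xi J'.
Proof.
move=> f0 JJ; rewrite /pL -(subnKC JJ) big_split_ord /= lerDl sumr_ge0 // => i _.
by rewrite addr_ge0.
Qed.

Lemma l2pm_EM n (A : 'M[R]_n) C : A^T = A -> fro A <= C -> l2pm C (EM A).
Proof.
move=> sA fC; split; first exact: canonical_EM.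
move=> J; apply: le_trans fC.
apply: (@le_trans _ _ (pL (fun x => x ^+ 2) (EM A) (J + size (eigseq A)))).
  by apply: pL_mono => [x|]; [exact: sqr_ge0|exact: leq_addr].
rewrite pL_EM ?expr0n ?leq_addl //.
by have [_ <-] := eigseqP sA; rewrite fro_sym.
Qed.

Lemma l2pm_le C C' xi : C <= C' -> l2pm C xi -> l2pm C' xi.
Proof. by move=> CC [h1 h2]; split=> // J; apply: le_trans (h2 J) CC. Qed.

Lemma side_ge0 s xi j : canonical_pm xi -> 0 <= side s xi j.
Proof. by case: s => -[h1 h2] /=; [case: (h1 j)|rewrite oppr_ge0; case: (h2 j)]. Qed.

Lemma side_le s xi i j : canonical_pm xi -> (i <= j)%N -> side s xi j <= side s xi i.
Proof.
move=> [h1 h2]; elim: j => [|j IH]; first by rewrite leqn0 => /eqP ->.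
rewrite leq_eqVlt => /predU1P[-> //|]; rewrite ltnS => /IH; apply: le_trans.
by case: s {IH} => /=; [case: (h1 j)|rewrite lerN2; case: (h2 j)].
Qed.

Lemma pL_sqr_side xi J :
  pL (fun x => x ^+ 2) xi J = \sum_(j < J) (side true xi j ^+ 2 + side false xi j ^+ 2).
Proof. by apply: eq_bigr => j _; rewrite /= sqrrN. Qed.

Lemma side_sqr_le C s xi j : l2pm C xi -> j.+1%:R * side s xi j ^+ 2 <= C.
Proof.
move=> [cx hx]; apply: le_trans (hx j.+1); rewrite pL_sqr_side.
have -> : j.+1%:R * side s xi j ^+ 2 = \sum_(i < j.+1) side s xi j ^+ 2.
  by rewrite sumr_const card_ord mulr_natl.
apply: ler_sum => i _.
apply: (@le_trans _ _ (side s xi i ^+ 2)).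
  by rewrite ler_pXn2r ?nnegrE ?side_ge0 // side_le // -ltnS.
by case: s; rewrite ?lerDl ?lerDr sqr_ge0.
Qed.

Lemma l2pm_ge0 C xi : l2pm C xi -> 0 <= C.
Proof. by move=> [_ /(_ 0%N)]; rewrite /pL big_ord0. Qed.

(** Past index C / t^2 every entry is at most [t], by [side_sqr_le], and contributes nothing. *)
Lemma pL_stable t l f C xi : vanish0 t l f -> l2pm C xi ->
  exists J0, forall J, (J0 <= J)%N -> pL f xi J = pL f xi J0.
Proof.
move=> [t0 l0 f0 _] hx; exists (Num.truncn (C / t ^+ 2)) => J hJ.
rewrite /pL -(subnKC hJ) big_split_ord /= [X in _ + X]big1 ?addr0 // => i _.
have small s : `|side s xi (Num.truncn (C / t ^+ 2) + i)| <= t.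
  set k := (_ + i)%N.
  rewrite -(@ler_pXn2r _ 2) ?nnegrE ?(ltW t0) // real_normK ?num_real //.
  have h1 := side_sqr_le s k hx.
  have k1 : C / t ^+ 2 < k.+1%:R.
    by apply: lt_le_trans (truncnS_gt _) _; rewrite ler_nat ltnS leq_addr.
  rewrite ltr_pdivrMr ?exprn_gt0 // in k1.
  have := le_lt_trans h1 k1; rewrite ltr_pM2l; first exact: ltW.
  by rewrite ltr0n.
rewrite !f0 ?addr0 //; first by have := small false; rewrite /= normrN.
exact: (small true).
Qed.

(* pL is eventually constant when f vanishes near 0 and xi is square summable *)
Definition lstat (f : R -> R) xi : R := limn (pL f xi).

Lemma lstatE t l f C xi : vanish0 t l f -> l2pm C xi ->
  exists J0, forall J, (J0 <= J)%N -> pL f xi J = lstat f xi.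
Proof.
move=> vf hx; have [J0 h] := pL_stable vf hx; exists J0 => J hJ.
rewrite h //; apply/esym/cvg_lim => //.
apply: cvg_near_cst; exists J0 => // J' /= hJ'; exact: h.
Qed.

Lemma lstat_cvg t l f C xi : vanish0 t l f -> l2pm C xi ->
  pL f xi J @[J --> \oo] --> lstat f xi.
Proof.
move=> vf hx; have [J0 h] := lstatE vf hx.
by apply: cvg_near_cst; exists J0 => // J' /= hJ'; exact: h.
Qed.

Lemma lstat_EM n (A : 'M[R]_n) t l f : A^T = A -> vanish0 t l f ->
  lstat f (EM A) = \sum_(x <- eigseq A) f x.
Proof.
move=> sA vf; have [J0 h] := lstatE vf (l2pm_EM sA (lexx (fro A))).
rewrite -(h (J0 + size (eigseq A))%N) ?leq_addr // pL_EM ?leq_addl //.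
by case: vf => t0 _ f0 _; rewrite f0 // normr0 ltW.
Qed.

(** The first j + 1 entries of the side each count 1. With the next lemma this turns the position of
    an entry into a gap of one unit between statistics. *)
Lemma lstat_ramp_ge C s t h xi j : 0 < t -> 0 < h -> l2pm C xi ->
  t + h <= side s xi j -> j.+1%:R <= lstat (fun x => ramp t h (sgnR s * x)) xi.
Proof.
move=> t0 h0 hx hj; set f := fun x => _.
have vf : vanish0 t h^-1 f by exact: vanish0_ramp.
have [J0 hJ] := lstatE vf hx; rewrite -(hJ (J0 + j.+1)%N) ?leq_addr //.
apply: (@le_trans _ _ (pL f xi j.+1)); last first.
  by apply: pL_mono; rewrite ?leq_addl // => x; exact: ramp_ge0.
have -> : j.+1%:R = \sum_(i < j.+1) (1 : R) by rewrite sumr_const card_ord.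
apply: ler_sum => i _.
have : 1 <= f (if s then xi.1 i else xi.2 i).
  rewrite /f ramp1 //; apply: le_trans hj _.
  have -> : sgnR s * (if s then xi.1 i else xi.2 i) = side s xi i.
    by rewrite /sgnR /side; case: s {f vf hJ}; rewrite ?mul1r ?mulN1r.
  by apply: side_le; [case: hx|rewrite -ltnS].
have f0 x : 0 <= f x by exact: ramp_ge0.
by move=> h1; apply: le_trans h1 _; case: (s); rewrite ?lerDl ?lerDr f0.
Qed.

(** Only the first [j] entries of the side can exceed [t]; those of the other side have the wrong
    sign. *)
Lemma lstat_ramp_le C s t h xi j : 0 < t -> 0 < h -> l2pm C xi ->
  side s xi j <= t -> lstat (fun x => ramp t h (sgnR s * x)) xi <= j%:R.
Proof.
move=> t0 h0 hx hj; set f := fun x => _.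
have vf : vanish0 t h^-1 f by exact: vanish0_ramp.
have [J0 hJ] := lstatE vf hx; rewrite -(hJ (j + J0)%N) ?leq_addl //.
have cx : canonical_pm xi by case: hx.
have E i : f (xi.1 i) + f (xi.2 i) = ramp t h (side s xi i).
  have g1 : 0 <= xi.1 i := side_ge0 true i cx.
  have g2 : xi.2 i <= 0 by have := side_ge0 false i cx; rewrite /= oppr_ge0.
  rewrite /f /side /sgnR; case: s {f vf hJ hj}; rewrite ?mul1r ?mulN1r.
    by rewrite [X in _ + X]ramp0 ?addr0 // (le_trans g2) // ltW.
  by rewrite ramp0 ?add0r // (@le_trans _ _ 0) // ?oppr_le0 // ltW.
rewrite /pL big_split_ord /= [X in _ + X]big1 ?addr0; last first.
  move=> i _; rewrite E ramp0 //; apply: le_trans hj; apply: side_le => //; exact: leq_addr.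
have -> : j%:R = \sum_(i < j) (1 : R) by rewrite sumr_const card_ord.
by apply: ler_sum => i _; rewrite E ramp_le1.
Qed.

(** Uniform closeness of the entries suffices although there are infinitely many, since
    [vanish0_sqr] weights each difference by summable squares. *)
Lemma lstat_lip C t l f xi xi' eta : vanish0 t l f -> l2pm C xi -> l2pm C xi' ->
  (forall s j, `|side s xi j - side s xi' j| <= eta) ->
  `|lstat f xi - lstat f xi'| <= l / t ^+ 2 * eta * (2 * C).
Proof.
move=> vf hx hx' hd.
have [J0 h] := lstatE vf hx; have [J1 h'] := lstatE vf hx'.
rewrite -(h (J0 + J1)%N) ?leq_addr // -(h' (J0 + J1)%N) ?leq_addl //.
set J := (_ + _)%N; rewrite /pL -sumrB.
have t2 : 0 <= l / t ^+ 2 by case: vf => t0 l0 _ _; rewrite divr_ge0 // exprn_ge0 // ltW.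
have e0 : 0 <= eta by apply: le_trans (normr_ge0 _) (hd true 0%N).
apply: le_trans (ler_norm_sum _ _ _) _.
apply: (@le_trans _ _ (\sum_(j < J) l / t ^+ 2 * eta *
   ((xi.1 j ^+ 2 + xi.2 j ^+ 2) + (xi'.1 j ^+ 2 + xi'.2 j ^+ 2)))).
  apply: ler_sum => j _.
  have -> : f (xi.1 j) + f (xi.2 j) - (f (xi'.1 j) + f (xi'.2 j)) =
    (f (xi.1 j) - f (xi'.1 j)) + (f (xi.2 j) - f (xi'.2 j)) by ring.
  apply: le_trans (ler_normD _ _) _.
  have -> : xi.1 j ^+ 2 + xi.2 j ^+ 2 + (xi'.1 j ^+ 2 + xi'.2 j ^+ 2) =
     (xi.1 j ^+ 2 + xi'.1 j ^+ 2) + (xi.2 j ^+ 2 + xi'.2 j ^+ 2) by ring.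
  rewrite mulrDr; apply: lerD.
  - apply: le_trans (vanish0_sqr _ _ vf) _; rewrite ler_wpM2r ?addr_ge0 ?sqr_ge0 //.
    by rewrite ler_wpM2l //; exact: (hd true).
  - apply: le_trans (vanish0_sqr _ _ vf) _; rewrite ler_wpM2r ?addr_ge0 ?sqr_ge0 //.
    rewrite ler_wpM2l //; have := hd false j.
    by rewrite /= -opprD normrN.
rewrite -mulr_sumr ler_wpM2l ?(mulr_ge0 t2 e0) // big_split /= mulr_natl mulr2n.
by apply: lerD; [case: hx => _; exact|case: hx' => _; exact].
Qed.

Lemma in_C2_l2pm xi : in_C 2 xi -> exists C, l2pm C xi.
Proof.
move=> [cx hx]; set S1 := (X in (X + _)%E) in hx; set S2 := (X in (_ + X)%E) in hx.
have n0 (a : nat -> R) n : (0 <= n)%N -> true -> (0 <= (`|a n| `^ 2)%:E)%E.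
  by move=> _ _; rewrite lee_fin powR_ge0.
have S10 : (0 <= S1)%E by apply: nneseries_ge0 => n; exact: (n0 (fun j => xi.1 j)).
have S20 : (0 <= S2)%E by apply: nneseries_ge0 => n; exact: (n0 (fun j => xi.2 j)).
exists (fine (S1 + S2)%E); split=> // J.
have fS : (S1 + S2)%E \is a fin_num by rewrite ge0_fin_numE // adde_ge0.
rewrite -lee_fin fineK //.
have part (a : nat -> R) : ((\sum_(j < J) a j ^+ 2)%:E <= \sum_(0 <= j <oo) (`|a j| `^ 2)%:E)%E.
  rewrite -sumEFin.
  apply: le_trans (nneseries_lim_ge J (n0 a)).
  rewrite big_mkord; apply: lee_sum => j _.
  by rewrite powR_mulrn // real_normK ?num_real.
rewrite /pL big_split /= EFinD; apply: leeD; exact: part.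
Qed.

Lemma nneseries_le (u : nat -> R) (C : \bar R) : (forall j, 0 <= u j) ->
  (forall J, ((\sum_(j < J) u j)%:E <= C)%E) -> (\sum_(0 <= j <oo) (u j)%:E <= C)%E.
Proof.
move=> u0 hu; apply: lime_le; first by apply: is_cvg_nneseries => *; rewrite lee_fin.
by apply: nearW => J; rewrite big_mkord sumEFin.
Qed.

Lemma l2pm_in_C2 C xi : l2pm C xi -> in_C 2 xi.
Proof.
move=> [cx hx]; split=> //.
have part (a : nat -> R) : (forall J, \sum_(j < J) a j ^+ 2 <= C) ->
    (\sum_(0 <= j <oo) (`|a j| `^ 2)%:E <= C%:E)%E.
  move=> ha; apply: nneseries_le => [j|J]; first exact: powR_ge0.
  rewrite lee_fin; apply: le_trans (ha J); apply: ler_sum => j _.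
  by rewrite powR_mulrn // real_normK ?num_real.
apply: (@le_lt_trans _ _ (C%:E + C%:E)%E); last by rewrite -EFinD ltry.
apply: leeD; apply: part => J; apply: le_trans (hx J); apply: ler_sum => j _.
- by rewrite lerDl sqr_ge0.
- by rewrite lerDr sqr_ge0.
Qed.

Lemma dist4_side (a b : @pmseq R) s j (eta : R) : 0 <= eta ->
  (dist_p 4 a b <= eta%:E)%E -> `|side s a j - side s b j| <= eta.
Proof.
move=> e0; rewrite /dist_p.
have n0 (u v : nat -> R) n : (0 <= n)%N -> true -> (0 <= (`|u n - v n| `^ 4)%:E)%E.
  by move=> _ _; rewrite lee_fin powR_ge0.
set S1 := (X in (X + _)%E); set S2 := (X in (_ + X)%E).
have S10 : (0 <= S1)%E by apply: nneseries_ge0 => n; exact: (n0 (fun j => a.1 j) (fun j => b.1 j)).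
have S20 : (0 <= S2)%E by apply: nneseries_ge0 => n; exact: (n0 (fun j => a.2 j) (fun j => b.2 j)).
have part (u v : nat -> R) :
    ((`|u j - v j| `^ 4)%:E <= \sum_(0 <= j <oo) (`|u j - v j| `^ 4)%:E)%E.
  apply: le_trans (nneseries_lim_ge j.+1 (n0 u v)).
  rewrite big_nat_recr //= leeDr // sume_ge0 // => i _.
have big : ((`|side s a j - side s b j| `^ 4)%:E <= S1 + S2)%E.
  case: s => /=.
    by apply: le_trans (part (fun j => a.1 j) (fun j => b.1 j)) _; rewrite leeDl.
  have -> : `|- a.2 j - - b.2 j| = `|a.2 j - b.2 j| by rewrite -opprD normrN.
  by apply: le_trans (part (fun j => a.2 j) (fun j => b.2 j)) _; rewrite leeDr.
move=> hd; rewrite -lee_fin; apply: le_trans hd.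
have <- : ((`|side s a j - side s b j| `^ 4)%:E `^ 4^-1)%E = `|side s a j - side s b j|%:E.
  by rewrite poweR_EFin -powRrM mulfV ?powRr1 // pnatr_eq0.
apply: gt0_ler_poweR => //; rewrite ?invr_ge0 // in_itv /= ?leey ?andbT ?lee_fin ?powR_ge0 //.
by rewrite adde_ge0.
Qed.

(** Each of the two series is bounded by D^4, and 2 D^4 <= (2 D)^4. *)
Lemma dist4_le (a b : @pmseq R) (D : R) : 0 <= D ->
  (forall J, \sum_(j < J) (`|a.1 j - b.1 j| ^+ 4 + `|a.2 j - b.2 j| ^+ 4) <= D ^+ 4) ->
  (dist_p 4 a b <= (2 * D)%:E)%E.
Proof.
move=> D0 h; rewrite /dist_p.
have part (u v : nat -> R) : (forall J, \sum_(j < J) `|u j - v j| ^+ 4 <= D ^+ 4) ->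
    (\sum_(0 <= j <oo) (`|u j - v j| `^ 4)%:E <= (D ^+ 4)%:E)%E.
  move=> hu; apply: nneseries_le => [j|J]; first exact: powR_ge0.
  rewrite lee_fin; apply: le_trans (hu J); apply: ler_sum => j _.
  by rewrite powR_mulrn.
have n0 (u v : nat -> R) : (0 <= \sum_(0 <= j <oo) (`|u j - v j| `^ 4)%:E)%E.
  by apply: nneseries_ge0 => n _ _; rewrite lee_fin powR_ge0.
have -> : (2 * D)%:E = (((2 * D) `^ 4)%:E `^ 4^-1)%E.
  by rewrite poweR_EFin -powRrM mulfV ?powRr1 ?pnatr_eq0 // mulr_ge0.
apply: gt0_ler_poweR => //; rewrite ?invr_ge0 // ?in_itv /= ?leey ?andbT ?lee_fin ?powR_ge0 //.
  by rewrite adde_ge0 ?(n0 (fun j => a.1 j) (fun j => b.1 j)) ?(n0 (fun j => a.2 j) (fun j => b.2 j)).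
apply: (@le_trans _ _ ((D ^+ 4)%:E + (D ^+ 4)%:E)%E).
  apply: leeD; apply: part => J; apply: le_trans (h J); apply: ler_sum => j _.
  - by rewrite lerDl exprn_ge0.
  - by rewrite lerDr exprn_ge0.
rewrite -EFinD lee_fin powR_mulrn ?mulr_ge0 // exprMn -mulr2n.
have := exprn_ge0 4 D0; lra.
Qed.

(** Finitely many entries control d_4: beyond them the bound on squares makes entries small, and
    fourth powers gain that smallness. The same would fail for d_2. *)
Lemma dist4_trunc C (a b : @pmseq R) (eta : R) (J : nat) : l2pm C a -> l2pm C b -> 0 <= eta ->
  (forall s j, (j < J)%N -> `|side s a j - side s b j| <= eta) ->
  forall J', \sum_(j < J') (`|a.1 j - b.1 j| ^+ 4 + `|a.2 j - b.2 j| ^+ 4) <=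
    J%:R * (2 * eta ^+ 4) + 16 * C ^+ 2 / J.+1%:R.
Proof.
move=> ha hb e0 hd J'.
have C0 := l2pm_ge0 ha.
have mono : \sum_(j < J') (`|a.1 j - b.1 j| ^+ 4 + `|a.2 j - b.2 j| ^+ 4) <=
    \sum_(j < J + J') (`|a.1 j - b.1 j| ^+ 4 + `|a.2 j - b.2 j| ^+ 4).
  rewrite addnC big_split_ord /= lerDl sumr_ge0 // => i _; by rewrite addr_ge0 ?exprn_ge0.
apply: le_trans mono _; rewrite big_split_ord /=; apply: lerD.
  have -> : J%:R * (2 * eta ^+ 4) = \sum_(j < J) (eta ^+ 4 + eta ^+ 4).
    by rewrite sumr_const card_ord mulr_natl; congr (_ *+ _); ring.
  apply: ler_sum => j _; apply: lerD; rewrite ler_pXn2r ?nnegrE //.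
    exact: (hd true).
  by have := hd false j (ltn_ord j); rewrite /= -opprD normrN.
(* |x-y|^4 <= 8 (x^4+y^4) and x^4 <= (C/(J+1)) x^2 beyond J *)
have d4 (x y : R) : x ^+ 2 <= C / J.+1%:R -> y ^+ 2 <= C / J.+1%:R ->
    `|x - y| ^+ 4 <= 8 * (C / J.+1%:R) * (x ^+ 2 + y ^+ 2).
  move=> hx hy; rewrite -normrX ger0_norm ?exprn_even_ge0 //.
  apply: (@le_trans _ _ (8 * (x ^+ 4 + y ^+ 4))).
    rewrite -subr_ge0.
    have -> : 8 * (x ^+ 4 + y ^+ 4) - (x - y) ^+ 4 =
      6 * (x ^+ 2 - y ^+ 2) ^+ 2 + (x + y) ^+ 4 by ring.
    by rewrite addr_ge0 ?exprn_even_ge0 // mulr_ge0 ?sqr_ge0.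
  rewrite -mulrA ler_wpM2l // mulrDr (exprD x 2 2) (exprD y 2 2).
  by apply: lerD; rewrite ler_wpM2r ?sqr_ge0.
have hs xi s j : l2pm C xi -> side s xi (J + j) ^+ 2 <= C / J.+1%:R.
  move=> hx; rewrite ler_pdivlMr // mulrC; apply: le_trans (side_sqr_le s (J + j) hx).
  by rewrite ler_wpM2r ?sqr_ge0 // ler_nat ltnS leq_addr.
pose T := \sum_(j < J') (a.1 (J + j)%N ^+ 2 + a.2 (J + j)%N ^+ 2 + (b.1 (J + j)%N ^+ 2 + b.2 (J + j)%N ^+ 2)).
apply: (@le_trans _ _ (8 * (C / J.+1%:R) * T)).
  rewrite /T mulr_sumr; apply: ler_sum => j _.
  rewrite addrACA mulrDr; apply: lerD; apply: d4.
  - exact: (hs a true). - exact: (hs b true).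
  - by have := hs a false j ha; rewrite /= sqrrN.
  - by have := hs b false j hb; rewrite /= sqrrN.
have tail xi : l2pm C xi -> \sum_(j < J') (xi.1 (J + j)%N ^+ 2 + xi.2 (J + j)%N ^+ 2) <= C.
  move=> [_ /(_ (J + J')%N)]; apply: le_trans; rewrite /pL big_split_ord /= lerDr.
  by apply: sumr_ge0 => i _; rewrite addr_ge0 ?sqr_ge0.
have TC : T <= 2 * C by rewrite /T big_split /= mulr_natl mulr2n lerD ?tail.
have -> : 16 * C ^+ 2 / J.+1%:R = 8 * (C / J.+1%:R) * (2 * C) by ring.
by rewrite ler_wpM2l // mulr_ge0 // divr_ge0.
Qed.

End PointMeasures.

(** * From power sums to eigenvalues *)

Section PowerSums.
Context {R : realType}.

Definition ptr (q : {poly R}) n (A : 'M[R]_n) : R := \sum_(k < size q) q`_k * \tr (A ^+ k).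

Lemma ptr_eig (q : {poly R}) n (A : 'M[R]_n) : A^T = A ->
  ptr q A = \sum_(x <- eigseq A) q.[x].
Proof.
move=> sA; under [RHS]eq_bigr do rewrite horner_coef.
rewrite exchange_big /=; apply: eq_bigr => k _.
by rewrite -mulr_sumr; have [_ ->] := eigseqP sA.
Qed.

Lemma eig_sqr_le n (A : 'M[R]_n) C x : A^T = A -> fro A <= C -> x \in eigseq A -> x ^+ 2 <= C.
Proof.
move=> sA hC hx; apply: le_trans hC; rewrite fro_sym //; have [_ ->] := eigseqP sA.
rewrite (big_rem x hx) /= lerDl; apply: sumr_ge0 => y _; exact: sqr_ge0.
Qed.

(** The polynomial depends on the Frobenius bound but not on the size of the matrix, because the
    error is proportional to x^4. *)
Lemma lstat_ptr t l f (C eps : R) : vanish0 t l f -> 0 < C -> 0 < eps ->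
  exists q : {poly R}, (forall k, (k < 4)%N -> q`_k = 0) /\
    forall n (A : 'M[R]_n), A^T = A -> fro A <= C -> `|lstat f (EM A) - ptr q A| <= eps.
Proof.
move=> vf C0 e0.
(* Eigenvalues satisfy x^2 <= C, so the error x^4 eps / C^2 is at most x^2 eps / C, and the squares
   sum to at most C. *)
have [p hp] : exists p : {poly R}, forall x : R,
    `|x| <= Num.sqrt C -> `|f x - x ^+ 4 * p.[x]| <= eps / C ^+ 2 * x ^+ 4.
  by apply: vanish0_weierstrass vf _ _; rewrite ?sqrtr_gt0 ?divr_gt0 ?exprn_gt0.
exists ('X^4 * p); split=> [k k4|n A sA hA]; first by rewrite coefXnM k4.
rewrite (lstat_EM sA vf) ptr_eig // -sumrB.
apply: le_trans (ler_norm_sum _ _ _) _.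
apply: (@le_trans _ _ (\sum_(x <- eigseq A) eps / C ^+ 2 * (C * x ^+ 2))).
  rewrite !big_seq; apply: ler_sum => x hx.
  have xC := eig_sqr_le sA hA hx.
  rewrite hornerM hornerXn; apply: le_trans (hp _ _) _.
    by rewrite -sqrtr_sqr ler_wsqrtr.
  rewrite ler_wpM2l ?divr_ge0 ?exprn_ge0 ?(ltW e0) ?(ltW C0) //.
  by rewrite (exprD _ 2 2) ler_wpM2r // sqr_ge0.
rewrite -mulr_sumr -mulr_sumr; have [_ <-] := eigseqP sA; rewrite -fro_sym //.
have -> : eps / C ^+ 2 * (C * fro A) = eps * (fro A / C) by field; rewrite gt_eqF.
by rewrite -[leRHS]mulr1 ler_wpM2l ?(ltW e0) // ler_pdivrMr // mul1r.
Qed.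

(** Ramps are placed on a grid. If an entry of one spectrum exceeded its counterpart by more than
    [eta], some ramp would fit in the gap and its statistic would be at least j + 1 on one side and
    at most j on the other. Close traces keep all these statistics within distance less than 1. *)
Lemma EM_powersum_close (C eta : R) : 0 < C -> 0 < eta ->
  exists (K : nat) (delta : R), 0 < delta /\
    forall n m (A : 'M[R]_n) (B : 'M[R]_m), A^T = A -> B^T = B -> fro A <= C -> fro B <= C ->
      (forall k, (2 < k < K)%N -> `|\tr (A ^+ k) - \tr (B ^+ k)| <= delta) ->
      forall s j, `|side s (EM A) j - side s (EM B) j| <= eta.
Proof.
(* A ramp has width [h] and its start is found within [h] of the lower entry, hence half of
   [eta]. *)
move=> C0 eta0; pose h := eta / 2; have h0 : 0 < h by rewrite divr_gt0.
pose f (p : nat * bool) x := ramp (h * p.1.+1%:R) h (sgnR p.2 * x) : R.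
have vf p : vanish0 (h * p.1.+1%:R) h^-1 (f p) by apply: vanish0_ramp => //; rewrite mulr_gt0.
have /boolp.choice[q hq] : forall p, exists q : {poly R}, (forall k, (k < 4)%N -> q`_k = 0) /\
    forall n (A : 'M[R]_n), A^T = A -> fro A <= C -> `|lstat (f p) (EM A) - ptr q A| <= 4^-1.
  by move=> p; apply: lstat_ptr (vf p) C0 _; rewrite invr_gt0.
(* No entry exceeds the square root of C, so finitely many grid points suffice. *)
pose m := (Num.truncn (Num.sqrt C / h)).+1.
pose S := \sum_(i < m) \sum_(s : bool) \sum_(k < size (q (i : nat, s))) `|(q (i : nat, s))`_k|.
have S0 : 0 <= S by rewrite !sumr_ge0 // => i _; rewrite !sumr_ge0 // => s _; rewrite sumr_ge0.
exists (\max_(i < m) \max_(s : bool) size (q (i : nat, s))), (4^-1 / (1 + S)); split.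
  by rewrite divr_gt0 ?invr_gt0 // ltr_wpDr.
move=> n1 n2 A B sA sB hA hB hk.
(* Two approximations by traces and one comparison of traces, each within 1/4. *)
have close (i : nat) s : (i < m)%N -> `|lstat (f (i, s)) (EM A) - lstat (f (i, s)) (EM B)| < 1.
  move=> im; have [q0 hq1] := hq (i, s).
  have d1 : `|ptr (q (i, s)) A - ptr (q (i, s)) B| <= 4^-1.
    rewrite /ptr -sumrB; apply: le_trans (ler_norm_sum _ _ _) _.
    apply: (@le_trans _ _ (\sum_(k < size (q (i, s))) `|(q (i, s))`_k| * (4^-1 / (1 + S)))).
      apply: ler_sum => k _; rewrite -mulrBr normrM.
      case: (ltnP k 3) => k3; first by rewrite q0 ?normr0 ?mul0r // ltnW.
      rewrite ler_wpM2l // hk // k3 /=.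
      apply: leq_trans (ltn_ord k) _.
      apply: leq_trans (leq_bigmax (Ordinal im)) => /=.
      exact: (@leq_bigmax _ (fun s => size (q (i, s))) s).
    rewrite -mulr_suml mulrCA ger_pMr ?invr_gt0 // ler_pdivrMr ?ltr_wpDr // mul1r.
    apply: (@le_trans _ _ S); last by rewrite lerDr.
    rewrite /S (bigD1 (Ordinal im)) //= (bigD1 s) //= -addrA lerDl addr_ge0 //.
      by rewrite sumr_ge0 // => *; rewrite sumr_ge0.
    by rewrite sumr_ge0 // => *; rewrite sumr_ge0 // => *; rewrite sumr_ge0.
  have d2 := hq1 _ _ sA hA; have d3 := hq1 _ _ sB hB.
  move: d1 d2 d3; rewrite !ler_norml ltr_norml; lra.
have lA := l2pm_EM sA hA; have lB := l2pm_EM sB hB.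
have main xi xi' s j : l2pm C xi -> l2pm C xi' ->
   (forall i, (i < m)%N -> `|lstat (f (i, s)) xi - lstat (f (i, s)) xi'| < 1) ->
   side s xi j <= side s xi' j + eta.
  move=> hx hx' hc; rewrite leNgt; apply/negP => lt.
  set b := side s xi' j in lt.
  have b0 : 0 <= b by apply: side_ge0; case: hx'.
  (* The ramp starting at the first grid point above [b]. *)
  pose i := Num.truncn (b / h).
  have ib : b <= h * i.+1%:R.
    by rewrite mulrC -ler_pdivrMr // ltW // truncnS_gt.
  have bi : h * i%:R <= b.
    by rewrite mulrC -ler_pdivlMr // truncn_le // divr_ge0 // ltW.
  have ta : h * i.+1%:R + h <= side s xi j.
    apply/ltW; apply: le_lt_trans lt; rewrite -natr1 mulrDr mulr1.
    rewrite /h in bi *; lra.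
  have im : (i < m)%N.
    rewrite /m ltnS; apply: le_truncn; rewrite ler_wpM2r ?invr_ge0 ?(ltW h0) //.
    apply: (@le_trans _ _ (side s xi j)); first by apply: ltW; apply: le_lt_trans lt; rewrite lerDl ltW.
    have a0 : 0 <= side s xi j by apply: side_ge0; case: hx.
    rewrite -(ger0_norm a0) -sqrtr_sqr ler_wsqrtr //.
    by apply: le_trans (side_sqr_le s j hx); rewrite ler_peMl ?sqr_ge0 // ler1n.
  have := hc _ im.
  have h1 := lstat_ramp_ge (mulr_gt0 h0 (ltr0Sn R i)) h0 hx ta.
  have h2 := lstat_ramp_le (mulr_gt0 h0 (ltr0Sn R i)) h0 hx' ib.
  rewrite /f /= -natr1 in h1 h2 *; rewrite ltr_norml; lra.
move=> s j; rewrite ler_norml lerBlDr lerNl opprB lerBlDr.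
rewrite !(addrC eta).
apply/andP; split; apply: main => // i im; last exact: close.
by rewrite distrC; exact: close.
Qed.

End PowerSums.

(** * Measurability of ordered eigenvalues *)

Section MeasurableEigenvalues.
Context {R : realType} d (T : measurableType d).
Variables (n : nat) (A : T -> 'M[R]_n).
Hypothesis mA : forall i j, measurable_fun setT (fun w => A w i j).
Hypothesis sA : forall w, (A w)^T = A w.

Lemma measurable_expmx k i j : measurable_fun setT (fun w => (A w ^+ k) i j).
Proof.
elim: k i j => [|k IH] i j.
  by under eq_fun do rewrite expr0 mxE; exact: measurable_cst.
under eq_fun do rewrite exprS mxE.
by apply: measurable_sum => l; apply: measurable_funM.
Qed.

Lemma measurable_ptr q : measurable_fun setT (fun w => ptr q (A w)).
Proof.
apply: measurable_sum => k; apply: measurable_funM; first exact: measurable_cst.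
by apply: measurable_sum => i; exact: measurable_expmx.
Qed.

(** A pointwise limit of polynomials in the entries: for each [w] the bound [fro (A w) <= m.+1%:R]
    holds eventually. *)
Lemma measurable_lstat_EM t l f : vanish0 t l f ->
  measurable_fun setT (fun w => lstat f (EM (A w))).
Proof.
move=> vf.
have /boolp.choice[q hq] : forall m : nat, exists q : {poly R}, (forall k, (k < 4)%N -> q`_k = 0) /\
    forall n (A : 'M[R]_n), A^T = A -> fro A <= m.+1%:R -> `|lstat f (EM A) - ptr q A| <= m.+1%:R^-1.
  by move=> m; apply: lstat_ptr vf _ _; rewrite ?invr_gt0.
apply: (@measurable_fun_cvg _ _ _ _ (fun m w => ptr (q m) (A w))); first by move=> m; exact: measurable_ptr.
move=> w _; apply/cvgrPdist_le => e e0.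
near=> m; have [_ h] := hq m.
apply: le_trans (h _ _ (sA w) _) _.
  apply: (@le_trans _ _ m%:R); last by rewrite ler_nat.
  by near: m; exact: nbhs_infty_ger.
rewrite invf_ple ?posrE //; apply: (@le_trans _ _ m%:R); last by rewrite ler_nat.
by near: m; exact: nbhs_infty_ger.
Unshelve. all: by end_near.
Qed.

Lemma measurable_side_EM s j : measurable_fun setT (fun w => side s (EM (A w)) j).
Proof.
apply: (measurability _ (RGenOInfty.measurableE R)) => _ [_ [x ->] <-]; rewrite setTI.
(* For y > 0 the entry exceeds [y] exactly when some ramp starting at [y] has statistic above [j].
   Threshold 0 is reached by a union, negative ones are trivial. *)
have pos (y : R) : 0 < y -> measurable ((fun w => side s (EM (A w)) j) @^-1` `]y, +oo[).
  move=> y0.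
  have -> : (fun w => side s (EM (A w)) j) @^-1` `]y, +oo[ =
     \bigcup_m [set w | j%:R < lstat (fun x => ramp y m.+1%:R^-1 (sgnR s * x)) (EM (A w))].
    apply/seteqP; split=> w /=.
      rewrite in_itv /= andbT => yw.
      have d0 : 0 < side s (EM (A w)) j - y by rewrite subr_gt0.
      exists (Num.truncn (side s (EM (A w)) j - y)^-1) => //=.
      apply: (@lt_le_trans _ _ j.+1%:R); first by rewrite ltr_nat.
      apply: lstat_ramp_ge y0 _ (l2pm_EM (sA w) (lexx _)) _.
        by rewrite invr_gt0.
      rewrite -lerBrDl invf_ple ?posrE //; exact/ltW/truncnS_gt.
    move=> [m _ /=]; rewrite in_itv /= andbT; apply: contraTT; rewrite -!leNgt => yw.
    by apply: lstat_ramp_le (l2pm_EM (sA w) (lexx _)) yw => //; rewrite invr_gt0.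
  apply: bigcup_measurable => m _.
  have mf := @measurable_lstat_EM _ _ _ (@vanish0_ramp R s y m.+1%:R^-1 y0 _).
  rewrite (_ : [set w | _] = (fun w => lstat (fun x => ramp y m.+1%:R^-1 (sgnR s * x)) (EM (A w))) @^-1` `]j%:R, +oo[).
    by rewrite -[X in measurable X]setTI; apply: mf => //; rewrite ?invr_gt0.
  by apply/seteqP; split=> w /=; rewrite in_itv /= andbT.
case: (ltrP 0 x) => x0; first exact: pos.
case: (ltrP x 0) => x1.
  rewrite (_ : _ @^-1` _ = setT) //; apply/seteqP; split=> w //= _.
  rewrite in_itv /= andbT; apply: lt_le_trans x1 _; apply: side_ge0; exact: canonical_EM.
have -> : x = 0 by apply/eqP; rewrite eq_le x0 x1.
have -> : (fun w => side s (EM (A w)) j) @^-1` `]0, +oo[ =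
    \bigcup_m (fun w => side s (EM (A w)) j) @^-1` `]m.+1%:R^-1, +oo[.
  apply/seteqP; split=> w /=.
    rewrite in_itv /= andbT => w0; exists (Num.truncn (side s (EM (A w)) j)^-1) => //=.
    by rewrite in_itv /= andbT invf_plt ?posrE // truncnS_gt.
  move=> [m _ /=]; rewrite !in_itv /= !andbT; apply: le_lt_trans; by rewrite invr_ge0.
by apply: bigcup_measurable => m _; apply: pos; rewrite invr_gt0.
Qed.

End MeasurableEigenvalues.

(** * Integrals and events of high probability *)

Lemma ler_dist3 (R : realType) (a b c e x y z : R) :
  `|a - b| <= x -> `|b - c| <= y -> `|c - e| <= z -> `|a - e| <= x + y + z.
Proof.
move=> h1 h2 h3; have -> : a - e = (a - b) + (b - c) + (c - e) by ring.
by apply: le_trans (ler_normD _ _) (lerD (le_trans (ler_normD _ _) (lerD h1 h2)) h3).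
Qed.

Section FiniteIntegral.
Context {R : realType} d (T : measurableType d).
Variable mu : {finite_measure set T -> \bar R}.
Implicit Types f g : T -> R.

Definition itg f := mu.-integrable setT (EFin \o f).

Lemma itg_meas f : itg f -> measurable_fun setT f.
Proof. by case/integrableP => /measurable_EFinP. Qed.

Lemma itg_bounded f (C : R) : measurable_fun setT f -> (forall x, `|f x| <= C) -> itg f.
Proof.
move=> mf hC; apply: measurable_bounded_integrable => //.
  exact: fin_num_fun_lty.
exists C; split; first exact: num_real.
by move=> M CM x _; apply: le_trans (hC x) (ltW CM).
Qed.

Lemma itg_cst (c : R) : itg (fun=> c).
Proof. exact: (@itg_bounded _ `|c|). Qed.

Lemma itg_le f g : measurable_fun setT f -> (forall x, `|f x| <= g x) -> itg g -> itg f.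
Proof.
move=> mf fg ig; apply: le_integrable ig => //; first exact/measurable_EFinP.
by move=> x _ /=; rewrite lee_fin (le_trans (fg x)) // ler_norm.
Qed.

Lemma itgD f g : itg f -> itg g -> itg (fun x => f x + g x).
Proof. by move=> i1 i2; exact: (integrableD measurableT i1 i2). Qed.

Lemma itgZ (c : R) f : itg f -> itg (fun x => c * f x).
Proof. by move=> i1; exact: (integrableZl measurableT c i1). Qed.

Lemma itgB f g : itg f -> itg g -> itg (fun x => f x - g x).
Proof. by move=> i1 i2; exact: (integrableB measurableT i1 i2). Qed.

Lemma itg_norm f : itg f -> itg (fun x => `|f x|).
Proof. exact: integrable_norm. Qed.

Lemma itg_sum (I : Type) (s : seq I) (F : I -> T -> R) : (forall i, itg (F i)) ->
  itg (fun x => \sum_(i <- s) F i x).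
Proof.
move=> h; elim: s => [|i s IH].
  by under eq_fun do rewrite big_nil; exact: itg_cst.
by under eq_fun do rewrite big_cons; exact: itgD.
Qed.

Lemma IntD f g : itg f -> itg g ->
  \int[mu]_x (f x + g x) = \int[mu]_x f x + \int[mu]_x g x.
Proof. exact: RintegralD. Qed.

Lemma IntB f g : itg f -> itg g ->
  \int[mu]_x (f x - g x) = \int[mu]_x f x - \int[mu]_x g x.
Proof. exact: RintegralB. Qed.

Lemma IntZ (c : R) f : itg f -> \int[mu]_x (c * f x) = c * \int[mu]_x f x.
Proof. by move=> i; rewrite RintegralZl. Qed.

Lemma Int_sum (I : Type) (s : seq I) (F : I -> T -> R) : (forall i, itg (F i)) ->
  \int[mu]_x (\sum_(i <- s) F i x) = \sum_(i <- s) \int[mu]_x F i x.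
Proof.
move=> h; elim: s => [|i s IH].
  by rewrite big_nil; under eq_Rintegral do rewrite big_nil; rewrite Rintegral_cst // mul0r.
rewrite big_cons -IH -IntD //; last exact: itg_sum.
by apply: eq_Rintegral => x _; rewrite big_cons.
Qed.

Lemma Int_le f g : itg f -> itg g -> (forall x, f x <= g x) ->
  \int[mu]_x f x <= \int[mu]_x g x.
Proof. by move=> i1 i2 h; apply: le_Rintegral. Qed.

Lemma Int_ge0 f : (forall x, 0 <= f x) -> 0 <= \int[mu]_x f x.
Proof. by move=> h; apply: Rintegral_ge0. Qed.

Lemma Int_norm f : itg f -> `|\int[mu]_x f x| <= \int[mu]_x `|f x|.
Proof. by move=> i; apply: le_normr_Rintegral. Qed.

Definition tmass : R := fine (mu setT).

Lemma tmass_ge0 : 0 <= tmass.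
Proof. by rewrite /tmass fine_ge0. Qed.

Lemma Int_cst (c : R) : \int[mu]_x c = c * tmass.
Proof. by rewrite Rintegral_cst. Qed.

Lemma Int_bound f (C : R) : measurable_fun setT f -> (forall x, `|f x| <= C) ->
  `|\int[mu]_x f x| <= C * tmass.
Proof.
move=> mf h; have i := itg_bounded mf h.
apply: le_trans (Int_norm i) _; rewrite -Int_cst.
by apply: Int_le => //; [exact: itg_norm|exact: itg_cst].
Qed.

Lemma EFin_Int f : itg f -> (\int[mu]_x f x)%:E = (\int[mu]_x (f x)%:E)%E.
Proof. by move=> i; rewrite /Rintegral fineK // integrable_fin_num. Qed.

Lemma Int_indic (A : set T) : measurable A -> \int[mu]_x (\1_A x : R) = fine (mu A).
Proof. by move=> mA; rewrite /Rintegral integral_indic // setIT. Qed.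

Lemma itg_indic (A : set T) : measurable A -> itg (\1_A : T -> R).
Proof. by move=> mA; exact: integrable_indic. Qed.

Lemma Int_dct (F : nat -> T -> R) (f : T -> R) (C : R) :
  (forall n, measurable_fun setT (F n)) -> (forall n x, `|F n x| <= C) ->
  (forall x, F n x @[n --> \oo] --> f x) ->
  \int[mu]_x F n x @[n --> \oo] --> \int[mu]_x f x.
Proof.
move=> mF hC cF.
have mf : measurable_fun setT f by apply: measurable_fun_cvg mF _ => x _; exact: cF.
have fC x : `|f x| <= C.
  have c : `|F n x| @[n --> \oo] --> `|f x| by apply: cvg_norm; exact: cF.
  rewrite -(cvg_lim _ c) //.
  apply: limr_le; first by apply/cvg_ex; eexists; exact: c.
  by apply: nearW => n; exact: hC.
have := @dominated_cvg _ _ _ mu setT measurableT (fun n => EFin \o F n) (EFin \o f) (cst C%:E).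
move=> /(_ _ _ _ _ _)/wrap[].
- by move=> n; exact/measurable_EFinP.
- by move=> x _; apply: cvg_EFin; [exact: nearW|exact: cF].
- by [].
- exact: itg_cst.
- by move=> n x _ /=; rewrite lee_fin.
move=> h; rewrite /Rintegral; apply: fine_cvg; rewrite fineK //.
exact/integrable_fin_num/(itg_bounded mf fC).
Qed.

End FiniteIntegral.

(** * Events of high probability *)

Section WithHighProbability.
Context {R : realType} d (T : measurableType d) (P : probability T R).

(** The exceptional set is existential, so [Q] itself need not be measurable. *)
Definition whp (e : R) (Q : T -> Prop) : Prop :=
  exists E : set T, [/\ measurable E, (P E <= e%:E)%E & forall w, ~ E w -> Q w].

Lemma whp_imp e Q Q' : (forall w, Q w -> Q' w) -> whp e Q -> whp e Q'.
Proof. by move=> h [E [mE PE HE]]; exists E; split=> // w /HE/h. Qed.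

Lemma whp_le e e' Q : e <= e' -> whp e Q -> whp e' Q.
Proof. by move=> h [E [mE PE HE]]; exists E; split=> //; apply: le_trans PE _; rewrite lee_fin. Qed.

Lemma whp_true e (Q : T -> Prop) : 0 <= e -> (forall w, Q w) -> whp e Q.
Proof. by move=> e0 h; exists set0; split => //; rewrite measure0 lee_fin. Qed.

Lemma whp_and e1 e2 Q1 Q2 : whp e1 Q1 -> whp e2 Q2 -> whp (e1 + e2) (fun w => Q1 w /\ Q2 w).
Proof.
move=> [E1 [m1 P1 H1]] [E2 [m2 P2 H2]]; exists (E1 `|` E2); split.
- exact: measurableU.
- by apply: le_trans (measureU2 _ _ _) _ => //; rewrite EFinD leeD.
- by move=> w nE; split; [apply: H1|apply: H2]; apply: contra_not nE; [left|right].
Qed.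

Lemma whp_all (I : eqType) (s : seq I) (e : R) (Q : I -> T -> Prop) : 0 <= e ->
  (forall i, i \in s -> whp e (Q i)) -> whp ((size s)%:R * e) (fun w => forall i, i \in s -> Q i w).
Proof.
move=> e0; elim: s => [|i s IH] h; first by rewrite mul0r; apply: whp_true.
have := whp_and (h i (mem_head _ _)) (IH (fun j js => h j (mem_behead (s := i :: s) js))).
rewrite /= -natr1 mulrDl mul1r addrC; apply: whp_imp => w [h1 h2] j.
by rewrite in_cons => /predU1P[->|]; [exact: h1|exact: h2].
Qed.

Lemma whp_P e (S : set T) : measurable S -> whp e (fun w => ~ S w) -> (P S <= e%:E)%E.
Proof.
move=> mS [E [mE PE HE]]; apply: le_trans PE; apply: le_measure; rewrite ?inE //.
by move=> w Sw; apply: contrapT => /HE.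
Qed.

Lemma whp_of_P e (S : set T) : measurable S -> (P S <= e%:E)%E -> whp e (fun w => ~ S w).
Proof. by move=> mS PS; exists S. Qed.

Lemma measurable_gt (f : T -> R) (a : R) : measurable_fun setT f -> measurable [set w | a < f w].
Proof.
move=> mf; rewrite (_ : [set w | _] = f @^-1` `]a, +oo[).
  by rewrite -[X in measurable X]setTI; exact: mf.
by apply/seteqP; split=> w /=; rewrite in_itv /= andbT.
Qed.

Lemma measurable_le_set (f : T -> R) (a : R) : measurable_fun setT f -> measurable [set w | f w <= a].
Proof.
move=> mf; rewrite (_ : [set w | _] = ~` [set w | a < f w]).
  exact/measurableC/measurable_gt.
by apply/seteqP; split=> w /=; [rewrite leNgt => /negP|move=> /negP; rewrite leNgt].
Qed.

Lemma whp_markov (f : T -> R) (a e : R) : 0 < a -> itg P f -> (forall w, 0 <= f w) ->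
  \int[P]_w f w <= a * e -> whp e (fun w => f w <= a).
Proof.
move=> a0 fi f0 fe; exists [set w | a < f w].
have mS := measurable_gt a (itg_meas fi).
split=> //; last by move=> w /= /negP; rewrite leNgt.
have h : a * fine (P [set w | a < f w]) <= \int[P]_w f w.
  rewrite -Int_indic // -IntZ; last exact: itg_indic.
  apply: Int_le => //; first by apply: itgZ; exact: itg_indic.
  move=> w; rewrite indicE; case: (boolP (w \in _)) => hw; last by rewrite mulr0.
  by rewrite mulr1; move: hw; rewrite inE /= => /ltW.
have := le_trans h fe; rewrite ler_pM2l // -lee_fin fineK //.
by rewrite fin_num_measure.
Qed.

(** Off the exceptional set the difference is at most [dl], on it at most 2. *)
Lemma Ex_close (f g : T -> R) (dl e : R) : 0 <= e -> 0 <= dl -> measurable_fun setT f -> measurable_fun setT g ->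
  (forall w, `|f w| <= 1) -> (forall w, `|g w| <= 1) ->
  whp e (fun w => `|f w - g w| <= dl) ->
  `|\int[P]_w f w - \int[P]_w g w| <= dl + 2 * e.
Proof.
move=> e0 dl0 mf mg f1 g1 [E [mE PE HE]].
have fi : itg P f by apply: itg_bounded f1.
have gi : itg P g by apply: itg_bounded g1.
rewrite -IntB //; apply: le_trans (Int_norm (itgB fi gi)) _.
apply: (@le_trans _ _ (\int[P]_w (dl + 2 * (\1_E w : R)))).
  apply: Int_le.
  - exact/itg_norm/itgB.
  - by apply: itgD; [exact: itg_cst|apply: itgZ; exact: itg_indic].
  - move=> w; rewrite indicE; case: (boolP (w \in E)) => hw.
      rewrite mulr1; apply: le_trans (ler_normB _ _) _.
      by have := f1 w; have := g1 w; lra.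
    by rewrite mulr0 addr0 HE //; move: hw; rewrite notin_setE.
rewrite IntD; [|exact: itg_cst|by apply: itgZ; exact: itg_indic].
rewrite Int_cst IntZ ?Int_indic //; last exact: itg_indic.
have -> : tmass P = 1 by rewrite /tmass; have /= -> := @probability_setT _ _ _ P.
rewrite mulr1 lerD2l ler_wpM2l //.
by rewrite -lee_fin fineK // fin_num_measure.
Qed.

End WithHighProbability.

(** * Gaussian fields *)

Section StandardNormal.
Context {R : realType}.
Local Notation leb := (@lebesgue_measure R).

(** The Radon-Nikodym derivative agrees almost everywhere with the normal density, as both integrate
    to the same measure. *)
Lemma ge0_integral_normal_prob (m s : R) (f : R -> \bar R) : (forall x, (0 <= f x)%E) ->
  measurable_fun setT f ->
  (\int[normal_prob m s]_x f x = \int[leb]_x (f x * (normal_pdf m s x)%:E))%E.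
Proof.
move=> f0 mf.
have dom := normal_prob_dominates m s.
rewrite -(Radon_Nikodym_SigmaFinite.change_of_variables dom) //.
apply: ae_eq_integral => //.
- apply: emeasurable_funM => //; apply: (measurable_int leb).
  exact: Radon_Nikodym_SigmaFinite.f_integrable.
- apply: emeasurable_funM => //=; apply/measurable_EFinP; exact: measurable_normal_pdf.
- apply: ae_eqe_mul2l => /=.
  apply: integral_ae_eq => //=.
  + exact: Radon_Nikodym_SigmaFinite.f_integrable.
  + by apply/measurable_EFinP; exact: measurable_normal_pdf.
  + move=> E _ mE; rewrite -Radon_Nikodym_SigmaFinite.f_integral //.
Qed.

Definition gam : probability (measurableTypeR R) R := normal_prob 0 1.

Lemma ge0_integral_normal_scale (s : R) (g : R -> R) : 0 < s -> (forall x, 0 <= g x) ->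
  continuous g ->
  (\int[normal_prob 0 s]_x (g x)%:E = \int[gam]_x (g (s * x))%:E)%E.
Proof.
move=> s0 g0 cg.
have mg : measurable_fun setT g by exact: continuous_measurable_fun.
rewrite ge0_integral_normal_prob; [|by move=> x; rewrite lee_fin|by apply/measurable_EFinP].
rewrite /gam ge0_integral_normal_prob; [|by move=> x; rewrite lee_fin|]; last first.
  apply/measurable_EFinP; apply: measurableT_comp => //; exact: measurable_funM.
under eq_integral do rewrite -EFinM.
pose F (x : R) := s * x.
have dF (x : R) : is_derive x (1 : R) F s.
  by apply: is_derive_eq; rewrite scaler1.
have F' : F^`()%classic = cst s.
  by apply/funext => x; rewrite derive1E; have [_ ->] := dF x.
have s1 : s != 0 by rewrite gt_eqF.
rewrite (@increasing_ge0_integration_by_substitutionT _ F (fun x => g x * normal_pdf 0 s x)).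
- apply: eq_integral => x _; rewrite -EFinM; congr EFin; rewrite F' !fctE /F.
  rewrite -mulrA; congr (_ * _).
  rewrite !normal_pdfE ?oner_neq0 // /normal_peak /normal_fun !subr0.
  have -> : - (s * x) ^+ 2 / (s ^+ 2 *+ 2) = - x ^+ 2 / (1 ^+ 2 *+ 2).
    by rewrite expr1n exprMn -mulr_natr; field; rewrite s1.
  rewrite mulrAC; congr (_ * _).
  rewrite expr1n mul1r -mulrnAr sqrtrM ?sqr_ge0 // sqrtr_sqr gtr0_norm //.
  rewrite invfM mulrAC mulVf // mul1r.
  by [].
- by move=> x y xy; rewrite /F ltr_pM2l.
- by rewrite F' => x; exact: cvg_cst.
- by rewrite F'; exact: is_cvg_cst.
- by rewrite F'; exact: is_cvg_cst.
- by move=> x; have [] := dF x.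
- rewrite /F; under eq_fun do rewrite mulrC; apply: gt0_cvgMlNy => //; exact: cvg_id.
- rewrite /F; under eq_fun do rewrite mulrC; apply: gt0_cvgMly => //; exact: cvg_id.
- move=> x; apply: cvgM; first exact: cg.
  exact: continuous_normal_pdf.
- by move=> x; rewrite mulr_ge0 // normal_pdf_ge0.
Qed.

Lemma gauss0_integral d (T : measurableType d) (P : probability T R) (Y : T -> R) (v : R)
    (g : R -> R) :
  measurable_fun setT Y -> 0 <= v ->
  (forall A : set R, measurable A -> P (Y @^-1` A) = gauss0 v A) ->
  (forall x, 0 <= g x) -> continuous g ->
  (\int[P]_w (g (Y w))%:E = \int[gam]_x (g (Num.sqrt v * x))%:E)%E.
Proof.
move=> mY v0 hY g0 cg.
have mg : measurable_fun setT g by exact: continuous_measurable_fun.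
pose Y' : T -> measurableTypeR R := Y.
have -> : (\int[P]_w (g (Y w))%:E = \int[pushforward P Y']_(x in setT) (g x)%:E)%E.
  rewrite ge0_integral_pushforward ?preimage_setT //; first by apply/measurable_EFinP.
  by move=> x _; rewrite lee_fin.
(* The degenerate law is the Dirac mass at 0, in agreement with the scaling factor sqrt 0. *)
have [v1|v1] := eqVneq v 0.
  rewrite (@eq_measure_integral _ _ _ _ (\d_(0 : measurableTypeR R)) (pushforward P Y')); last first.
    by move=> A mA _; have := hY A mA; rewrite /gauss0 v1 eqxx.
  rewrite integral_dirac //; last exact/measurable_EFinP.
  rewrite diracT mul1e v1 sqrtr0.
  under eq_integral do rewrite mul0r.
  rewrite integral_cst // -[LHS]mule1; congr (_ * _)%E.
  by symmetry; exact: probability_setT.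
rewrite (@eq_measure_integral _ _ _ _ (normal_prob 0 (Num.sqrt v)) (pushforward P Y')); last first.
  by move=> A mA _; have := hY A mA; rewrite /gauss0 (negbTE v1).
by rewrite ge0_integral_normal_scale // sqrtr_gt0 lt_neqAle eq_sym v1.
Qed.

Lemma gam_pow4_itg : itg gam (fun x => x ^+ 4).
Proof.
apply/integrableP; split; first by apply/measurable_EFinP; exact: exprn_measurable.
rewrite ge0_integral_normal_prob; last 2 first.
- by move=> x; rewrite abse_ge0.
- by apply: measurableT_comp => //; apply/measurable_EFinP; exact: exprn_measurable.
have p2 : 0 < normal_peak (2 : R) by exact: normal_peak_gt0.
(* x^4 = 256/9 (3 x^2 / 16)^2 <= 256/9 exp (3 x^2 / 8), and this exponential turns the standard
   density into that of standard deviation 2. *)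
pose K : R := 256 / 9 * (normal_peak 1 / normal_peak 2).
apply: (@le_lt_trans _ _ (\int[leb]_x (K%:E * (normal_pdf 0 2 x)%:E))%E).
  apply: ge0_le_integral => //.
  - by move=> x _; rewrite mule_ge0 // lee_fin normal_pdf_ge0.
  - apply: emeasurable_funM; last by apply/measurable_EFinP; exact: measurable_normal_pdf.
    by apply: measurableT_comp => //; apply/measurable_EFinP; exact: exprn_measurable.
  - by apply/measurable_EFinP; apply: measurable_funM => //; exact: measurable_normal_pdf.
  - move=> x _; rewrite -EFinM lee_fin !normal_pdfE ?oner_neq0 ?pnatr_eq0 // /K.
    rewrite ger0_norm ?exprn_even_ge0 // /normal_fun !subr0.
    have -> : 256 / 9 * (normal_peak 1 / normal_peak 2) *
      (normal_peak 2 * expR (- x ^+ 2 / (2 ^+ 2 *+ 2))) =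
      normal_peak 1 * (256 / 9 * expR (- x ^+ 2 / (2 ^+ 2 *+ 2))).
      by field; rewrite gt_eqF.
    rewrite mulrCA ler_wpM2l ?normal_peak_ge0 //.
    have -> : - x ^+ 2 / (2 ^+ 2 *+ 2) = - x ^+ 2 / (1 ^+ 2 *+ 2) + 3 / 8 * x ^+ 2 by field.
    rewrite expRD mulrCA mulrC ler_wpM2l ?expR_ge0 //.
    have -> : 3 / 8 * x ^+ 2 = 3 / 16 * x ^+ 2 + 3 / 16 * x ^+ 2 by field.
    rewrite expRD -expr2.
    have h : 3 / 16 * x ^+ 2 <= expR (3 / 16 * x ^+ 2).
      by apply: le_trans (expR_ge1Dx _); rewrite lerDr.
    have h2 : (3 / 16 * x ^+ 2) ^+ 2 <= expR (3 / 16 * x ^+ 2) ^+ 2.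
      by rewrite ler_pXn2r // ?nnegrE ?expR_ge0 // mulr_ge0 // sqr_ge0.
    have -> : x ^+ 4 = 256 / 9 * (3 / 16 * x ^+ 2) ^+ 2 by field.
    by rewrite ler_wpM2l.
rewrite integralZl //; last exact: integrable_normal_pdf.
by rewrite integral_normal_pdf mule1 ltry.
Qed.

Definition gm4 : R := \int[gam]_x (x ^+ 4).
Definition gm2 : R := \int[gam]_x (x ^+ 2).

Lemma gam_pow2_itg : itg gam (fun x => x ^+ 2).
Proof.
apply: (@itg_le _ _ _ gam (fun x : measurableTypeR R => x ^+ 2) (fun x : measurableTypeR R => 1 + x ^+ 4)).
- exact: exprn_measurable.
- move=> x; rewrite ger0_norm ?sqr_ge0 // (exprD x 2 2) -subr_ge0.
  have -> : 1 + x ^+ 2 * x ^+ 2 - x ^+ 2 = (x ^+ 2 - 2^-1) ^+ 2 + 3 / 4 by field.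
  by rewrite addr_ge0 // sqr_ge0.
- by apply: itgD; [exact: itg_cst|exact: gam_pow4_itg].
Qed.

(* E cos (Y + b) for a centred Gaussian Y of second moment m; gm2 = 1 and gm4 = 3 are never computed *)
Definition gcos (b m : R) : R := \int[gam]_x cos (Num.sqrt (m / gm2) * x + b).

Lemma measurable_cosR : measurable_fun setT (cos : R -> R).
Proof. by apply: continuous_measurable_fun; exact: continuous_cos. Qed.

Lemma measurable_cos_affine (a b : R) : measurable_fun setT (fun x : R => cos (a * x + b)).
Proof.
apply: measurableT_comp; first exact: measurable_cosR.
by apply: measurable_funD => //; apply: measurable_funM.
Qed.

Lemma cos_abs_le1 (x : R) : `|cos x| <= 1.
Proof. by rewrite ler_norml cos_geN1 cos_le1. Qed.

Lemma gcos_cvg (b : R) (m : nat -> R) (l : R) : m n @[n --> \oo] --> l ->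
  gcos b (m n) @[n --> \oo] --> gcos b l.
Proof.
move=> ml; apply: (@Int_dct _ _ _ gam _ _ 1).
- by move=> n; exact: measurable_cos_affine.
- by move=> n x; exact: cos_abs_le1.
- move=> x; apply: (cvg_comp _ cos); last exact: continuous_cos.
  apply: cvgD; last exact: cvg_cst.
  apply: cvgM; last exact: cvg_cst.
  apply: (cvg_comp _ Num.sqrt); last exact: sqrt_continuous.
  by apply: cvgM => //; exact: cvg_cst.
Qed.

End StandardNormal.

(** * Moments of linear combinations of the field *)

Section GaussianLincomb.
Context {R : realType} d (T : measurableType d) (P : probability T R).
Variable X : int -> int -> T -> R.
Hypothesis gX : centered_gaussian P X.
Hypothesis vX : positive_variance P X.

Lemma measurable_lincomb s : measurable_fun setT (lincomb X s).
Proof.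
case: gX => mX _; apply: measurable_sum => p.
by apply: measurable_funM.
Qed.

Lemma lincomb_lin (a : R) s1 s2 w :
  lincomb X (map (fun p => (p.1, a * p.2)) s1 ++ s2) w = a * lincomb X s1 w + lincomb X s2 w.
Proof.
rewrite /lincomb big_cat big_map /=; congr (_ + _); rewrite mulr_sumr.
by apply: eq_bigr => p _; rewrite mulrA.
Qed.

Lemma lincomb1 i j w : lincomb X [:: ((i, j), 1)] w = X i j w.
Proof. by rewrite /lincomb big_seq1 mul1r. Qed.

Lemma lincomb_law s : exists v : R, 0 <= v /\ forall g : R -> R, (forall x, 0 <= g x) -> continuous g ->
  (\int[P]_w (g (lincomb X s w))%:E = \int[gam]_x (g (Num.sqrt v * x))%:E)%E.
Proof.
case: gX => mX /(_ s) [v [v0 hv]]; exists v; split=> // g g0 cg.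
by apply: gauss0_integral => //; exact: measurable_lincomb.
Qed.

Lemma continuous_expn (n : nat) : continuous (fun x : R => x ^+ n).
Proof. exact: exprn_continuous. Qed.

Lemma lincomb_pow (s : seq ((int * int) * R)) : exists v : R, [/\
  itg P (fun w => lincomb X s w ^+ 4), itg P (fun w => lincomb X s w ^+ 2),
  \int[P]_w (lincomb X s w ^+ 4) = v ^+ 2 * gm4, \int[P]_w (lincomb X s w ^+ 2) = v * gm2 &
  forall b, \int[P]_w cos (lincomb X s w + b) = \int[gam]_x cos (Num.sqrt v * x + b)].
Proof.
have [v [v0 hv]] := lincomb_law s; exists v.
have mL := measurable_lincomb s.
have e4 : (\int[P]_w (lincomb X s w ^+ 4)%:E = (v ^+ 2 * gm4)%:E)%E.
  rewrite (hv (fun x => x ^+ 4)); [|by move=> x; rewrite exprn_even_ge0|exact: continuous_expn].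
  under eq_integral do rewrite exprMn.
  rewrite /gm4 -IntZ ?EFin_Int //; [|exact/itgZ/gam_pow4_itg|exact: gam_pow4_itg].
  by apply: eq_integral => x _; rewrite (exprM _ 2 2) sqr_sqrtr.
have e2 : (\int[P]_w (lincomb X s w ^+ 2)%:E = (v * gm2)%:E)%E.
  rewrite (hv (fun x => x ^+ 2)); [|by move=> x; rewrite sqr_ge0|exact: continuous_expn].
  rewrite /gm2 -IntZ ?EFin_Int //; [|exact/itgZ/gam_pow2_itg|exact: gam_pow2_itg].
  by apply: eq_integral => x _; rewrite exprMn sqr_sqrtr.
split=> //.
- apply/integrableP; split; first by apply/measurable_EFinP; exact: measurable_funX.
  under eq_integral do rewrite /= ger0_norm ?exprn_even_ge0 //.
  by rewrite e4 ltry.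
- apply/integrableP; split; first by apply/measurable_EFinP; exact: measurable_funX.
  under eq_integral do rewrite /= ger0_norm ?exprn_even_ge0 //.
  by rewrite e2 ltry.
- by rewrite /Rintegral e4.
- by rewrite /Rintegral e2.
- move=> b.
  have mc : measurable_fun setT (fun w => cos (lincomb X s w + b)).
    apply: measurableT_comp; first exact: measurable_cosR.
    exact: measurable_funD.
  have i1 : itg P (fun w => cos (lincomb X s w + b)).
    by apply: itg_bounded mc _ => w; exact: cos_abs_le1.
  have i2 : itg gam (fun x => cos (Num.sqrt v * x + b)).
    apply: (@itg_bounded _ _ _ gam (fun x : measurableTypeR R => cos (Num.sqrt v * x + b)) 1).
      exact: measurable_cos_affine.
    by move=> x; exact: cos_abs_le1.
  (* The transfer of laws is stated for nonnegative functions, so the cosine is shifted by 1. *)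
  have := hv (fun x => 1 + cos (x + b)) _ _.
  move=> /(_ _ _)/wrap[].
  - by move=> x; have := cos_geN1 (x + b); lra.
  - move=> x; apply: cvgD; first exact: cvg_cst.
    apply: (cvg_comp _ cos); last exact: continuous_cos.
    by apply: cvgD; [exact: cvg_id|exact: cvg_cst].
  move=> /(congr1 fine); rewrite -[LHS]/(\int[P]_w (1 + cos (lincomb X s w + b))).
  rewrite -[RHS]/(\int[gam]_x (1 + cos (Num.sqrt v * x + b))).
  rewrite !IntD // ?Int_cst; [|exact: itg_cst|exact: itg_cst].
  have t1 (d' : measure_display) (T' : measurableType d') (Q : probability T' R) : tmass Q = 1.
    by rewrite /tmass; have /= -> := @probability_setT _ _ _ Q.
  by rewrite !t1 => /addrI.
Qed.

(** The second moment of X_{0,0} is a multiple of [gm2] and is positive by hypothesis. *)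
Lemma gm2_neq0 : gm2 != 0 :> R.
Proof.
have [v [_ i2 _ e2 _]] := lincomb_pow [:: ((0, 0), 1)].
apply/eqP => g0; move: vX; rewrite /positive_variance unlock.
under eq_integral do rewrite -lincomb1.
by rewrite -EFin_Int // e2 g0 mulr0 ltxx.
Qed.

(** The Gaussian kurtosis. Its value 3 is never evaluated; what matters is that it does not depend
    on the linear combination. *)
Definition kurt : R := gm4 / gm2 ^+ 2.

Lemma kurt_ge0 : 0 <= kurt.
Proof. by rewrite divr_ge0 ?sqr_ge0 // Int_ge0 // => x; rewrite exprn_even_ge0. Qed.

Lemma lincomb_itg4 s : itg P (fun w => lincomb X s w ^+ 4).
Proof. by have [v []] := lincomb_pow s. Qed.

Lemma lincomb_itg2 s : itg P (fun w => lincomb X s w ^+ 2).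
Proof. by have [v []] := lincomb_pow s. Qed.

Lemma lincomb_moment4 s : \int[P]_w (lincomb X s w ^+ 4) =
  kurt * (\int[P]_w (lincomb X s w ^+ 2)) ^+ 2.
Proof.
have [v [_ _ -> -> _]] := lincomb_pow s.
by rewrite /kurt; field; exact: gm2_neq0.
Qed.

Lemma lincomb_cos s b : \int[P]_w cos (lincomb X s w + b) =
  gcos b (\int[P]_w (lincomb X s w ^+ 2)).
Proof.
have [v [_ _ _ -> ->]] := lincomb_pow s.
by rewrite /gcos mulfK // gm2_neq0.
Qed.

Lemma lincomb_itgM s1 s2 : itg P (fun w => lincomb X s1 w * lincomb X s2 w).
Proof.
apply: (@itg_le _ _ _ _ _ (fun w => lincomb X s1 w ^+ 2 + lincomb X s2 w ^+ 2)).
- by apply: measurable_funM; exact: measurable_lincomb.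
- move=> w; set a := lincomb _ _ _; set b := lincomb _ _ _.
  rewrite normrM -(real_normK (num_real a)) -(real_normK (num_real b)) -subr_ge0.
  have -> : `|a| ^+ 2 + `|b| ^+ 2 - `|a| * `|b| = (`|a| - `|b|) ^+ 2 + `|a| * `|b| by ring.
  by rewrite addr_ge0 ?sqr_ge0 // mulr_ge0.
- by apply: itgD; exact: lincomb_itg2.
Qed.

Definition cov s1 s2 : R := \int[P]_w (lincomb X s1 w * lincomb X s2 w).

Lemma covC s1 s2 : cov s1 s2 = cov s2 s1.
Proof. by apply: eq_Rintegral => w _; rewrite mulrC. Qed.

Definition scl (a : R) (s : seq ((int * int) * R)) := map (fun p => (p.1, a * p.2)) s.

Lemma cov_lin (a : R) s1 s2 s : cov (scl a s1 ++ s2) s = a * cov s1 s + cov s2 s.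
Proof.
rewrite /cov -IntZ; last exact: lincomb_itgM.
rewrite -IntD; [|by apply: itgZ; exact: lincomb_itgM|exact: lincomb_itgM].
by apply: eq_Rintegral => w _; rewrite lincomb_lin mulrDl mulrA.
Qed.

Lemma cov_linr (a : R) s1 s2 s : cov s (scl a s1 ++ s2) = a * cov s s1 + cov s s2.
Proof. by rewrite covC cov_lin !(covC s). Qed.

Lemma cov_sqr s : \int[P]_w (lincomb X s w ^+ 2) = cov s s.
Proof. by apply: eq_Rintegral => w _; rewrite expr2. Qed.

(** Second moment of x b + y c + z e + a in terms of the pairwise second moments of a, b, c, e. *)
Definition vform (x y z bb cc ee aa bc be ba ce ca ea : R) : R :=
  x ^+ 2 * bb + y ^+ 2 * cc + z ^+ 2 * ee + aa +
  2 * (x * y * bc + x * z * be + x * ba + y * z * ce + y * ca + z * ea).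

(** Summing over signs with their product as weight leaves only the monomial abce, of coefficient 4!
    in each of the 8 terms: 192 = 8 * 24. *)
Lemma polar4 (a b c e : R) : 192^-1 *
  ((1 * b + (1 * c + (1 * e + a))) ^+ 4 - (1 * b + (1 * c + (-1 * e + a))) ^+ 4
   - (1 * b + (-1 * c + (1 * e + a))) ^+ 4 + (1 * b + (-1 * c + (-1 * e + a))) ^+ 4
   - (-1 * b + (1 * c + (1 * e + a))) ^+ 4 + (-1 * b + (1 * c + (-1 * e + a))) ^+ 4
   + (-1 * b + (-1 * c + (1 * e + a))) ^+ 4 - (-1 * b + (-1 * c + (-1 * e + a))) ^+ 4) =
  a * b * c * e.
Proof. by field. Qed.

(** The same signed sum applied to the squared second moment keeps the three pairings, each with
    coefficient 64 / 192. *)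
Lemma polar_vform (k bb cc ee aa bc be ba ce ca ea : R) :
  let v x y z := k * vform x y z bb cc ee aa bc be ba ce ca ea ^+ 2 in
  192^-1 * (v 1 1 1 - v 1 1 (-1) - v 1 (-1) 1 + v 1 (-1) (-1)
   - v (-1) 1 1 + v (-1) 1 (-1) + v (-1) (-1) 1 - v (-1) (-1) (-1)) =
  k / 3 * (ba * ce + ca * be + ea * bc).
Proof. by rewrite /vform /=; field. Qed.

(* polarization of E Y^4 = kurt (E Y^2)^2 *)
Lemma lincomb_wick a b c e :
  \int[P]_w (lincomb X a w * lincomb X b w * lincomb X c w * lincomb X e w) =
  kurt / 3 * (cov a b * cov c e + cov a c * cov b e + cov a e * cov b c).
Proof.
pose L (x y z : R) := scl x b ++ (scl y c ++ (scl z e ++ a)).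
have LE x y z w : lincomb X (L x y z) w = x * lincomb X b w + (y * lincomb X c w + (z * lincomb X e w + lincomb X a w)).
  by rewrite /L !lincomb_lin.
pose F (x y z : R) w := lincomb X (L x y z) w ^+ 4.
have FI x y z : itg P (F x y z) by exact: lincomb_itg4.
have FE x y z : \int[P]_w F x y z w = kurt * vform x y z (cov b b) (cov c c) (cov e e) (cov a a)
    (cov b c) (cov b e) (cov b a) (cov c e) (cov c a) (cov e a) ^+ 2.
  rewrite /F lincomb_moment4 cov_sqr; congr (_ * _ ^+ 2).
  rewrite /L !(cov_lin, cov_linr).
  rewrite (covC c b) (covC e b) (covC a b) (covC e c) (covC a c) (covC a e) /vform; ring.
have IE x y z : \int[P]_w F x y z w = kurt * vform x y z (cov b b) (cov c c) (cov e e) (cov a a)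
    (cov b c) (cov b e) (cov b a) (cov c e) (cov c a) (cov e a) ^+ 2 by rewrite FE.
have -> : \int[P]_w (lincomb X a w * lincomb X b w * lincomb X c w * lincomb X e w) =
   \int[P]_w (192^-1 * (F 1 1 1 w - F 1 1 (-1) w - F 1 (-1) 1 w + F 1 (-1) (-1) w
   - F (-1) 1 1 w + F (-1) 1 (-1) w + F (-1) (-1) 1 w - F (-1) (-1) (-1) w)).
  by apply: eq_Rintegral => w _; rewrite /F !LE polar4.
rewrite IntZ; last by do 7?[apply: itgD; [|exact: FI]|apply: itgB; [|exact: FI]]; exact: FI.
rewrite IntB; [|by do 6?[apply: itgD; [|exact: FI]|apply: itgB; [|exact: FI]]; exact: FI|exact: FI].
rewrite IntD; [|by do 5?[apply: itgD; [|exact: FI]|apply: itgB; [|exact: FI]]; exact: FI|exact: FI].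
rewrite IntD; [|by do 4?[apply: itgD; [|exact: FI]|apply: itgB; [|exact: FI]]; exact: FI|exact: FI].
rewrite IntB; [|by do 3?[apply: itgD; [|exact: FI]|apply: itgB; [|exact: FI]]; exact: FI|exact: FI].
rewrite IntD; [|by do 2?[apply: itgD; [|exact: FI]|apply: itgB; [|exact: FI]]; exact: FI|exact: FI].
rewrite IntB; [|by do 1?[apply: itgD; [|exact: FI]|apply: itgB; [|exact: FI]]; exact: FI|exact: FI].
rewrite IntB; [|exact: FI|exact: FI].
by rewrite !IE polar_vform (covC a b) (covC a c) (covC a e).
Qed.

End GaussianLincomb.

(** * Averages of the spectral measure *)

Section DirichletKernel.
Context {R : realType}.

(* a phase-independent bound for the average of cos (j x + b), j = 1, ..., N *)
Definition Bk (N : nat) (x : R) : R :=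
  if sin (x / 2) == 0 then 1 else Num.min 1 (N%:R * `|sin (x / 2)|)^-1.

Lemma Bk_ge0 N x : 0 <= Bk N x.
Proof. by rewrite /Bk; case: ifP => // _; rewrite le_min ler01 invr_ge0 mulr_ge0. Qed.

Lemma Bk_le1 N x : Bk N x <= 1.
Proof. by rewrite /Bk; case: ifP => // _; rewrite ge_min lexx. Qed.

Lemma measurable_sinR : measurable_fun setT (sin : R -> R).
Proof. by apply: continuous_measurable_fun; exact: continuous_sin. Qed.

Lemma measurable_Bk N : measurable_fun setT (Bk N).
Proof.
have ms : measurable_fun setT (fun x : R => sin (x / 2)).
  by apply: measurableT_comp; [exact: measurable_sinR|exact: measurable_funM].
apply: measurable_fun_ifT; first exact: measurable_fun_eqr.
  exact: measurable_cst.
apply: measurable_minr; first exact: measurable_cst.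
have -> : (fun x : R => (N%:R * `|sin (x / 2)|)^-1) =
    (fun y => powR y (-1)) \o (fun x => N%:R * `|sin (x / 2)|).
  by apply/funext => x /=; rewrite powR_inv1 // mulr_ge0.
apply: measurableT_comp; first exact: measurable_powR.
by apply: measurable_funM; [exact: measurable_cst|exact: measurableT_comp].
Qed.

Lemma Bk_cvg x : sin (x / 2) != 0 -> Bk N x @[N --> \oo] --> (0 : R).
Proof.
move=> s0; have n0 : 0 < `|sin (x / 2)| by rewrite normr_gt0.
apply/cvgrPdist_le => e e0; near=> N.
rewrite sub0r normrN ger0_norm ?Bk_ge0 // /Bk (negbTE s0) ge_min; apply/orP; right.
have N0 : 0 < N%:R :> R by near: N; exists 1%N => // n /=; rewrite ltr0n.
rewrite invf_ple ?posrE ?mulr_gt0 // -ler_pdivrMr //.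
near: N; exact: nbhs_infty_ger.
Unshelve. all: by end_near. Qed.

Lemma sum_cos_bound N x b : `|\sum_(j < N) cos (j.+1%:R * x + b)| <= N%:R * Bk N x.
Proof.
have triv : `|\sum_(j < N) cos (j.+1%:R * x + b)| <= N%:R.
  apply: le_trans (ler_norm_sum _ _ _) _.
  have -> : N%:R = \sum_(j < N) (1 : R) by rewrite sumr_const card_ord.
  by apply: ler_sum => j _; exact: cos_abs_le1.
rewrite /Bk; case: eqP => [_|/eqP s0]; first by rewrite mulr1.
case: N triv => [|N] triv; first by rewrite big_ord0 normr0 mul0r.
have n0 : 0 < `|sin (x / 2)| by rewrite normr_gt0.
rewrite minr_pMr ?ler0n // mulr1 le_min triv /= invfM mulrA divff ?pnatr_eq0 // mul1r.
(* Multiplication by 2 sin (x / 2) turns the sum into a telescoping difference of two sines. *)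
have tel : 2 * sin (x / 2) * \sum_(j < N.+1) cos (j.+1%:R * x + b) =
    sin (N.+1%:R * x + b + x / 2) - sin (b + x / 2).
  elim: (N.+1) => [|n IH]; first by rewrite big_ord0 mulr0 mul0r add0r subrr.
  rewrite big_ord_recr /= mulrDr IH.
  have -> : n%:R * x + b + x / 2 = n.+1%:R * x + b - x / 2 by rewrite -natr1; field.
  set u := n.+1%:R * x + b; rewrite (sinB u) (sinD u); ring.
rewrite -(ler_pM2l n0) mulfV ?gt_eqF // -normrM.
have -> : sin (x / 2) * \sum_(j < N.+1) cos (j.+1%:R * x + b) =
  2^-1 * (sin (N.+1%:R * x + b + x / 2) - sin (b + x / 2)) by rewrite -tel; field.
rewrite normrM ger0_norm // ler_pdivrMl // mulr1.
apply: le_trans (ler_normB _ _) _.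
have h (y : R) : `|sin y| <= 1 by rewrite ler_norml sin_geN1 sin_le1.
have := h (N.+1%:R * x + b + x / 2); have := h (b + x / 2); lra.
Qed.

Lemma avg_cos_bound N x b : (0 < N)%N ->
  `|N%:R^-1 * \sum_(j < N) cos (j.+1%:R * x + b)| <= Bk N x.
Proof.
move=> N0; rewrite normrM normfV normr_nat ler_pdivrMl ?ltr0n //; exact: sum_cos_bound.
Qed.

End DirichletKernel.

(** * A Wiener-type lemma for averaged squared covariances *)

Section SpectralAverages.
Context {R : realType}.
Variable nu : {finite_measure set (R * R)%type -> \bar R}.
Implicit Types (D : set (R * R)) (z : R * R).

Lemma Int_eq_ae (f g : R * R -> R) (N : set (R * R)) : measurable N -> nu N = 0%E ->
  measurable_fun setT f -> measurable_fun setT g -> (forall z, ~ N z -> f z = g z) ->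
  \int[nu]_z f z = \int[nu]_z g z.
Proof.
move=> mN N0 mf mg fg; rewrite /Rintegral; congr fine.
apply: ae_eq_integral => //; try exact/measurable_EFinP.
exists N; split=> // z /= /not_implyP[_ h]; apply: contrapT => nN; apply: h.
by rewrite fg.
Qed.

(* co s z is the coordinate of z in which the averaged index sits *)
Definition co (s : bool) z : R := if s then z.1 else z.2.

Lemma measurable_co s : measurable_fun setT (co s).
Proof. by case: s; [exact: measurable_fst|exact: measurable_snd]. Qed.

(** Covariance at lag (u, v) of a real field with spectral measure [nu] restricted to [D]; the lag
    [u] acts on coordinate [s]. *)
Definition rD D (u v : R) s : R := \int[nu]_z (\1_D z * cos (u * co s z + v * co (~~ s) z)).

Lemma measurable_cosdot (u v b : R) s :
  measurable_fun setT (fun z => cos (u * co s z + v * co (~~ s) z + b)).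
Proof.
apply: measurableT_comp; first exact: measurable_cosR.
by apply: measurable_funD => //; apply: measurable_funD; apply: measurable_funM => //; exact: measurable_co.
Qed.

(** A product of two cosines splits into difference and sum frequencies, hence the two kernels. *)
Definition kern D N s z : R :=
  \int[nu]_z' (\1_D z' * (2^-1 * (Bk N (co s z - co s z') + Bk N (co s z + co s z')))).

Definition betaN D N s : R := \int[nu]_z (\1_D z * kern D N s z).

Lemma kern_fun_meas D N s z : measurable D -> measurable_fun setT
  (fun z' => \1_D z' * (2^-1 * (Bk N (co s z - co s z') + Bk N (co s z + co s z')))).
Proof.
move=> mD; apply: measurable_funM; first exact: measurable_indic.
apply: measurable_funM => //; apply: measurable_funD; apply: measurableT_comp (measurable_Bk N) _.
  by apply: measurable_funB => //; exact: measurable_co.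
by apply: measurable_funD => //; exact: measurable_co.
Qed.

Lemma indic01 (T : Type) (D : set T) (z : T) : 0 <= (\1_D z : R) <= 1.
Proof. by rewrite indicE; case: (_ \in _); rewrite ?lexx ler01. Qed.

Lemma kern_fun_bnd D N s z z' :
  0 <= \1_D z' * (2^-1 * (Bk N (co s z - co s z') + Bk N (co s z + co s z'))) <= 1.
Proof.
have /andP[i0 i1] := indic01 D z'.
have b0 := Bk_ge0 N (co s z - co s z'); have b1 := Bk_le1 N (co s z - co s z').
have c0 := Bk_ge0 N (co s z + co s z'); have c1 := Bk_le1 N (co s z + co s z').
rewrite mulr_ge0 //=; last lra.
rewrite -[leRHS]mulr1 ler_pM //; lra.
Qed.

Lemma kern_bnd D N s z : measurable D -> 0 <= kern D N s z <= tmass nu.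
Proof.
move=> mD; have h := kern_fun_bnd D N s z.
rewrite Int_ge0 /=; last by move=> z'; case/andP: (h z').
rewrite -[leRHS]mul1r; apply: le_trans (ler_norm _) _.
apply: Int_bound; first exact: kern_fun_meas.
by move=> z'; case/andP: (h z') => h0 h1; rewrite ger0_norm.
Qed.

Lemma measurable_kern D N s : measurable D -> measurable_fun setT (kern D N s).
Proof.
move=> mD.
pose f (p : (R * R) * (R * R)) : \bar R :=
  (\1_D p.2 * (2^-1 * (Bk N (co s p.1 - co s p.2) + Bk N (co s p.1 + co s p.2))))%:E.
have mf : measurable_fun setT f.
  have m1 : measurable_fun setT (fun p : (R * R) * (R * R) => co s p.1).
    by apply: measurableT_comp; [exact: measurable_co|exact: measurable_fst].
  have m2 : measurable_fun setT (fun p : (R * R) * (R * R) => co s p.2).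
    by apply: measurableT_comp; [exact: measurable_co|exact: measurable_snd].
  apply/measurable_EFinP; apply: measurable_funM.
    apply: (measurableT_comp (f := \1_D : R * R -> R)); first exact: measurable_indic.
    exact: measurable_snd.
  apply: measurable_funM => //; apply: measurable_funD; apply: measurableT_comp (measurable_Bk N) _.
    exact: measurable_funB.
  exact: measurable_funD.
have f0 p : setT p -> (0 <= f p)%E by move=> _; rewrite lee_fin; case/andP: (kern_fun_bnd D N s p.1 p.2).
have mF : measurable_fun setT (fubini_F nu f) by apply: measurable_fun_fubini_tonelli_F => // p; exact: f0.
by apply: (measurableT_comp (f := fine)) => //; exact: fine_measurable.
Qed.

(** One factor of each square is written as an integral, twice, and the average is taken inside. The
    inner average of cosines is bounded by [Bk] whatever the phases, so the bound is uniform in [c]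
    and [v]. *)
Lemma avg_rD2 D N s (c v : R) : measurable D -> (0 < N)%N ->
  N%:R^-1 * \sum_(j < N) rD D (j.+1%:R - c) v s ^+ 2 <= betaN D N s.
Proof.
move=> mD N0.
pose cs (j : nat) z := cos ((j.+1%:R - c) * co s z + v * co (~~ s) z).
have mcs j : measurable_fun setT (cs j).
  have := measurable_cosdot (j.+1%:R - c) v 0 s.
  by under eq_fun do rewrite addr0.
have mi : measurable_fun setT (\1_D : R * R -> R) by exact: measurable_indic.
have icb j z : `|\1_D z * cs j z| <= 1.
  rewrite normrM -[leRHS]mulr1 ler_pM // ?cos_abs_le1 //.
  by case/andP: (indic01 D z) => h0 h1; rewrite ger0_norm.
have ic j : itg nu (fun z => \1_D z * cs j z).
  by apply: (@itg_bounded _ _ _ nu _ 1 _ (icb j)); exact: measurable_funM.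
have iD (F : R * R -> R) : measurable_fun setT F -> (exists C, forall z, `|F z| <= C) ->
    itg nu (fun z => \1_D z * F z).
  move=> mF [C hC]; apply: (@itg_bounded _ _ _ nu _ C); first exact: measurable_funM.
  move=> z; rewrite normrM -[leRHS]mul1r ler_pM //.
  by case/andP: (indic01 D z) => h0 h1; rewrite ger0_norm.
pose r j := rD D (j.+1%:R - c) v s.
have rE j : r j = \int[nu]_z (\1_D z * cs j z) by [].
have r2 (j : 'I_N) : r j ^+ 2 = \int[nu]_z (\1_D z * (r j * cs j z)).
  rewrite expr2 {2}rE -IntZ //; apply: eq_Rintegral => z _; ring.
have inner z : N%:R^-1 * \sum_(j < N) r j * cs j z =
    \int[nu]_z' (\1_D z' * (N%:R^-1 * \sum_(j < N) cs j z' * cs j z)).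
  rewrite mulr_sumr; transitivity (\sum_(j < N) \int[nu]_z' (N%:R^-1 * cs j z * (\1_D z' * cs j z'))).
    by apply: eq_bigr => j _; rewrite IntZ // -rE; ring.
  rewrite -Int_sum; last by move=> j; exact: itgZ.
  by apply: eq_Rintegral => z' _; rewrite mulrCA mulr_sumr mulr_sumr; apply: eq_bigr => j _; ring.
(* All terms in [c] and [v] are absorbed into the phases [b0] and [b1]. *)
have ptw z z' : `|N%:R^-1 * \sum_(j < N) cs j z' * cs j z| <=
    2^-1 * (Bk N (co s z - co s z') + Bk N (co s z + co s z')).
  pose b0 := (- c * (co s z - co s z') + v * (co (~~ s) z - co (~~ s) z')).
  pose b1 := (- c * (co s z + co s z') + v * (co (~~ s) z + co (~~ s) z')).
  have -> : N%:R^-1 * \sum_(j < N) cs j z' * cs j z =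
     2^-1 * (N%:R^-1 * \sum_(j < N) cos (j.+1%:R * (co s z - co s z') + b0) +
             N%:R^-1 * \sum_(j < N) cos (j.+1%:R * (co s z + co s z') + b1)).
    rewrite -mulrDr -big_split /= mulrCA; congr (_ * _); rewrite mulr_sumr; apply: eq_bigr => j _.
    set A := (j.+1%:R - c) * co s z + v * co (~~ s) z.
    set B := (j.+1%:R - c) * co s z' + v * co (~~ s) z'.
    have -> : j.+1%:R * (co s z - co s z') + b0 = A - B by rewrite /b0 /A /B; ring.
    have -> : j.+1%:R * (co s z + co s z') + b1 = A + B by rewrite /b1 /A /B; ring.
    by rewrite (cosB A B) (cosD A B) /cs -/A -/B; field.
  rewrite normrM ger0_norm // ler_wpM2l //; apply: le_trans (ler_normD _ _) _.
  by apply: lerD; exact: avg_cos_bound.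
have mprod z : measurable_fun setT (fun z' => N%:R^-1 * \sum_(j < N) cs j z' * cs j z).
  by apply: measurable_funM => //; apply: measurable_sum => j; exact: measurable_funM.
have Bb (z z' : R * R) : 2^-1 * (Bk N (co s z - co s z') + Bk N (co s z + co s z')) <= 1.
  have := Bk_le1 N (co s z - co s z'); have := Bk_le1 N (co s z + co s z'); lra.
have innerb z : N%:R^-1 * \sum_(j < N) r j * cs j z <= kern D N s z.
  rewrite inner; apply: Int_le.
  - apply: iD => //; exists 1 => z'; exact: le_trans (ptw z z') (Bb z z').
  - apply: (@itg_bounded _ _ _ nu _ 1); first exact: kern_fun_meas.
    by move=> z'; case/andP: (kern_fun_bnd D N s z z') => h0 h1; rewrite ger0_norm.
  - move=> z'; rewrite ler_wpM2l //.
    exact: le_trans (ler_norm _) (ptw z z').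
have rb j : `|r j| <= tmass nu.
  rewrite rE -[leRHS]mul1r; apply: Int_bound; [exact: (measurable_funM mi (mcs j))|exact: icb].
have itr (j : nat) : itg nu (fun z => \1_D z * (r j * cs j z)).
  apply: iD; first exact: measurable_funM.
  by exists (tmass nu) => z; rewrite normrM -[leRHS]mulr1 ler_pM // cos_abs_le1.
have -> : N%:R^-1 * \sum_(j < N) rD D (j.+1%:R - c) v s ^+ 2 =
   \int[nu]_z (\1_D z * (N%:R^-1 * \sum_(j < N) r j * cs j z)).
  rewrite mulr_sumr; transitivity (\sum_(j < N) \int[nu]_z (N%:R^-1 * (\1_D z * (r j * cs j z)))).
    by apply: eq_bigr => j _; rewrite IntZ // -r2.
  rewrite -Int_sum; last by move=> j; exact: itgZ.
  by apply: eq_Rintegral => z _; rewrite mulrCA mulr_sumr mulr_sumr; apply: eq_bigr => j _; ring.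
apply: Int_le.
- apply: iD.
    by apply: measurable_funM => //; apply: measurable_sum => j; exact: measurable_funM.
  exists (N%:R^-1 * \sum_(j < N) (tmass nu)) => z.
  rewrite normrM normfV normr_nat ler_wpM2l ?invr_ge0 //.
  apply: le_trans (ler_norm_sum _ _ _) _; apply: ler_sum => j _.
  by rewrite normrM -[leRHS]mulr1 ler_pM // cos_abs_le1.
- apply: iD; first exact: measurable_kern.
  by exists (tmass nu) => z; case/andP: (kern_bnd N s z mD) => h0 h1; rewrite ger0_norm.
- move=> z; rewrite ler_wpM2l //; exact: innerb.
Qed.

(** The limit of [Bk]: the indicator of multiples of 2 pi. *)
Definition Bk0 (x : R) : R := (sin (x / 2) == 0)%:R.

Lemma Bk_cvg0 x : Bk N x @[N --> \oo] --> Bk0 x.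
Proof.
rewrite /Bk0; case: (eqVneq (sin (x / 2)) 0) => h /=; last exact: Bk_cvg.
by rewrite /Bk h eqxx; exact: cvg_cst.
Qed.

(** Bounded convergence is used for the inner and then for the outer integral. The hypothesis bounds
    the mass of [D] on the lines where the coordinate [s] is that of [z] up to sign, modulo 2 pi. *)
Lemma beta_small D s (dl e : R) : measurable D -> 0 <= dl -> 0 < e ->
  (forall z, D z -> \int[nu]_z' (\1_D z' * (2^-1 * (Bk0 (co s z - co s z') + Bk0 (co s z + co s z')))) <= dl) ->
  exists N0, forall N, (N0 <= N)%N -> betaN D N s <= dl * tmass nu + e.
Proof.
move=> mD dlp e0 hD.
pose G z := \int[nu]_z' (\1_D z' * (2^-1 * (Bk0 (co s z - co s z') + Bk0 (co s z + co s z')))).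
have kc z : kern D N s z @[N --> \oo] --> G z.
  apply: (@Int_dct _ _ _ nu _ _ 1).
  - by move=> N; exact: kern_fun_meas.
  - by move=> N z'; case/andP: (kern_fun_bnd D N s z z') => h0 h1; rewrite ger0_norm.
  - move=> z'; apply: cvgM; first exact: cvg_cst.
    apply: cvgM; first exact: cvg_cst.
    by apply: cvgD; exact: Bk_cvg0.
have mi : measurable_fun setT (\1_D : R * R -> R) by exact: measurable_indic.
have bc : betaN D N s @[N --> \oo] --> \int[nu]_z (\1_D z * G z).
  apply: (@Int_dct _ _ _ nu _ _ (tmass nu)).
  - by move=> N; apply: measurable_funM => //; exact: measurable_kern.
  - move=> N z; case/andP: (kern_bnd N s z mD) => h0 h1; case/andP: (indic01 D z) => h2 h3.
    by rewrite normrM !ger0_norm // -[leRHS]mul1r ler_pM.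
  - by move=> z; apply: cvgM; [exact: cvg_cst|exact: kc].
have mG : measurable_fun setT G.
  by apply: (measurable_fun_cvg (fun N => measurable_kern N s mD)) => z _; exact: kc.
have dl0 : 0 <= \int[nu]_z (\1_D z * G z) <= dl * tmass nu.
  have G0 z : 0 <= G z.
    apply: Int_ge0 => z'; case/andP: (indic01 D z') => h2 h3.
    by rewrite mulr_ge0 // mulr_ge0 // addr_ge0.
  rewrite Int_ge0 /=; last by move=> z; rewrite mulr_ge0 //; case/andP: (indic01 D z).
  rewrite -Int_cst; apply: Int_le.
  - apply: (@itg_bounded _ _ _ nu _ dl); first exact: measurable_funM.
    move=> z; rewrite indicE; case: (boolP (z \in D)) => [|_]; last by rewrite mul0r normr0.
    by rewrite inE mul1r ger0_norm // => /hD.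
  - exact: itg_cst.
  - move=> z; rewrite indicE; case: (boolP (z \in D)) => [|_]; last by rewrite mul0r.
    by rewrite inE mul1r => /hD.
move/cvgrPdist_lt : bc => /(_ e e0) [N0 _ h]; exists N0 => N NN.
have := h N NN; rewrite distrC ltr_norml => /andP[_ h1].
by case/andP: dl0 => _ h2; move: h1 h2; lra.
Qed.

End SpectralAverages.

(** * Removing the atoms *)

Section Frequencies.
Context {R : realType}.
Implicit Types (z w : R * R) (e f : int * int).

Definition dot e z : R := e.1%:~R * z.1 + e.2%:~R * z.2.
(** The shift by pi / 2 turns the cosine into minus the sine. *)
Definition ph (c : bool) : R := if c then pi / 2 else 0.

(** Transfer function of a linear combination: its two phases are the real part and minus the
    imaginary part of the sum of p.2 e^{i p.1 z}. *)
Definition tf (s : seq ((int * int) * R)) (c : bool) z : R :=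
  \sum_(p <- s) p.2 * cos (dot p.1 z + ph c).

(** Real form of Re (e^{iA} e^{-iB}); it separates [A] from [B]. *)
Lemma cos_ph (A B : R) : cos (A - B) =
  cos (A + ph false) * cos (B + ph false) + cos (A + ph true) * cos (B + ph true).
Proof. by rewrite /ph !addr0 !cosDpihalf cosB mulrNN. Qed.

Lemma dotBr e z w : dot e (z - w) = dot e z - dot e w.
Proof. by rewrite /dot /=; ring. Qed.

Lemma dotDr e z w : dot e (z + w) = dot e z + dot e w.
Proof. by rewrite /dot /=; ring. Qed.

Lemma tf_lin (a : R) s1 s2 c z : tf (scl a s1 ++ s2) c z = a * tf s1 c z + tf s2 c z.
Proof.
rewrite /tf big_cat big_map /=; congr (_ + _); rewrite mulr_sumr.
by apply: eq_bigr => p _; rewrite mulrA.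
Qed.

Definition idx (M : nat) : seq (int * int) :=
  [seq ((i.+1)%:Z, (j.+1)%:Z) | i <- index_iota 0 M, j <- index_iota 0 M].

Lemma sum_idx (M : nat) (g : int * int -> R) :
  \sum_(f <- idx M) g f = \sum_(i < M) \sum_(j < M) g ((i.+1)%:Z, (j.+1)%:Z).
Proof.
rewrite /idx big_allpairs_dep /= big_mkord; apply: eq_bigr => i _.
by rewrite big_mkord.
Qed.

Lemma avg2_cos_bound1 M w b : (0 < M)%N ->
  `|M%:R^-1 ^+ 2 * \sum_(f <- idx M) cos (dot f w + b)| <= Bk M w.1.
Proof.
move=> M0; rewrite sum_idx exchange_big /=.
have -> : M%:R^-1 ^+ 2 * \sum_(j < M) \sum_(i < M) cos (dot ((i.+1)%:Z, (j.+1)%:Z) w + b) =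
  M%:R^-1 * \sum_(j < M) (M%:R^-1 * \sum_(i < M) cos (i.+1%:R * w.1 + (j.+1%:R * w.2 + b))).
  rewrite -mulr_sumr mulrA expr2; congr (_ * _); apply: eq_bigr => j _; apply: eq_bigr => i _.
  by rewrite /dot /= addrA.
rewrite normrM normfV normr_nat ler_pdivrMl ?ltr0n //.
apply: le_trans (ler_norm_sum _ _ _) _.
have -> : M%:R * Bk M w.1 = \sum_(j < M) Bk M w.1 by rewrite sumr_const card_ord mulr_natl.
by apply: ler_sum => j _; exact: avg_cos_bound.
Qed.

Lemma avg2_cos_bound2 M w b : (0 < M)%N ->
  `|M%:R^-1 ^+ 2 * \sum_(f <- idx M) cos (dot f w + b)| <= Bk M w.2.
Proof.
move=> M0; rewrite sum_idx.
have -> : M%:R^-1 ^+ 2 * \sum_(i < M) \sum_(j < M) cos (dot ((i.+1)%:Z, (j.+1)%:Z) w + b) =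
  M%:R^-1 * \sum_(i < M) (M%:R^-1 * \sum_(j < M) cos (j.+1%:R * w.2 + (i.+1%:R * w.1 + b))).
  rewrite -mulr_sumr mulrA expr2; congr (_ * _); apply: eq_bigr => i _; apply: eq_bigr => j _.
  by congr cos; rewrite /dot /=; ring.
rewrite normrM normfV normr_nat ler_pdivrMl ?ltr0n //.
apply: le_trans (ler_norm_sum _ _ _) _.
have -> : M%:R * Bk M w.2 = \sum_(j < M) Bk M w.2 by rewrite sumr_const card_ord mulr_natl.
by apply: ler_sum => j _; exact: avg_cos_bound.
Qed.

(** A double average decays as soon as one coordinate is not resonant, hence the minimum. *)
Definition B2 M w : R := Num.min (Bk M w.1) (Bk M w.2).

Lemma avg2_cos_bound M w b : (0 < M)%N ->
  `|M%:R^-1 ^+ 2 * \sum_(f <- idx M) cos (dot f w + b)| <= B2 M w.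
Proof. by move=> M0; rewrite /B2 le_min avg2_cos_bound1 // avg2_cos_bound2. Qed.

Lemma avg2_cst M (c : R) : (0 < M)%N -> M%:R^-1 ^+ 2 * \sum_(f <- idx M) c = c.
Proof.
move=> M0; rewrite sum_idx !sumr_const !card_ord -(mulr_natl c M) -(mulr_natl (M%:R * c) M).
by field; rewrite pnatr_eq0 -lt0n.
Qed.

Lemma B2_ge0 M w : 0 <= B2 M w. Proof. by rewrite le_min !Bk_ge0. Qed.
Lemma B2_le1 M w : B2 M w <= 1. Proof. by rewrite ge_min Bk_le1. Qed.

Lemma B2_cvg w : (sin (w.1 / 2) != 0) || (sin (w.2 / 2) != 0) -> B2 M w @[M --> \oo] --> (0 : R).
Proof.
move=> h.
have main (g : nat -> R) : g M @[M --> \oo] --> (0 : R) -> (forall M, B2 M w <= g M) ->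
    B2 M w @[M --> \oo] --> (0 : R).
  move=> cg hg; apply: (@squeeze_cvgr _ _ _ _ (fun=> 0) g) => //; last exact: cvg_cst.
  by apply: nearW => M; rewrite B2_ge0 hg.
case/orP: h => h.
- by apply: (main (fun M => Bk M w.1)); [exact: Bk_cvg|move=> M; rewrite ge_min lexx].
- by apply: (main (fun M => Bk M w.2)); [exact: Bk_cvg|move=> M; rewrite ge_min lexx orbT].
Qed.

Definition Box : set (R * R) := `]- pi, pi] `*` `]- pi, pi].

Lemma measurable_Box : measurable Box.
Proof. by apply: measurableX; exact: measurable_itv. Qed.

(* - x modulo 2 pi, represented in ]- pi, pi] *)
Definition ng (x : R) : R := if x == pi then pi else - x.
Definition negm z : R * R := (ng z.1, ng z.2).

Lemma sin_half_eq0 (x : R) : - (2 * pi) < x < 2 * pi -> sin (x / 2) = 0 -> x = 0.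
Proof.
move=> /andP[h1 h2] s0.
have [xp|xn|//] := ltrgt0P x.
  have : 0 < sin (x / 2) by apply: sin_gt0_pi; rewrite divr_gt0 //= ltr_pdivrMr // mulrC.
  by rewrite s0 ltxx.
have : 0 < sin (- x / 2).
  by apply: sin_gt0_pi; rewrite divr_gt0 ?oppr_gt0 //= ltr_pdivrMr // mulrC ltrNl.
by rewrite mulNr sinN s0 oppr0 ltxx.
Qed.

(** Inside the box two coordinates differ by less than 2 pi, so resonance means equality. *)
Lemma sin_diff_box (x y : R) : x \in `]- pi, pi] -> y \in `]- pi, pi] ->
  sin ((x - y) / 2) = 0 -> x = y.
Proof.
rewrite !in_itv /= => /andP[x0 x1] /andP[y0 y1] /sin_half_eq0 h.
by apply/eqP; rewrite -subr_eq0; apply/eqP/h; apply/andP; split; lra.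
Qed.

(** A sum in the box reaches 2 pi only when both coordinates are pi, the case for which [ng] fixes
    pi. *)
Lemma sin_sum_box (x y : R) : x \in `]- pi, pi] -> y \in `]- pi, pi] ->
  sin ((x + y) / 2) = 0 -> x = ng y.
Proof.
rewrite !in_itv /= /ng => /andP[x0 x1] /andP[y0 y1] s0.
case: eqP => [yp|/eqP yp].
  apply/eqP; rewrite eq_le x1 /= leNgt; apply/negP => xp.
  have : x + y = 0 by apply: sin_half_eq0 s0; apply/andP; split; lra.
  lra.
have y2 : y < pi by rewrite lt_neqAle yp.
have : x + y = 0 by apply: sin_half_eq0 s0; apply/andP; split; lra.
lra.
Qed.

Lemma ngK (x : R) : x \in `]- pi, pi] -> ng (ng x) = x.
Proof.
rewrite in_itv /= /ng => /andP[x0 x1]; case: (eqVneq x pi) => [->|xp]; first by rewrite eqxx.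
case: eqP => [h|_]; last by rewrite opprK.
by move: x0; rewrite -h opprK ltxx.
Qed.

Lemma ng_itv (x : R) : x \in `]- pi, pi] -> ng x \in `]- pi, pi].
Proof.
rewrite !in_itv /= /ng => /andP[x0 x1]; have p0 := pi_gt0 R; case: (eqVneq x pi) => [_|xp].
  by rewrite lexx andbT; lra.
have x2 : x < pi by rewrite lt_neqAle xp.
by apply/andP; split; lra.
Qed.

Lemma BoxP z : Box z <-> (z.1 \in `]- pi, pi]) && (z.2 \in `]- pi, pi]).
Proof. by split; [case=> /= -> ->|case/andP]. Qed.

Lemma negmK z : Box z -> negm (negm z) = z.
Proof. by move=> /BoxP/andP[h1 h2]; rewrite /negm /= !ngK //; case: z h1 h2. Qed.

Lemma negm_Box z : Box z -> Box (negm z).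
Proof. by move=> /BoxP/andP[h1 h2]; apply/BoxP; rewrite /negm /= !ng_itv. Qed.

Lemma cos_period (x : R) (m : int) : cos (x + m%:~R * (2 * pi)) = cos x.
Proof.
have nat_case (k : nat) (y : R) : cos (y + k%:R * (2 * pi)) = cos y.
  have -> : k%:R * (2 * pi) = (pi *+ 2) *+ k :> R by rewrite mulr_natl (mulr_natl pi 2).
  by rewrite (periodicn (@cosD2pi R)).
case: m => k; first exact: nat_case.
rewrite NegzE mulrNz -[LHS](nat_case k.+1); congr cos; rewrite -pmulrn; ring.
Qed.

Lemma cos_negm (a : R) e z : cos (a + dot e (negm z + z)) = cos a.
Proof.
have h (x : R) : exists m : int, ng x + x = m%:~R * (2 * pi).
  rewrite /ng; case: eqP => [->|_]; first by exists 1; rewrite mul1r mulr_natl mulr2n.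
  by exists 0; rewrite addNr mul0r.
have [m1 E1] := h z.1; have [m2 E2] := h z.2.
rewrite /dot /= E1 E2.
have -> : a + (e.1%:~R * (m1%:~R * (2 * pi)) + e.2%:~R * (m2%:~R * (2 * pi))) =
   a + (e.1 * m1 + e.2 * m2)%:~R * (2 * pi) :> R.
  by rewrite intrD !intrM; ring.
exact: cos_period.
Qed.

Definition goodF (F : seq (R * R)) : Prop :=
  [/\ uniq F, (forall z, z \in F -> Box z) & forall z, z \in F -> negm z \in F].

Variable F : seq (R * R).
Hypothesis gF : goodF F.

(* X_e minus the empirical projection, over an M x M window, onto the atoms in F *)
Definition Ylist (M : nat) e : seq ((int * int) * R) :=
  scl (-1) [seq (f, M%:R^-1 ^+ 2 * \sum_(n <- F) cos (dot e n - dot f n)) | f <- idx M] ++ [:: (e, 1)].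

(** Leakage of the window at [z] from the frequency [n], and in [b2] from its negative; zero at
    resonance, where the window average is exact. *)
Definition b1 M n z : R := if z == n then 0 else B2 M (z - n).
Definition b2 M n z : R := if z == negm n then 0 else B2 M (z + n).
Definition kap M z : R := \sum_(n <- F) 2^-1 * (b1 M n z + b2 M n z).

Lemma b1_bnd M n z : 0 <= b1 M n z <= 1.
Proof. by rewrite /b1; case: ifP; rewrite ?lexx ?ler01 // B2_ge0 B2_le1. Qed.
Lemma b2_bnd M n z : 0 <= b2 M n z <= 1.
Proof. by rewrite /b2; case: ifP; rewrite ?lexx ?ler01 // B2_ge0 B2_le1. Qed.

Lemma kap_bnd M z : 0 <= kap M z <= (size F)%:R.
Proof.
rewrite /kap sumr_ge0 /=; last first.
  by move=> n _; case/andP: (b1_bnd M n z) => h1 _; case/andP: (b2_bnd M n z) => h2 _; lra.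
have -> : (size F)%:R = \sum_(n <- F) (1 : R) by rewrite big_const_seq count_predT iter_addr_0.
apply: ler_sum => n _.
by case/andP: (b1_bnd M n z) => _ h1; case/andP: (b2_bnd M n z) => _ h2; lra.
Qed.

Lemma kap_cvg z : Box z -> kap M z @[M --> \oo] --> (0 : R).
Proof.
move=> bz; have [uF bF nF] := gF.
have bz' := bz; move/BoxP/andP: bz' => [z1 z2].
have -> : (0 : R) = \sum_(n <- F | n \in F) 0 by rewrite big1.
rewrite /kap; under eq_fun do rewrite big_seq.
apply: (cvg_big add_continuous) => n nF'; have /BoxP/andP[n1 n2] := bF _ nF'.
rewrite -[X in _ --> X](mulr0 2^-1); apply: cvgM; first exact: cvg_cst.
rewrite -[X in _ --> X](addr0 0); apply: cvgD.
- rewrite /b1; case: (eqVneq z n) => zn; first exact: cvg_cst.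
  apply: B2_cvg; apply: contraNT zn; rewrite negb_or !negbK => /andP[/eqP s1 /eqP s2].
  rewrite [z]surjective_pairing [n]surjective_pairing.
  by rewrite (sin_diff_box z1 n1 s1) (sin_diff_box z2 n2 s2).
- rewrite /b2; case: (eqVneq z (negm n)) => zn; first exact: cvg_cst.
  apply: B2_cvg; apply: contraNT zn; rewrite negb_or !negbK => /andP[/eqP s1 /eqP s2].
  by rewrite [z]surjective_pairing (sin_sum_box z1 n1 s1) (sin_sum_box z2 n2 s2).
Qed.

(** The filter removes the frequencies in [F] and keeps the others, up to leakage. The product
    formula gives two averages, resonant at [n] and at [negm n], and each accounts for half of the
    cosine. *)
Lemma tf_Ylist M e c z : (0 < M)%N -> Box z ->
  `|tf (Ylist M e) c z - (z \notin F)%:R * cos (dot e z + ph c)| <= kap M z.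
Proof.
move=> M0 bz; have [uF bF nF] := gF.
pose T1 n := M%:R^-1 ^+ 2 * \sum_(f <- idx M) cos (dot f (z - n) + (dot e n + ph c)).
pose T2 n := M%:R^-1 ^+ 2 * \sum_(f <- idx M) cos (dot f (z + n) + (ph c - dot e n)).
have -> : tf (Ylist M e) c z = cos (dot e z + ph c) - \sum_(n <- F) 2^-1 * (T1 n + T2 n).
  rewrite /Ylist tf_lin /tf big_seq1 mul1r mulN1r addrC big_map /=; congr (_ - _).
  transitivity (\sum_(f <- idx M) \sum_(n <- F) M%:R^-1 ^+ 2 * (cos (dot e n - dot f n) * cos (dot f z + ph c))).
    by apply: eq_bigr => f _; rewrite -mulrA mulr_suml mulr_sumr.
  rewrite exchange_big /=; apply: eq_bigr => n _.
  rewrite /T1 /T2 -mulrDr -big_split /= mulrCA -mulr_sumr; congr (_ * _); rewrite mulr_sumr; apply: eq_bigr => f _.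
  rewrite dotBr dotDr; set A := dot e n - dot f n; set B := dot f z + ph c.
  have -> : dot f z - dot f n + (dot e n + ph c) = B + A by rewrite /A /B; ring.
  have -> : dot f z + dot f n + (ph c - dot e n) = B - A by rewrite /A /B; ring.
  by rewrite (cosD B A) (cosB B A); field.
pose C := cos (dot e z + ph c).
have e1 n : n \in F -> `|T1 n - (z == n)%:R * C| <= b1 M n z.
  move=> nF'; rewrite /T1 /b1; case: (eqVneq z n) => [<-|zn].
    rewrite subrr mul1r; under eq_bigr do rewrite /dot !mulr0 addr0 add0r.
    by rewrite avg2_cst // subrr normr0.
  by rewrite mul0r subr0; exact: avg2_cos_bound.
have e2 n : n \in F -> `|T2 n - (z == negm n)%:R * C| <= b2 M n z.
  move=> nF'; rewrite /T2 /b2; case: (eqVneq z (negm n)) => [zn|zn].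
    rewrite mul1r zn; under eq_bigr do rewrite addrC cos_negm.
    rewrite avg2_cst // /C zn -[X in X - _](cos_negm _ e n) dotDr.
    have -> : ph c - dot e n + (dot e (negm n) + dot e n) = dot e (negm n) + ph c by ring.
    by rewrite subrr normr0.
  by rewrite mul0r subr0; exact: avg2_cos_bound.
have S1 : \sum_(n <- F) (z == n)%:R = (z \in F)%:R :> R.
  case: (boolP (z \in F)) => zF.
    by rewrite (bigD1_seq z) //= eqxx big1 ?addr0 // => n; rewrite eq_sym => /negbTE ->.
  by rewrite big1_seq // => n /andP[_ nF']; case: eqP => // zn; rewrite zn nF' in zF.
(* [negm] permutes [F], so the resonances at [negm n] are as many as those at [n]; this is where
   closure under negation is used. *)
have S2 : \sum_(n <- F) (z == negm n)%:R = (z \in F)%:R :> R.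
  rewrite -S1; have -> : \sum_(n <- F) (z == n)%:R = \sum_(n <- map negm F) (z == n)%:R :> R.
    apply: perm_big; apply: uniq_perm => //.
      by rewrite map_inj_in_uniq // => x y xF yF h; rewrite -(negmK (bF _ xF)) h negmK //; exact: bF.
    move=> x; apply/idP/mapP => [xF|[y yF ->]]; last exact: nF.
    by exists (negm x); [exact: nF|rewrite negmK //; exact: bF].
  by rewrite big_map.
have -> : C - \sum_(n <- F) 2^-1 * (T1 n + T2 n) - (z \notin F)%:R * C =
   - \sum_(n <- F) 2^-1 * ((T1 n - (z == n)%:R * C) + (T2 n - (z == negm n)%:R * C)).
  rewrite -mulr_sumr -mulr_sumr !big_split /= !sumrN -!mulr_suml S1 S2.
  by case: (z \in F) => /=; field.
rewrite normrN; apply: le_trans (ler_norm_sum _ _ _) _.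
rewrite /kap big_seq [leRHS]big_seq; apply: ler_sum => n nF'.
rewrite normrM ger0_norm // ler_wpM2l //; apply: le_trans (ler_normD _ _) _.
by apply: lerD; [exact: e1|exact: e2].
Qed.

Lemma measurable_pt (n : R * R) : measurable [set n].
Proof.
have -> : [set n] = [set n.1] `*` [set n.2].
  by apply/seteqP; split=> [x -> //|[x1 x2] /= [-> ->]]; rewrite -surjective_pairing.
by apply: measurableX; exact: measurable_set1.
Qed.

Lemma measurable_eqpt (n : R * R) : measurable_fun setT (fun z : R * R => z == n).
Proof.
have -> : (fun z : R * R => z == n) = (fun z => (z.1 == n.1) && (z.2 == n.2)).
  by apply/funext => -[a b]; case: n => c d0.
by apply: measurable_and; apply: measurable_fun_eqr.
Qed.

Lemma measurable_B2 M (g h : R * R -> R) : measurable_fun setT g -> measurable_fun setT h ->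
  measurable_fun setT (fun z => B2 M (g z, h z)).
Proof. by move=> mg mh; apply: measurable_minr; apply: measurableT_comp (measurable_Bk M) _. Qed.

Lemma measurable_kap M : measurable_fun setT (kap M).
Proof.
have m1 : measurable_fun setT (fun z : R * R => z.1) by exact: measurable_fst.
have m2 : measurable_fun setT (fun z : R * R => z.2) by exact: measurable_snd.
apply: measurable_sum => n; apply: measurable_funM => //; apply: measurable_funD.
- apply: measurable_fun_ifT => //; first exact: measurable_eqpt.
  apply: (@measurable_B2 M (fun z => z.1 - n.1) (fun z => z.2 - n.2)); exact: measurable_funB.
- apply: measurable_fun_ifT => //; first exact: measurable_eqpt.
  apply: (@measurable_B2 M (fun z => z.1 + n.1) (fun z => z.2 + n.2)); exact: measurable_funD.
Qed.

Lemma measurable_cosdot2 e (b : R) : measurable_fun setT (fun z => cos (dot e z + b)).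
Proof.
apply: measurableT_comp; first exact: measurable_cosR.
apply: measurable_funD => //; apply: measurable_funD; exact: measurable_funM.
Qed.

Lemma measurable_tf s c : measurable_fun setT (tf s c).
Proof. by apply: measurable_sum => p; apply: measurable_funM => //; exact: measurable_cosdot2. Qed.

Lemma tf_bounded s c : exists C, forall z, `|tf s c z| <= C.
Proof.
exists (\sum_(p <- s) `|p.2|) => z; apply: le_trans (ler_norm_sum _ _ _) _.
by apply: ler_sum => p _; rewrite normrM ler_piMr // cos_abs_le1.
Qed.

End Frequencies.

(** * Fourfold index sums *)

Section FourFoldSums.
Context {R : realType}.

Lemma sum4_le (N : nat) (G : 'I_N -> 'I_N -> 'I_N -> 'I_N -> R) (K : R) :
  (forall b c e, \sum_a G a b c e <= N%:R * K) ->
  \sum_a \sum_b \sum_c \sum_e G a b c e <= N%:R ^+ 4 * K.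
Proof.
have Sb (I : 'I_N -> R) (B : R) : (forall i, I i <= B) -> \sum_i I i <= N%:R * B.
  move=> h; have -> : N%:R * B = \sum_(i < N) B by rewrite sumr_const card_ord mulr_natl.
  by apply: ler_sum => i _.
move=> h; rewrite exchange_big /=.
have -> : N%:R ^+ 4 * K = N%:R * (N%:R * (N%:R * (N%:R * K))) by ring.
apply: (Sb _ _) => b; rewrite exchange_big /=; apply: (Sb _ _) => c; rewrite exchange_big /=; apply: (Sb _ _) => e.
exact: h.
Qed.

Lemma sum4_last_le (N : nat) (G : 'I_N -> 'I_N -> 'I_N -> 'I_N -> R) (K : R) :
  (forall a b c, \sum_e G a b c e <= N%:R * K) ->
  \sum_a \sum_b \sum_c \sum_e G a b c e <= N%:R ^+ 4 * K.
Proof.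
have Sb (I : 'I_N -> R) (B : R) : (forall i, I i <= B) -> \sum_i I i <= N%:R * B.
  move=> h; have -> : N%:R * B = \sum_(i < N) B by rewrite sumr_const card_ord mulr_natl.
  by apply: ler_sum => i _.
move=> h; have -> : N%:R ^+ 4 * K = N%:R * (N%:R * (N%:R * (N%:R * K))) by ring.
by apply: (Sb _ _) => a; apply: (Sb _ _) => b; apply: (Sb _ _) => c; exact: h.
Qed.

Lemma mxtrace4 (N : nat) (A : 'M[R]_N) :
  \tr (A ^+ 4) = \sum_a \sum_b \sum_c \sum_e A a b * A b c * A c e * A e a.
Proof.
rewrite /mxtrace; apply: eq_bigr => a _.
have -> : A ^+ 4 = A *m (A *m (A *m A)) by rewrite !mulmxE !exprS expr0 mulr1.
rewrite mxE; apply: eq_bigr => b _; rewrite mxE mulr_sumr; apply: eq_bigr => c _.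
rewrite mxE !mulr_sumr; apply: eq_bigr => e _; ring.
Qed.

Lemma weighted_four_le (n bT bF x s1 s2 s3 s4 : R) :
  s1 <= n * bT -> s2 <= n * bT -> s3 <= n * bF -> s4 <= n * bF ->
  n * (32 * x) + 8 * (s1 + s2 + s3 + s4) <= n * (16 * (bT + bF) + 32 * x).
Proof. by move=> *; lra. Qed.

End FourFoldSums.

(** * Fourth moment of the remainder matrix *)

Section SpectralGaussian.
Context {R : realType} d (T : measurableType d) (P : probability T R).
Variable X : int -> int -> T -> R.
Hypothesis gX : centered_gaussian P X.
Hypothesis vX : positive_variance P X.
Variable nu : {finite_measure set (R * R)%type -> \bar R}.
Hypothesis hcov : forall p q : int * int,
  cov P X [:: (p, 1)] [:: (q, 1)] = \int[nu]_z cos (dot q z - dot p z).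
Hypothesis nuBox : nu (~` Box) = 0%E.

Local Notation cv := (cov P X).

(** The density with respect to [nu] of the covariance of two linear combinations: the real part of
    one transfer function times the conjugate of the other. *)
Definition spec s1 s2 (z : R * R) : R := tf s1 false z * tf s2 false z + tf s1 true z * tf s2 true z.

Lemma indic_bnd (D : set (R * R)) z : 0 <= (\1_D z : R) <= 1.
Proof. exact: indic01. Qed.

Lemma measurable_indicBox : measurable_fun setT (\1_Box : R * R -> R).
Proof. by apply: measurable_indic; exact: measurable_Box. Qed.

Lemma itg_tfM s1 s2 c : itg nu (fun z => tf s1 c z * tf s2 c z).
Proof.
have [C1 h1] := tf_bounded s1 c; have [C2 h2] := tf_bounded s2 c.
apply: (@itg_bounded _ _ _ nu _ (C1 * C2)); first by apply: measurable_funM; exact: measurable_tf.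
by move=> z; rewrite normrM ler_pM.
Qed.

Lemma itg_spec s1 s2 : itg nu (spec s1 s2).
Proof. by apply: itgD; exact: itg_tfM. Qed.

Lemma cov_nil s : cv [::] s = 0.
Proof.
rewrite /cov; transitivity (\int[P]_w (0 : R)); last by rewrite Int_cst mul0r.
by apply: eq_Rintegral => w _; rewrite /lincomb big_nil mul0r.
Qed.

Lemma tf_nil c z : tf [::] c z = 0 :> R. Proof. by rewrite /tf big_nil. Qed.

Lemma spec_lin (a : R) s1 s2 s z : spec (scl a s1 ++ s2) s z = a * spec s1 s z + spec s2 s z.
Proof. by rewrite /spec !tf_lin; ring. Qed.

Lemma specC s1 s2 z : spec s1 s2 z = spec s2 s1 z.
Proof. by rewrite /spec; ring. Qed.

(** Both sides are bilinear, so the identity extends from single sites by induction on the two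
    lists. *)
Lemma cov_spec s1 s2 : cv s1 s2 = \int[nu]_z spec s1 s2 z.
Proof.
have int0 (f : R * R -> R) : (forall z, f z = 0) -> \int[nu]_z f z = 0.
  move=> h; transitivity (\int[nu]_z (0 : R)); last by rewrite Int_cst mul0r.
  by apply: eq_Rintegral => z _; rewrite h.
have consE p (s : seq ((int * int) * R)) : p :: s = scl p.2 [:: (p.1, 1)] ++ s.
  by case: p => e a; rewrite /scl /= mulr1.
have step (p : (int * int) * R) s t : cv [:: (p.1, 1)] t = \int[nu]_z spec [:: (p.1, 1)] t z ->
    cv s t = \int[nu]_z spec s t z -> cv (p :: s) t = \int[nu]_z spec (p :: s) t z.
  move=> h1 h2; rewrite consE (cov_lin gX) h1 h2 -IntZ; last exact: itg_spec.
  rewrite -IntD; [|by apply: itgZ; exact: itg_spec|exact: itg_spec].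
  by apply: eq_Rintegral => z _; rewrite spec_lin.
have nilc t : cv [::] t = \int[nu]_z spec [::] t z.
  by rewrite cov_nil int0 // => z; rewrite /spec !tf_nil !mul0r addr0.
have base p s2' : cv [:: (p, 1)] s2' = \int[nu]_z spec [:: (p, 1)] s2' z.
  rewrite covC; under eq_Rintegral do rewrite specC.
  elim: s2' => [|q s IH]; first exact: nilc.
  apply: step => //; rewrite hcov; apply: eq_Rintegral => z _.
  by rewrite /spec /tf !big_seq1 !mul1r -cos_ph -[LHS]cosN opprB.
by elim: s1 => [|p s IH]; [exact: nilc|apply: step].
Qed.

Lemma cov_box s1 s2 : cv s1 s2 = \int[nu]_z (\1_Box z * spec s1 s2 z).
Proof.
rewrite cov_spec; apply: (@Int_eq_ae _ nu _ _ (~` Box)) => //.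
- by apply: measurableC; exact: measurable_Box.
- exact: (itg_meas (itg_spec s1 s2)).
- apply: measurable_funM; first exact: measurable_indicBox.
  exact: (itg_meas (itg_spec s1 s2)).
- by move=> z /contrapT bz; rewrite indicE mem_set // mul1r.
Qed.

Variable F : seq (R * R).
Hypothesis gF : goodF F.

Definition rest : set (R * R) := Box `&` [set z | z \notin F].

Lemma measurable_rest : measurable rest.
Proof.
apply: measurableI; first exact: measurable_Box.
have -> : [set z | z \notin F] = ~` [set z | z \in F] by apply/seteqP; split=> z /= /negP.
apply: measurableC; elim: (F) => [|n s IH].
  by rewrite (_ : [set z | _] = set0) //; apply/seteqP; split.
rewrite (_ : [set z | _] = [set n] `|` [set z | z \in s]).
  by apply: measurableU => //; exact: measurable_pt.
apply/seteqP; split=> z /=; rewrite inE; first by case/predU1P; [left|right].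
by case=> ->; rewrite ?eqxx ?orbT.
Qed.

Lemma rest_indic z : Box z -> \1_rest z = (z \notin F)%:R :> R.
Proof.
move=> bz; rewrite indicE; congr (nat_of_bool _)%:R; apply/idP/idP; first by rewrite inE => -[].
by move=> zF; rewrite inE.
Qed.

(** Two factors, each within [kap] of a quantity bounded by 1, give an error 2 kap + kap^2 in their
    product; the outer 2 counts the phases. *)
Definition eta M : R := \int[nu]_z (\1_Box z * (2 * (2 * kap F M z + kap F M z ^+ 2))).

Lemma eta_bnd M z : 0 <= \1_Box z * (2 * (2 * kap F M z + kap F M z ^+ 2)) <=
   2 * (2 * (size F)%:R + (size F)%:R ^+ 2).
Proof.
have /andP[i0 i1] := indic_bnd Box z; have /andP[k0 k1] := kap_bnd F M z.
have q0 : kap F M z ^+ 2 <= (size F)%:R ^+ 2 by rewrite ler_pXn2r ?nnegrE.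
have q1 := sqr_ge0 (kap F M z).
rewrite mulr_ge0 //=; last by rewrite mulr_ge0 // addr_ge0 // mulr_ge0.
rewrite -[leRHS]mul1r ler_pM //; [by rewrite mulr_ge0 // addr_ge0 // mulr_ge0|lra].
Qed.

Lemma measurable_eta_fun M : measurable_fun setT
  (fun z => \1_Box z * (2 * (2 * kap F M z + kap F M z ^+ 2))).
Proof.
apply: measurable_funM; first exact: measurable_indicBox.
apply: measurable_funM => //; apply: measurable_funD.
  by apply: measurable_funM => //; exact: measurable_kap.
by apply: measurable_funX; exact: measurable_kap.
Qed.

Lemma eta_itg M : itg nu (fun z => \1_Box z * (2 * (2 * kap F M z + kap F M z ^+ 2))).
Proof.
apply: (@itg_bounded _ _ _ nu _ (2 * (2 * (size F)%:R + (size F)%:R ^+ 2)) (measurable_eta_fun M)).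
by move=> z; case/andP: (eta_bnd M z) => h0 h1; rewrite ger0_norm.
Qed.

Lemma eta_ge0 M : 0 <= eta M.
Proof. by apply: Int_ge0 => z; case/andP: (eta_bnd M z). Qed.

Lemma eta_cvg : eta M @[M --> \oo] --> (0 : R).
Proof.
have -> : (0 : R) = \int[nu]_z (0 : R) by rewrite Int_cst mul0r.
apply: Int_dct.
- exact: measurable_eta_fun.
- by move=> M z; case/andP: (eta_bnd M z) => h0 h1; rewrite ger0_norm; [exact: h1|].
- move=> z; rewrite indicE; case: (boolP (z \in Box)) => [|_]; last first.
    by under eq_fun do rewrite mul0r; exact: cvg_cst.
  rewrite inE => bz; have kc := kap_cvg gF bz.
  have -> : (0 : R) = 1 * (2 * (2 * 0 + 0 ^+ 2)) by ring.
  apply: cvgM; first exact: cvg_cst.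
  apply: cvgM; first exact: cvg_cst.
  apply: cvgD; first by apply: cvgM => //; exact: cvg_cst.
  by apply: (cvg_comp _ (fun x : R => x ^+ 2)) kc _; exact: exprn_continuous.
Qed.

(** The covariance of two sites that would remain if the atoms in [F] were removed exactly. *)
Definition rr e f : R := rD nu rest (e.1%:~R - f.1%:~R) (e.2%:~R - f.2%:~R) true.

Lemma rr_swap e f : rr e f = rD nu rest (e.2%:~R - f.2%:~R) (e.1%:~R - f.1%:~R) false.
Proof. by apply: eq_Rintegral => z _; rewrite /co /= addrC. Qed.

Lemma rr_itg e f : itg nu (fun z => \1_rest z * cos (dot e z - dot f z)).
Proof.
apply: (@itg_bounded _ _ _ nu _ 1); last first.
  move=> z; rewrite normrM -[leRHS]mulr1 ler_pM ?cos_abs_le1 //.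
  by case/andP: (indic_bnd rest z) => h0 h1; rewrite ger0_norm.
apply: measurable_funM; first by apply: measurable_indic; exact: measurable_rest.
have := @measurable_cosdot2 R (e.1 - f.1, e.2 - f.2) 0.
by congr measurable_fun; apply/funext => z; rewrite /dot /= !intrB; congr cos; ring.
Qed.

Lemma rrE e f : rr e f = \int[nu]_z (\1_rest z * cos (dot e z - dot f z)).
Proof. by apply: eq_Rintegral => z _; rewrite /dot /co /=; congr (_ * cos _); ring. Qed.

Lemma rr_bnd e f : `|rr e f| <= tmass nu.
Proof.
rewrite rrE -[leRHS]mul1r; apply: Int_bound; first exact: (itg_meas (rr_itg e f)).
move=> z; rewrite normrM -[leRHS]mulr1 ler_pM ?cos_abs_le1 //.
by case/andP: (indic_bnd rest z) => h0 h1; rewrite ger0_norm.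
Qed.

Lemma cov_Ylist M e f : (0 < M)%N -> `|cv (Ylist F M e) (Ylist F M f) - rr e f| <= eta M.
Proof.
move=> M0; rewrite cov_box rrE.
have i1 : itg nu (fun z => \1_Box z * spec (Ylist F M e) (Ylist F M f) z).
  apply: (@itg_le _ _ _ nu _ (fun z => `|spec (Ylist F M e) (Ylist F M f) z|)).
  - apply: measurable_funM; first exact: measurable_indicBox.
    exact: (itg_meas (itg_spec _ _)).
  - move=> z; rewrite normrM ler_piMl //; case/andP: (indic_bnd Box z) => h0 h1.
    by rewrite ger0_norm.
  - exact/itg_norm/itg_spec.
rewrite -IntB //; last exact: rr_itg.
apply: le_trans (Int_norm _) _; first by apply: itgB => //; exact: rr_itg.
apply: Int_le => [||z].
- by apply: itg_norm; apply: itgB => //; exact: rr_itg.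
- exact: eta_itg.
case: (pselect (Box z)) => [bz|nbz]; last first.
  have i0 : \1_Box z = 0 :> R by rewrite indicE memNset.
  have i2 : \1_rest z = 0 :> R by rewrite indicE memNset // => -[].
  by rewrite i0 i2 !mul0r subrr normr0.
rewrite rest_indic // indicE mem_set // !mul1r cos_ph /spec.
set i := (z \notin F)%:R; have i01 : `|i| <= 1 by rewrite /i; case: (z \notin F); rewrite ?normr1 ?normr0 ?ler01.
(* Idempotence distributes the indicator over both factors. *)
have ii : i = i * i by rewrite /i; case: (z \notin F); rewrite ?mul1r ?mul0r.
set k := kap F M z; have k0 : 0 <= k by case/andP: (kap_bnd F M z).
have main c : `|tf (Ylist F M e) c z * tf (Ylist F M f) c z -
    i * (cos (dot e z + ph c) * cos (dot f z + ph c))| <= 2 * k + k ^+ 2.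
  have := tf_Ylist gF e c M0 bz; have := tf_Ylist gF f c M0 bz; rewrite -/i -/k.
  set a := tf _ _ _; set b := tf _ _ _; set a' := cos _; set b' := cos _ => hb ha.
  have -> : b * a - i * (b' * a') = (b - i * b') * (a - i * a') + (b - i * b') * (i * a') + (i * b') * (a - i * a').
    by rewrite {1}ii; ring.
  have ia : `|i * a'| <= 1 by rewrite normrM -[leRHS]mulr1 ler_pM // cos_abs_le1.
  have ib : `|i * b'| <= 1 by rewrite normrM -[leRHS]mulr1 ler_pM // cos_abs_le1.
  have t1 : `|(b - i * b') * (a - i * a')| <= k * k by rewrite normrM ler_pM.
  have t2 : `|(b - i * b') * (i * a')| <= k * 1 by rewrite normrM ler_pM.
  have t3 : `|(i * b') * (a - i * a')| <= 1 * k by rewrite normrM ler_pM.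
  apply: le_trans (ler_normD _ _) _; apply: le_trans (lerD (ler_normD _ _) t3) _.
  by rewrite expr2; lra.
have -> : forall x0 x1 y0 y1 : R, x0 + x1 - i * (y0 + y1) = (x0 - i * y0) + (x1 - i * y1) by move=> *; ring.
apply: le_trans (ler_normD _ _) _; apply: le_trans (lerD (main false) (main true)) _.
by rewrite -/k; lra.
Qed.

Variable M : nat.
Hypothesis M0 : (0 < M)%N.

Definition pt (p q : nat) : int * int := ((p.+1)%:Z, (q.+1)%:Z).
Definition Wl (p q : nat) := Ylist F M (pt p q) ++ Ylist F M (pt q p).
(** Covariance of two entries of the symmetrized remainder. *)
Definition V p q r s := cv (Wl p q) (Wl r s).

Lemma lincomb_Wl p q w :
  lincomb X (Wl p q) w = lincomb X (Ylist F M (pt p q)) w + lincomb X (Ylist F M (pt q p)) w.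
Proof. by rewrite /lincomb big_cat. Qed.

Lemma lincomb_WlC p q w : lincomb X (Wl p q) w = lincomb X (Wl q p) w.
Proof. by rewrite !lincomb_Wl addrC. Qed.

Lemma VC p q r s : V p q r s = V r s p q. Proof. exact: covC. Qed.
Lemma Vl p q r s : V p q r s = V q p r s.
Proof. by apply: eq_Rintegral => w _; rewrite lincomb_WlC. Qed.
Lemma VE p q r s : `|V p q r s - (rr (pt p q) (pt r s) + rr (pt p q) (pt s r) +
   rr (pt q p) (pt r s) + rr (pt q p) (pt s r))| <= 4 * eta M.
Proof.
have -> : V p q r s = cv (Ylist F M (pt p q)) (Ylist F M (pt r s)) + cv (Ylist F M (pt p q)) (Ylist F M (pt s r)) +
   cv (Ylist F M (pt q p)) (Ylist F M (pt r s)) + cv (Ylist F M (pt q p)) (Ylist F M (pt s r)).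
  have sE (s1 s2 : seq ((int * int) * R)) : s1 ++ s2 = scl 1 s1 ++ s2.
    by rewrite /scl; congr cat; rewrite -[LHS]map_id; apply: eq_map => -[e a]; rewrite mul1r.
  rewrite /V /Wl (sE (Ylist F M (pt p q))) (sE (Ylist F M (pt r s))) (cov_lin gX) !(cov_linr gX) !mul1r.
  by ring.
have h e f := cov_Ylist e f M0.
have := h (pt p q) (pt r s); have := h (pt p q) (pt s r); have := h (pt q p) (pt r s); have := h (pt q p) (pt s r).
rewrite !ler_norml => /andP[a1 a2] /andP[a3 a4] /andP[a5 a6] /andP[a7 a8]; apply/andP; split; lra.
Qed.

Lemma V_bnd p q r s : `|V p q r s| <= 4 * (tmass nu + eta M).
Proof.
have h e f := rr_bnd e f.
have := VE p q r s.
have := h (pt p q) (pt r s); have := h (pt p q) (pt s r); have := h (pt q p) (pt r s); have := h (pt q p) (pt s r).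
rewrite !ler_norml => /andP[a1 a2] /andP[a3 a4] /andP[a5 a6] /andP[a7 a8] /andP[a9 a10]; apply/andP; split; lra.
Qed.

(** With S the sum of the four ideal covariances, V^2 <= 2 (4 eta)^2 + 2 S^2 and S^2 is at most 4
    times the sum of their squares. Two of these squares average to at most [betaN] for each
    coordinate, whence 32 and 16. *)
Definition KN (N : nat) : R :=
  16 * (betaN nu rest N true + betaN nu rest N false) + 32 * eta M ^+ 2.

(** The summed index [p] sits in the first coordinate for [r1] and [r2], in the second for [r3] and
    [r4], hence both values of [betaN]. *)
Lemma sum_V2 (N q r s : nat) : (0 < N)%N -> \sum_(p < N) V p q r s ^+ 2 <= N%:R * KN N.
Proof.
move=> N0; have N1 : 0 < N%:R :> R by rewrite ltr0n.
pose r1 (p : nat) := rr (pt p q) (pt r s); pose r2 (p : nat) := rr (pt p q) (pt s r).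
pose r3 (p : nat) := rr (pt q p) (pt r s); pose r4 (p : nat) := rr (pt q p) (pt s r).
have ptw (p : 'I_N) : V p q r s ^+ 2 <= 32 * eta M ^+ 2 + 8 * (r1 p ^+ 2 + r2 p ^+ 2 + r3 p ^+ 2 + r4 p ^+ 2).
  have := VE p q r s; rewrite -/(r1 p) -/(r2 p) -/(r3 p) -/(r4 p).
  set S := _ + r4 p => h.
  have h2 : (V p q r s - S) ^+ 2 <= (4 * eta M) ^+ 2.
    by rewrite -(real_normK (num_real (_ - _))) ler_pXn2r // nnegrE // mulr_ge0 // eta_ge0.
  have e1 : V p q r s ^+ 2 <= 2 * (V p q r s - S) ^+ 2 + 2 * S ^+ 2.
    rewrite -subr_ge0; have -> : 2 * (V p q r s - S) ^+ 2 + 2 * S ^+ 2 - V p q r s ^+ 2 = (V p q r s - 2 * S) ^+ 2 by ring.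
    exact: sqr_ge0.
  have e2 : S ^+ 2 <= 4 * (r1 p ^+ 2 + r2 p ^+ 2 + r3 p ^+ 2 + r4 p ^+ 2).
    rewrite /S -subr_ge0; set a := r1 p; set b := r2 p; set c := r3 p; set e := r4 p.
    have -> : 4 * (a ^+ 2 + b ^+ 2 + c ^+ 2 + e ^+ 2) - (a + b + c + e) ^+ 2 =
      (a - b) ^+ 2 + (a - c) ^+ 2 + (a - e) ^+ 2 + (b - c) ^+ 2 + (b - e) ^+ 2 + (c - e) ^+ 2 by ring.
    by rewrite !addr_ge0 // sqr_ge0.
  move: h2 e1 e2; rewrite exprMn; set x := eta M ^+ 2; lra.
apply: le_trans (ler_sum _ (fun i _ => ptw i)) _.
have -> : \sum_(i < N) (32 * eta M ^+ 2 + 8 * (r1 i ^+ 2 + r2 i ^+ 2 + r3 i ^+ 2 + r4 i ^+ 2)) =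
  N%:R * (32 * eta M ^+ 2) + 8 * (\sum_(i < N) r1 i ^+ 2 + \sum_(i < N) r2 i ^+ 2 +
    \sum_(i < N) r3 i ^+ 2 + \sum_(i < N) r4 i ^+ 2).
  rewrite big_split /= sumr_const card_ord -(mulr_natl (32 * _) N).
  congr (_ + _).
  rewrite -mulr_sumr; congr (_ * _).
  by rewrite !big_split.
have bt c v sd : \sum_(p < N) rD nu rest (p.+1%:R - c) v sd ^+ 2 <= N%:R * betaN nu rest N sd.
  rewrite -ler_pdivrMl //; apply: avg_rD2 => //; exact: measurable_rest.
have E1 p : r1 p = rD nu rest (p.+1%:R - r.+1%:R) (q.+1%:R - s.+1%:R) true by [].
have E2 p : r2 p = rD nu rest (p.+1%:R - s.+1%:R) (q.+1%:R - r.+1%:R) true by [].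
have E3 p : r3 p = rD nu rest (p.+1%:R - s.+1%:R) (q.+1%:R - r.+1%:R) false by rewrite /r3 rr_swap.
have E4 p : r4 p = rD nu rest (p.+1%:R - r.+1%:R) (q.+1%:R - s.+1%:R) false by rewrite /r4 rr_swap.
have b1 := bt r.+1%:R (q.+1%:R - s.+1%:R) true; have b2 := bt s.+1%:R (q.+1%:R - r.+1%:R) true.
have b3 := bt s.+1%:R (q.+1%:R - r.+1%:R) false; have b4 := bt r.+1%:R (q.+1%:R - s.+1%:R) false.
under eq_bigr do rewrite E1.
under [X in _ + 8 * (_ + X + _ + _)]eq_bigr do rewrite E2.
under [X in _ + 8 * (_ + _ + X + _)]eq_bigr do rewrite E3.
under [X in _ + 8 * (_ + _ + _ + X)]eq_bigr do rewrite E4.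
rewrite /KN; apply: (weighted_four_le _ b1 b2 b3 b4).
Qed.

Definition WY (N : nat) (w : T) : 'M[R]_N := \matrix_(i, j) lincomb X (Wl i j) w.

Lemma WY_sym N w : (WY N w)^T = WY N w.
Proof. by apply/matrixP => i j; rewrite !mxE lincomb_WlC. Qed.

Lemma itg_lincomb4 a b c e :
  itg P (fun w => lincomb X a w * lincomb X b w * lincomb X c w * lincomb X e w).
Proof.
apply: (@itg_le _ _ _ P _ (fun w => lincomb X a w ^+ 4 + lincomb X b w ^+ 4 + lincomb X c w ^+ 4 + lincomb X e w ^+ 4)).
- by do 3?[apply: measurable_funM]; exact: (measurable_lincomb gX).
- move=> w; set x := lincomb X a w; set y := lincomb X b w; set z := lincomb X c w; set u := lincomb X e w.
  rewrite !normrM.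
  have p4 (v : R) : v ^+ 4 = `|v| ^+ 4.
    by rewrite -normrX ger0_norm // exprn_even_ge0.
  rewrite (p4 x) (p4 y) (p4 z) (p4 u); move: `|x| `|y| `|z| `|u| (normr_ge0 x) (normr_ge0 y) (normr_ge0 z) (normr_ge0 u) => {x y z u} x y z u _ _ _ _.
  have := sqr_ge0 (x * y - z * u); have := sqr_ge0 (x ^+ 2 - y ^+ 2); have := sqr_ge0 (z ^+ 2 - u ^+ 2).
  have := sqr_ge0 (x ^+ 2); have := sqr_ge0 (y ^+ 2); have := sqr_ge0 (z ^+ 2); have := sqr_ge0 (u ^+ 2); nra.
- by do 3?[apply: itgD]; exact: lincomb_itg4.
Qed.

Lemma WY_trace4E N w : \tr ((N%:R^-1 *: WY N w) ^+ 4) = \sum_(a < N) \sum_(b < N) \sum_(c < N) \sum_(e < N)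
  N%:R^-1 ^+ 4 * (lincomb X (Wl a b) w * lincomb X (Wl b c) w * lincomb X (Wl c e) w * lincomb X (Wl e a) w).
Proof.
rewrite mxtrace4; apply: eq_bigr => a _; apply: eq_bigr => b _; apply: eq_bigr => c _; apply: eq_bigr => e _.
by rewrite !mxE; ring.
Qed.

Lemma WY_trace4_itg N : itg P (fun w => \tr ((N%:R^-1 *: WY N w) ^+ 4)).
Proof.
under eq_fun do rewrite WY_trace4E.
do 4!apply: itg_sum => ?; apply: itgZ; exact: itg_lincomb4.
Qed.

(* Each of the three Wick pairings has covariances whose squares average to at most KN. *)
Lemma WY_trace4 N : (0 < N)%N ->
  \int[P]_w \tr ((N%:R^-1 *: WY N w) ^+ 4) <= (kurt : R) * KN N.
Proof.
move=> N0; have N1 : N%:R != 0 :> R by rewrite pnatr_eq0 -lt0n.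
under eq_Rintegral do rewrite WY_trace4E.
have i1 (a b c e : nat) : itg P (fun w => N%:R^-1 ^+ 4 *
   (lincomb X (Wl a b) w * lincomb X (Wl b c) w * lincomb X (Wl c e) w * lincomb X (Wl e a) w)).
  by apply: itgZ; exact: itg_lincomb4.
have E1 (a b c e : nat) : \int[P]_w (N%:R^-1 ^+ 4 *
   (lincomb X (Wl a b) w * lincomb X (Wl b c) w * lincomb X (Wl c e) w * lincomb X (Wl e a) w)) =
   N%:R^-1 ^+ 4 * ((kurt : R) / 3 * (V a b b c * V c e e a + V a b c e * V b c e a + V a b e a * V b c c e)).
  by rewrite IntZ ?(lincomb_wick gX vX) //; exact: itg_lincomb4.
rewrite Int_sum; last by move=> a; do 3!apply: itg_sum => ?; exact: i1.
under eq_bigr => a _.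
  rewrite Int_sum; last by move=> b; do 2!apply: itg_sum => ?; exact: i1.
  under eq_bigr => b _.
    rewrite Int_sum; last by move=> c; do 1!apply: itg_sum => ?; exact: i1.
    under eq_bigr => c _.
      rewrite Int_sum; last by move=> e; exact: i1.
      under eq_bigr => e _ do rewrite E1.
      over.
    over.
  over.
have kg : 0 <= (kurt : R) by exact: (kurt_ge0).
(* Squares of the two factors of each Wick pairing. A product is at most half the sum of the
   squares, so each of the six fourfold sums carries kurt / 6. *)
pose G1 (a b c e : nat) := V a b b c ^+ 2; pose G2 (a b c e : nat) := V c e e a ^+ 2.
pose G3 (a b c e : nat) := V a b c e ^+ 2; pose G4 (a b c e : nat) := V b c e a ^+ 2.
pose G5 (a b c e : nat) := V a b e a ^+ 2; pose G6 (a b c e : nat) := V b c c e ^+ 2.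
have S1 : \sum_(a < N) \sum_(b < N) \sum_(c < N) \sum_(e < N) G1 a b c e <= N%:R ^+ 4 * KN N.
  by apply: (@sum4_le _ _ (fun a b c e : 'I_N => G1 a b c e)) => b c e; exact: sum_V2.
have S2 : \sum_(a < N) \sum_(b < N) \sum_(c < N) \sum_(e < N) G2 a b c e <= N%:R ^+ 4 * KN N.
  apply: (@sum4_le _ _ (fun a b c e : 'I_N => G2 a b c e)) => b c e.
  by under eq_bigr do rewrite /G2 VC Vl; exact: sum_V2.
have S3 : \sum_(a < N) \sum_(b < N) \sum_(c < N) \sum_(e < N) G3 a b c e <= N%:R ^+ 4 * KN N.
  by apply: (@sum4_le _ _ (fun a b c e : 'I_N => G3 a b c e)) => b c e; exact: sum_V2.
have S4 : \sum_(a < N) \sum_(b < N) \sum_(c < N) \sum_(e < N) G4 a b c e <= N%:R ^+ 4 * KN N.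
  apply: (@sum4_le _ _ (fun a b c e : 'I_N => G4 a b c e)) => b c e.
  by under eq_bigr do rewrite /G4 VC Vl; exact: sum_V2.
(* Here [a] occurs twice in the covariance, so the free index averaged is [e]. *)
have S5 : \sum_(a < N) \sum_(b < N) \sum_(c < N) \sum_(e < N) G5 a b c e <= N%:R ^+ 4 * KN N.
  apply: (@sum4_last_le _ _ (fun a b c e : 'I_N => G5 a b c e)) => b c e.
  by under eq_bigr do rewrite /G5 VC; exact: sum_V2.
have S6 : \sum_(a < N) \sum_(b < N) \sum_(c < N) \sum_(e < N) G6 a b c e <= N%:R ^+ 4 * KN N.
  apply: (@sum4_last_le _ _ (fun a b c e : 'I_N => G6 a b c e)) => b c e.
  by under eq_bigr do rewrite /G6 VC Vl; exact: sum_V2.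
apply: (@le_trans _ _ (\sum_(a < N) \sum_(b < N) \sum_(c < N) \sum_(e < N)
   (N%:R^-1 ^+ 4 * ((kurt : R) / 6)) * (G1 a b c e + G2 a b c e + G3 a b c e + G4 a b c e + G5 a b c e + G6 a b c e))).
  apply: ler_sum => a _; apply: ler_sum => b _; apply: ler_sum => c _; apply: ler_sum => e _.
  rewrite -[leRHS]mulrA ler_wpM2l ?exprn_ge0 ?invr_ge0 //.
  have -> : (kurt : R) / 3 = (kurt : R) / 6 * 2 by field.
  rewrite -[leLHS]mulrA; apply: ler_wpM2l; first by lra.
  rewrite /G1 /G2 /G3 /G4 /G5 /G6.
  have am (x y : R) : 2 * (x * y) <= x ^+ 2 + y ^+ 2.
    by rewrite -subr_ge0; have -> : x ^+ 2 + y ^+ 2 - 2 * (x * y) = (x - y) ^+ 2 by [ring|]; exact: sqr_ge0.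
  have := am (V a b b c) (V c e e a); have := am (V a b c e) (V b c e a); have := am (V a b e a) (V b c c e); lra.
under eq_bigr do under eq_bigr do under eq_bigr do rewrite -mulr_sumr !big_split /=.
under eq_bigr do under eq_bigr do rewrite -mulr_sumr !big_split /=.
under eq_bigr do rewrite -mulr_sumr !big_split /=.
rewrite -mulr_sumr !big_split /=.
have -> : (kurt : R) * KN N = (N%:R^-1 ^+ 4 * ((kurt : R) / 6)) * (6 * (N%:R ^+ 4 * KN N)) by field.
rewrite ler_wpM2l //; last by lra.
rewrite mulr_ge0 ?exprn_ge0 ?invr_ge0 //; lra.
Qed.

Lemma fro_scale (c : R) m n (A : 'M[R]_(m, n)) : fro (c *: A) = c ^+ 2 * fro A.
Proof.
rewrite /fro mulr_sumr; apply: eq_bigr => i _; rewrite mulr_sumr; apply: eq_bigr => j _.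
by rewrite mxE exprMn.
Qed.

Lemma fro_mean_le (N : nat) (A : T -> 'M[R]_N) (K : R) : (0 < N)%N ->
  (forall i j, itg P (fun w => A w i j ^+ 2)) -> (forall i j, \int[P]_w (A w i j ^+ 2) <= K) ->
  itg P (fun w => fro (N%:R^-1 *: A w)) /\ \int[P]_w fro (N%:R^-1 *: A w) <= K.
Proof.
move=> N0 iA hA; have N1 : N%:R != 0 :> R by rewrite pnatr_eq0 -lt0n.
have i2 : itg P (fun w => fro (A w)) by do 2!apply: itg_sum => ?; exact: iA.
split; first by under eq_fun do rewrite fro_scale; exact: itgZ.
under eq_Rintegral do rewrite fro_scale.
rewrite IntZ // Int_sum; last by move=> i; apply: itg_sum => j; exact: iA.
under eq_bigr do rewrite Int_sum //.
have -> : K = N%:R^-1 ^+ 2 * \sum_(i < N) \sum_(j < N) K.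
  by rewrite !sumr_const !card_ord -(mulr_natl K N) -(mulr_natl (N%:R * K) N); field.
rewrite ler_wpM2l ?exprn_ge0 ?invr_ge0 //; apply: ler_sum => i _; apply: ler_sum => j _; exact: hA.
Qed.

Lemma fro_WY N : (0 < N)%N -> itg P (fun w => fro (N%:R^-1 *: WY N w)) /\
  \int[P]_w fro (N%:R^-1 *: WY N w) <= 4 * (tmass nu + eta M).
Proof.
move=> N0; apply: fro_mean_le => // i j; under eq_fun do rewrite mxE.
  exact: lincomb_itg2.
rewrite cov_sqr; apply: le_trans (ler_norm _) _; exact: V_bnd.
Qed.

Lemma fro_WX N : (0 < N)%N -> itg P (fun w => fro (N%:R^-1 *: WN X N w)) /\
  \int[P]_w fro (N%:R^-1 *: WN X N w) <= 4 * tmass nu.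
Proof.
move=> N0; pose L i j : seq ((int * int) * R) := [:: (pt i j, 1); (pt j i, 1)].
have LE i j w : WN X N w i j = lincomb X (L i j) w.
  by rewrite mxE /lincomb /L big_cons big_seq1 !mul1r.
apply: fro_mean_le => // i j; under eq_fun do rewrite LE.
  exact: lincomb_itg2.
rewrite cov_sqr cov_spec; apply: le_trans (ler_norm _) _; apply: Int_bound.
  exact: (itg_meas (itg_spec _ _)).
move=> z; have b c : `|tf (L i j) c z| <= 2.
  rewrite /tf /L big_cons big_seq1 !mul1r; apply: le_trans (ler_normD _ _) _.
  by have := cos_abs_le1 (dot (pt i j) z + ph c); have := cos_abs_le1 (dot (pt j i) z + ph c); rewrite /=; lra.
(* On the diagonal [spec] is the squared modulus of a sum of two unit exponentials. *)
have key : spec (L i j) (L i j) z <= 4.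
  rewrite /spec /tf /L !(big_cons, big_nil) /= !mul1r /ph /= !addr0 !cosDpihalf.
  set u := dot (pt i j) z; set v := dot (pt j i) z.
  have := cos2Dsin2 u; have := cos2Dsin2 v; have := sqr_ge0 (cos u - cos v); have := sqr_ge0 (sin u - sin v); nra.
rewrite ger0_norm //; by rewrite /spec -!expr2 addr_ge0 // sqr_ge0.
Qed.

End SpectralGaussian.

(** * The low-rank part and limits of traces *)

Section LowRank.
Context {R : realType}.
Implicit Types (n z : R * R) (u : R * R -> bool -> R).

(** Limit of the averages of cos (j w + b): only multiples of 2 pi contribute. *)
Definition avl (w b : R) : R := if sin (w / 2) == 0 then cos b else 0.

Lemma avg_cos_cvg (w b : R) :
  N%:R^-1 * \sum_(j < N) cos (j.+1%:R * w + b) @[N --> \oo] --> avl w b.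
Proof.
rewrite /avl; case: eqP => [s0|/eqP s0]; last first.
  apply/cvgr0Pnorm_lt => e e0; have /cvgrPdist_lt/(_ e e0) := Bk_cvg s0.
  move=> [N0 _ h]; exists N0.+1 => // N /= NN.
  have := h N (ltnW NN); rewrite sub0r normrN ger0_norm ?Bk_ge0 //.
  by apply: le_lt_trans; apply: avg_cos_bound; exact: leq_ltn_trans NN.
(* When sin (w / 2) = 0 all summands are equal. *)
have per (j : nat) : cos (j.+1%:R * w + b) = cos b.
  elim: (j.+1) => [|i IH]; first by rewrite mul0r add0r.
  rewrite -IH; have -> : i.+1%:R * w + b = (i%:R * w + b + w / 2) + w / 2 by rewrite -natr1; field.
  rewrite cosD s0 mulr0 subr0; set c := i%:R * w + b.
  have -> : cos (c + w / 2) * cos (w / 2) = cos c * cos (w / 2) ^+ 2 by rewrite cosD s0; ring.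
  have := cos2Dsin2 (w / 2); rewrite s0 expr0n addr0 => ->; ring.
apply: cvg_near_cst; exists 1%N => // N /= N0.
under eq_bigr do rewrite per; rewrite sumr_const card_ord -(mulr_natl (cos b) N) mulKf //.
by rewrite pnatr_eq0 -lt0n.
Qed.

Definition cs (a : bool) (t : R) : R := cos (t + ph a).

Lemma csM a b s t : cs a s * cs b t = 2^-1 * (cos ((s - t) + (ph a - ph b)) + cos ((s + t) + (ph a + ph b))).
Proof.
rewrite /cs; have -> : (s - t) + (ph a - ph b) = (s + ph a) - (t + ph b) by ring.
have -> : (s + t) + (ph a + ph b) = (s + ph a) + (t + ph b) by ring.
by rewrite (cosB (s + ph a)) (cosD (s + ph a)); field.
Qed.

(* one rank-one term: left (frequency, phase), right (frequency, phase), coefficient index, sign *)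
Definition lrow : Type := (R * bool) * (R * bool) * ((R * R) * bool) * R.
Definition lrow0 : lrow := ((0, false), (0, false), ((0, 0), false), 0).
Definition cf u (r : lrow) : R := r.2 * u r.1.2.1 r.1.2.2.
Definition lf (r : lrow) (t : R) : R := cs r.1.1.1.2 (t * r.1.1.1.1).
Definition rf (r : lrow) (t : R) : R := cs r.1.1.2.2 (t * r.1.1.2.1).

(** The addition formulas separate the row index from the column index. Two phases, two terms for
    each and the symmetrization give eight rank-one terms per frequency. *)
Definition rows1 n : seq lrow :=
  [:: ((n.1, false), (n.2, false), (n, false), 1); ((n.1, true), (n.2, true), (n, false), -1);
      ((n.1, true), (n.2, false), (n, true), 1); ((n.1, false), (n.2, true), (n, true), 1);
      ((n.2, false), (n.1, false), (n, false), 1); ((n.2, true), (n.1, true), (n, false), -1);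
      ((n.2, true), (n.1, false), (n, true), 1); ((n.2, false), (n.1, true), (n, true), 1)].

Lemma rows1E n u (i j : nat) :
  \sum_(r <- rows1 n) cf u r * lf r i.+1%:R * rf r j.+1%:R =
  (cos (dot (pt i j) n + ph false) + cos (dot (pt j i) n + ph false)) * u n false +
  (cos (dot (pt i j) n + ph true) + cos (dot (pt j i) n + ph true)) * u n true.
Proof.
rewrite /rows1 !big_cons big_nil /cf /lf /rf /cs /dot /ph /= !addr0 !cosDpihalf -!pmulrn.
rewrite (cosD (i.+1%:R * n.1)) (cosD (j.+1%:R * n.1)) (sinD (i.+1%:R * n.1)) (sinD (j.+1%:R * n.1)).
ring.
Qed.

Variable F : seq (R * R).

Definition rows : seq lrow := flatten [seq rows1 n | n <- F].
Definition row (r : 'I_(size rows)) : lrow := nth lrow0 rows r.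

Lemma sum_rows (g : lrow -> R) : \sum_(r < size rows) g (row r) = \sum_(n <- F) \sum_(r <- rows1 n) g r.
Proof.
have -> : \sum_(n <- F) \sum_(r <- rows1 n) g r = \sum_(r <- rows) g r by rewrite big_flatten big_map.
by rewrite (big_nth lrow0) big_mkord.
Qed.

(** Contribution of the frequencies in [F] to the matrix when [u] gives their Fourier
    coefficients. *)
Definition WZ u N : 'M[R]_N := \matrix_(i, j) \sum_(n <- F)
  ((cos (dot (pt i j) n + ph false) + cos (dot (pt j i) n + ph false)) * u n false +
   (cos (dot (pt i j) n + ph true) + cos (dot (pt j i) n + ph true)) * u n true).

Lemma WZ_sym u N : (WZ u N)^T = WZ u N.
Proof. by apply/matrixP => i j; rewrite !mxE; apply: eq_bigr => n _; rewrite ![cos (dot (pt j i) _ + _) + _]addrC. Qed.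

Definition Lmx u N : 'M[R]_(N, size rows) := \matrix_(i, r) (cf u (row r) * lf (row r) i.+1%:R).
Definition Rmx N : 'M[R]_(size rows, N) := \matrix_(r, j) (N%:R^-1 * rf (row r) j.+1%:R).

Lemma WZ_factor u N : N%:R^-1 *: WZ u N = Lmx u N *m Rmx N.
Proof.
apply/matrixP => i j; rewrite !mxE; under eq_bigr do rewrite -rows1E.
rewrite -sum_rows mulr_sumr; apply: eq_bigr => r _; rewrite !mxE; ring.
Qed.

(** Limit of the product of the two factors of [WZ] in reverse order; its size is independent of N
    and its entries are linear in [u]. *)
Definition Gam u : 'M[R]_(size rows) := \matrix_(r, r') (cf u (row r') * (2^-1 *
  (avl ((row r).1.1.2.1 - (row r').1.1.1.1) (ph (row r).1.1.2.2 - ph (row r').1.1.1.2) +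
   avl ((row r).1.1.2.1 + (row r').1.1.1.1) (ph (row r).1.1.2.2 + ph (row r').1.1.1.2)))).

Lemma RL_cvg u r r' : (Rmx N *m Lmx u N) r r' @[N --> \oo] --> Gam u r r'.
Proof.
pose y := (row r).1.1.2.1; pose b := (row r).1.1.2.2; pose x := (row r').1.1.1.1; pose a := (row r').1.1.1.2.
have -> : (fun N => (Rmx N *m Lmx u N) r r') = (fun N => cf u (row r') * (2^-1 *
   (N%:R^-1 * \sum_(j < N) cos (j.+1%:R * (y - x) + (ph b - ph a)) +
    N%:R^-1 * \sum_(j < N) cos (j.+1%:R * (y + x) + (ph b + ph a))))).
  apply/funext => N; rewrite mxE -mulrDr -big_split /= !mulr_sumr; apply: eq_bigr => j _.
  rewrite !mxE /rf /lf -/y -/b -/x -/a.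
  have -> : N%:R^-1 * cs b (j.+1%:R * y) * (cf u (row r') * cs a (j.+1%:R * x)) =
    cf u (row r') * N%:R^-1 * (cs b (j.+1%:R * y) * cs a (j.+1%:R * x)) by ring.
  by rewrite csM -mulrBr -mulrDr; ring.
rewrite mxE; apply: cvgM; first exact: cvg_cst.
by apply: cvgM; [exact: cvg_cst|apply: cvgD; exact: avg_cos_cvg].
Qed.

Lemma cvg_expmx q (A : nat -> 'M[R]_q) (B : 'M[R]_q) k :
  (forall i j, A N i j @[N --> \oo] --> B i j) ->
  forall i j, (A N ^+ k) i j @[N --> \oo] --> (B ^+ k) i j.
Proof.
move=> h; elim: k => [|k IH] i j.
  by under eq_fun do rewrite expr0; rewrite expr0; exact: cvg_cst.
under eq_fun do rewrite exprS -mulmxE mxE; rewrite exprS -mulmxE mxE.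
by apply: (cvg_big add_continuous) => l _; apply: cvgM.
Qed.

Definition Tk u k : R := \tr (Gam u ^+ k).

(** The traces are those of the product in reverse order, which converges entrywise. *)
Lemma WZ_trace_cvg u k : (0 < k)%N -> \tr ((N%:R^-1 *: WZ u N) ^+ k) @[N --> \oo] --> Tk u k.
Proof.
case: k => // k _; under eq_fun do rewrite WZ_factor mxtrace_exp_mulC.
by apply: (cvg_big add_continuous) => i _; apply: cvg_expmx; exact: RL_cvg.
Qed.

End LowRank.

(** * From pointwise convergence to convergence in probability *)

Section PointwiseToWhp.
Context {R : realType} d (T : measurableType d) (P : probability T R).

Lemma cvg_whp (f : nat -> T -> R) (g : T -> R) (e : R) : 0 < e ->
  (forall n, measurable_fun setT (f n)) -> measurable_fun setT g ->
  (forall w, f n w @[n --> \oo] --> g w) ->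
  exists N0, forall N, (N0 <= N)%N -> whp P e (fun w => `|f N w - g w| <= e).
Proof.
move=> e0 mf mg fg.
(* Truncation allows bounded convergence; Markov is then applied at level e / 2, which excludes the
   truncated branch. *)
pose h n w := Num.min e `|f n w - g w|.
have mh n : measurable_fun setT (h n).
  by apply: measurable_minr => //; apply: measurableT_comp => //; exact: measurable_funB.
have h0 n w : 0 <= h n w by rewrite le_min (ltW e0) /=.
have hb n w : `|h n w| <= e by rewrite ger0_norm // ge_min lexx.
have hc w : h n w @[n --> \oo] --> (0 : R).
  apply: (@squeeze_cvgr _ _ _ _ (fun=> 0) (fun n => `|f n w - g w|)) => //; last 2 first.
  - exact: cvg_cst.
  - rewrite -(normr0 R); apply: cvg_norm; rewrite -(subrr (g w)).
    by apply: cvgB => //; exact: cvg_cst.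
  by apply: nearW => n; rewrite h0 /= ge_min lexx orbT.
have := @Int_dct _ _ _ P h (fun=> 0) e mh hb hc.
rewrite Int_cst mul0r => /cvgr0Pnorm_lt/(_ (e / 2 * e)) []; first by rewrite mulr_gt0 // divr_gt0.
move=> N0 _ H; exists N0 => N NN.
have ih : itg P (h N) by exact: itg_bounded (mh N) (hb N).
have e2 : 0 < e / 2 by rewrite divr_gt0.
case: (whp_markov e2 ih (h0 N) (e := e)).
  by have := H N NN; rewrite /= ger0_norm ?Int_ge0 // => /ltW.
move=> E [mE PE HE]; exists E; split=> // w /HE; rewrite /h ge_min => /orP[|]; first by lra.
by move=> h1; apply: le_trans h1 _; lra.
Qed.

End PointwiseToWhp.

(** * Approximating traces by functions of finitely many Fourier coefficients *)

Section TraceApproximation.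
Context {R : realType} d (T : measurableType d) (P : probability T R).
Variable X : int -> int -> T -> R.
Hypothesis gX : centered_gaussian P X.
Hypothesis vX : positive_variance P X.
Variable nu : {finite_measure set (R * R)%type -> \bar R}.
Hypothesis hcov : forall p q : int * int,
  cov P X [:: (p, 1)] [:: (q, 1)] = \int[nu]_z cos (dot q z - dot p z).
Hypothesis nuBox : nu (~` Box) = 0%E.

(** Empirical Fourier coefficient at [n], its two phases standing for real and imaginary parts. *)
Definition Ul (M : nat) (n : R * R) (b : bool) : seq ((int * int) * R) :=
  [seq (f, M%:R^-1 ^+ 2 * cos (dot f n + ph b)) | f <- idx M].
Definition U M w n b : R := lincomb X (Ul M n b) w.

Lemma Z_decomp F M e w : X e.1 e.2 w - lincomb X (Ylist F M e) w =
  \sum_(n <- F) (cos (dot e n + ph false) * U M w n false + cos (dot e n + ph true) * U M w n true).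
Proof.
rewrite /Ylist lincomb_lin.
have -> : lincomb X [:: (e, 1)] w = X e.1 e.2 w by rewrite /lincomb big_seq1 mul1r.
rewrite mulN1r opprD opprK addrCA subrr addr0 /lincomb big_map /=.
under eq_bigr => f _ do rewrite -mulrA mulr_suml mulr_sumr.
rewrite exchange_big /=; apply: eq_bigr => n _.
rewrite /U /lincomb !big_map /= !mulr_sumr -big_split /=; apply: eq_bigr => f _.
by rewrite cos_ph; ring.
Qed.

Lemma WN_decomp F M N w : WN X N w = WZ F (U M w) N + WY X F M N w.
Proof.
apply/matrixP => i j; rewrite !mxE lincomb_Wl.
have E e := Z_decomp F M e w.
have E1 e : X e.1 e.2 w = \sum_(n <- F) (cos (dot e n + ph false) * U M w n false +
    cos (dot e n + ph true) * U M w n true) + lincomb X (Ylist F M e) w by rewrite -E subrK.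
rewrite (E1 (pt i j)) (E1 (pt j i)) addrACA -big_split /=; congr (_ + _).
by apply: eq_bigr => n _; ring.
Qed.

Lemma measurable_U M n b : measurable_fun setT (fun w => U M w n b).
Proof. exact: (measurable_lincomb gX). Qed.

Lemma measurable_WN N i j : measurable_fun setT (fun w => WN X N w i j).
Proof.
under eq_fun do rewrite mxE; case: gX => mX _; exact: measurable_funD.
Qed.

Lemma WN_sym N w : (WN X N w)^T = WN X N w.
Proof. by apply/matrixP => i j; rewrite !mxE addrC. Qed.

Lemma measurable_Tk F M k : measurable_fun setT (fun w => Tk F (U M w) k).
Proof.
apply: measurable_sum => i; apply: (measurable_expmx (A := fun w => Gam F (U M w))) => r r'.
under eq_fun do rewrite mxE; apply: measurable_funM => //; apply: measurable_funM => //.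
exact: measurable_U.
Qed.

(** The integral is half the sum of the masses that [rest F] gives to the lines where coordinate [s]
    equals that of [z] and its negative. *)
Definition lines F (dl : R) : Prop := forall s z, rest F z ->
  \int[nu]_z' (\1_(rest F) z' * (2^-1 * (Bk0 (co s z - co s z') + Bk0 (co s z + co s z')))) <= dl.

Lemma fro_diff_le N (A B : 'M[R]_N) : fro (A - B) <= 2 * fro A + 2 * fro B.
Proof.
rewrite /fro !mulr_sumr -big_split; apply: ler_sum => i _; rewrite /= !mulr_sumr -big_split.
apply: ler_sum => j _; rewrite !mxE -subr_ge0 /=.
have -> : 2 * A i j ^+ 2 + 2 * B i j ^+ 2 - (A i j - B i j) ^+ 2 = (A i j + B i j) ^+ 2 by ring.
exact: sqr_ge0.
Qed.

(** The two [betaN] terms and the [eta] term each contribute at most 32 dl (m + 1), whence the 64 in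
    [dl]. *)
Lemma KN_small (dl eta0 bT bF kp m t : R) : 0 <= kp -> 0 <= m -> 0 <= eta0 -> eta0 <= 1 -> eta0 <= dl ->
  0 < t -> dl = t / (64 * (kp + 1) * (m + 1)) -> bT <= dl * m + dl -> bF <= dl * m + dl ->
  kp * (16 * (bT + bF) + 32 * eta0 ^+ 2) <= t.
Proof.
move=> kp0 m0 e0 e1 ed t0 dE hT hF.
have m1 : 0 < m + 1 by lra.
have k1 : 0 < kp + 1 by lra.
have dm : dl * (m + 1) = t / (64 * (kp + 1)).
  by rewrite dE; field; rewrite !gt_eqF.
have e2 : eta0 ^+ 2 <= dl * (m + 1).
  rewrite expr2; apply: ler_pM => //; lra.
have h : 16 * (bT + bF) + 32 * eta0 ^+ 2 <= t / (kp + 1).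
  have -> : t / (kp + 1) = 64 * (t / (64 * (kp + 1))) by field; rewrite gt_eqF.
  by rewrite -dm; lra.
apply: (@le_trans _ _ (kp * (t / (kp + 1)))); first exact: ler_wpM2l.
rewrite mulrCA -[leRHS]mulr1 ler_wpM2l ?(ltW t0) // ler_pdivrMr // mul1r; lra.
Qed.

(** The order of the quantifiers matters: the threshold [dl] is chosen before [F], the window [M]
    before the size [N]. The approximant then does not involve [N]. *)
Lemma trace_approx_atoms k (eps : R) : (2 < k)%N -> 0 < eps -> exists dl, 0 < dl /\
  forall F, goodF F -> lines F dl -> exists M0, forall M, (M0 <= M)%N -> exists N0, forall N, (N0 <= N)%N ->
    whp P eps (fun w => `|\tr ((N%:R^-1 *: WN X N w) ^+ k) - Tk F (U M w) k| <= eps).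
Proof.
move=> k2 e0; set m := tmass nu; have m0 : 0 <= m := tmass_ge0 nu.
have k0 : 0 < k%:R :> R by rewrite ltr0n; exact: leq_trans k2.
(* Markov's inequality: the Frobenius norms have mean at most 4 (m + 1) and are to exceed [C1] with
   probability at most eps / 4. *)
pose C1 := 16 * (m + 1) / eps; have C10 : 0 < C1 by rewrite divr_gt0 //; lra.
(* The low-rank part is a difference of two matrices bounded by [C1], and [fro_diff_le] costs a
   factor 2 on each. *)
pose C := 4 * C1; have C0 : 0 < C by rewrite mulr_gt0.
(* Chosen so that the bound of [mxtrace_exp_diff] equals eps / 2 when the square root of tr Y^4 is
   [sq]. *)
pose sq := (eps / (2 * k%:R)) ^+ 2 / C ^+ k.-1.
have sq0 : 0 < sq by rewrite divr_gt0 // ?exprn_gt0 // divr_gt0 // mulr_gt0.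
pose tau := sq ^+ 2; have tau0 : 0 < tau by rewrite exprn_gt0.
have kp0 : 0 <= (kurt : R) := kurt_ge0.
pose t := tau * (eps / 4); have t0 : 0 < t by rewrite mulr_gt0 // divr_gt0.
pose dl := t / (64 * ((kurt : R) + 1) * (m + 1)).
have dl0 : 0 < dl by rewrite divr_gt0 // !mulr_gt0 //; lra.
exists dl; split=> // F gF hl.
have mn0 : 0 < Num.min 1 dl by rewrite lt_min ltr01.
have /cvgr0Pnorm_lt/(_ _ mn0) [M0 _ hM] := eta_cvg nu gF.
exists M0.+1 => M MM; have Mp : (0 < M)%N by exact: leq_ltn_trans MM.
have := hM M (ltnW MM); rewrite /= ger0_norm ?eta_ge0 // lt_min => /andP[eta1 etad].
have [N1 hN1] := beta_small (measurable_rest F) (ltW dl0) dl0 (hl true).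
have [N2 hN2] := beta_small (measurable_rest F) (ltW dl0) dl0 (hl false).
have e4 : 0 < eps / 4 by rewrite divr_gt0.
have mWZ N : measurable_fun setT (fun w => \tr ((N%:R^-1 *: WZ F (U M w) N) ^+ k)).
  apply: measurable_sum => i; apply: (measurable_expmx (A := fun w => N%:R^-1 *: WZ F (U M w) N)) => r r'.
  under eq_fun do rewrite !mxE; apply: measurable_funM => //; apply: measurable_sum => n.
  by apply: measurable_funD; apply: measurable_funM => //; exact: measurable_U.
have [N3 hN3] := @cvg_whp _ _ _ P (fun N w => \tr ((N%:R^-1 *: WZ F (U M w) N) ^+ k))
   (fun w => Tk F (U M w) k) (eps / 4) e4 mWZ (measurable_Tk F M k) (fun w => @WZ_trace_cvg _ F (U M w) k (ltnW (ltnW k2))).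
exists (maxn 1 (maxn N1 (maxn N2 N3))) => N; rewrite !geq_max => /andP[N0 /andP[n1 /andP[n2 n3]]].
have [iX EX] := fro_WX gX hcov N0.
have [iY EY] := fro_WY gX hcov nuBox gF Mp N0.
have wX : whp P (eps / 4) (fun w => fro (N%:R^-1 *: WN X N w) <= C1).
  apply: whp_markov => //; first by move=> w; exact: fro_ge0.
  apply: le_trans EX _; rewrite -/m /C1; have -> : 16 * (m + 1) / eps * (eps / 4) = 4 * (m + 1) by field; rewrite gt_eqF.
  lra.
have wY : whp P (eps / 4) (fun w => fro (N%:R^-1 *: WY X F M N w) <= C1).
  apply: whp_markov => //; first by move=> w; exact: fro_ge0.
  apply: le_trans EY _; rewrite -/m /C1; have -> : 16 * (m + 1) / eps * (eps / 4) = 4 * (m + 1) by field; rewrite gt_eqF.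
  lra.
have w4 : whp P (eps / 4) (fun w => \tr ((N%:R^-1 *: WY X F M N w) ^+ 4) <= tau).
  apply: whp_markov => //.
  - exact: (WY_trace4_itg gX).
  - move=> w; set A := _ *: _; have sA : A^T = A by rewrite /A linearZ /= WY_sym.
    have -> : A ^+ 4 = (A ^+ 2) ^+ 2 by rewrite -exprM.
    by rewrite -fro_sym ?fro_ge0 // tr_expmx sA.
  - apply: le_trans (WY_trace4 gX vX hcov nuBox gF Mp N0) _.
    rewrite /KN; apply: (@KN_small dl _ _ _ _ m) => //; rewrite ?eta_ge0 ?(ltW eta1) ?(ltW etad) //.
    + exact: hN1.
    + exact: hN2.
have wZ := hN3 N n3.
have := whp_and (whp_and wX wY) (whp_and w4 wZ).
have -> : eps / 4 + eps / 4 + (eps / 4 + eps / 4) = eps by field.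
apply: whp_imp => w [[hX hY] [h4 hZ]].
set A := N%:R^-1 *: WN X N w; set B := N%:R^-1 *: WZ F (U M w) N.
have AB : A - B = N%:R^-1 *: WY X F M N w by rewrite /A /B -scalerBr (WN_decomp F M) addrC addKr.
have sA : A^T = A by rewrite /A linearZ /= WN_sym.
have sB : B^T = B by rewrite /B linearZ /= WZ_sym.
have fA : fro A <= C by apply: le_trans hX _; rewrite /C; lra.
have fB : fro B <= C.
  have -> : B = A - (A - B) by rewrite opprB addrC subrK.
  by apply: le_trans (fro_diff_le _ _) _; rewrite AB /C; move: hX; rewrite -/A; lra.
have := mxtrace_exp_diff k2 sA sB fA fB; rewrite AB.
have st : Num.sqrt (\tr ((N%:R^-1 *: WY X F M N w) ^+ 4)) <= sq.
  by rewrite -[leRHS]ger0_norm ?(ltW sq0) // -sqrtr_sqr ler_wsqrtr.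
have -> : `|\tr (A ^+ k) - Tk F (U M w) k| = `|(\tr (A ^+ k) - \tr (B ^+ k)) + (\tr (B ^+ k) - Tk F (U M w) k)|.
  by congr (`|_|); ring.
move=> hk; apply: le_trans (ler_normD _ _) _.
have : k%:R * Num.sqrt (C ^+ k.-1 * Num.sqrt (\tr ((N%:R^-1 *: WY X F M N w) ^+ 4))) <= eps / 2.
  apply: (@le_trans _ _ (k%:R * (eps / (2 * k%:R)))); last by rewrite le_eqVlt; apply/orP; left; apply/eqP; field; rewrite gt_eqF.
  rewrite ler_pM2l // -[leRHS]ger0_norm ?divr_ge0 ?(ltW e0) ?mulr_ge0 //.
  rewrite -sqrtr_sqr ler_wsqrtr //.
  have -> : (eps / (2 * k%:R)) ^+ 2 = C ^+ k.-1 * sq by rewrite /sq mulrCA mulfV ?mulr1 // gt_eqF // exprn_gt0.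
  by rewrite ler_pM2l // exprn_gt0.
move: hZ; rewrite -/B; lra.
Qed.

End TraceApproximation.

(** * Consequences of the hypotheses on the spectral measure *)

Section SpectralHypotheses.
Context {R : realType}.

Lemma finite_version (nu : {measure set (R * R)%type -> \bar R}) : (nu setT < +oo)%E ->
  exists nf : {finite_measure set (R * R)%type -> \bar R}, forall A, nf A = nu A.
Proof.
move=> h; exists (mfrestr measurableT h : {finite_measure set (R * R)%type -> \bar R}) => A.
by rewrite /mfrestr /mrestr; congr (nu _); exact: setIT.
Qed.

Context d (T : measurableType d) (P : probability T R).
Variable X : int -> int -> T -> R.
Variables nu nac nd : {measure set (R * R)%type -> \bar R}.
Hypothesis H : thm_hyps P X nu nac nd.

Let gX : centered_gaussian P X := H.1.
Let vX : positive_variance P X := H.2.2.1.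

(** Stationarity reduces the covariance of two sites to their lag; the spectral measure is
    repackaged as a finite measure. *)
Lemma spectral_version : exists nf : {finite_measure set (R * R)%type -> \bar R},
  [/\ forall A, nf A = nu A, nf (~` Box) = 0%E &
   forall p q : int * int, cov P X [:: (p, 1)] [:: (q, 1)] = \int[nf]_z cos (dot q z - dot p z)].
Proof.
case: H => _ [st [_ [[nuT [nB sp]] _]]]; have [nf E] := finite_version nuT.
exists nf; split=> //; first by rewrite E.
move=> [j k] [j' k']; have [h _] := sp (j' - j) (k' - k).
have := st j k (j' - j) (k' - k); rewrite h unlock !(addrC _ (_ - _)) !subrK => hE.
rewrite /cov; transitivity (\int[P]_w (X j k w * X j' k' w)).
  by apply: eq_Rintegral => w _; rewrite !lincomb1.
rewrite /Rintegral hE; congr fine.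
rewrite (@eq_measure_integral _ _ _ _ nu nf); last by move=> A _ _; exact: E.
by apply: eq_integral => z _; congr EFin; congr cos; rewrite /dot /= !intrB; ring.
Qed.

Lemma nd_setT_fin : (nd setT < +oo)%E.
Proof.
case: H => _ [_ [_ [[nuT _] [_ [_ nuE]]]]]; apply: le_lt_trans nuT.
by rewrite nuE // leeDr.
Qed.

Lemma measurable_memseq (F : seq (R * R)) : measurable [set z | z \in F].
Proof. by apply: countable_measurable => [z|]; [exact: measurable_pt|exact/finite_set_countable/finite_seq]. Qed.

Lemma measurable_coset s (a : R) : measurable [set z | co s z = a].
Proof.
have := @measurable_co R s measurableT [set a] (measurable_set1 a).
by rewrite setTI.
Qed.

Lemma nac_null A : measurable A -> (@lebesgue_measure R \x @lebesgue_measure R)%E A = 0%E -> nac A = 0%E.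
Proof.
case: H => _ [_ [_ [_ [dom _]]]] mA A0; exact: (null_content_dominatesP _ _).1 dom _ mA A0.
Qed.

Lemma nac_coset s (a : R) : nac [set z | co s z = a] = 0%E.
Proof.
apply: nac_null; first exact: measurable_coset.
have ms : measurable ([set a] : set R) by exact: measurable_set1.
have leb0 : @lebesgue_measure R [set a] = 0%E by exact: lebesgue_measure_set1.
case: s => /=.
- have -> : [set z : R * R | co true z = a] = [set a] `*` setT.
    by apply/seteqP; split=> [[x y] /=|[x y] [/= ->]].
  have E := @product_measure1E _ _ _ _ R (@lebesgue_measure R) (@lebesgue_measure R) _ _ ms measurableT.
  apply: etrans E _.
  by apply: etrans (congr1 (fun x => x * _)%E leb0) _; exact: mul0e.
- have -> : [set z : R * R | co false z = a] = setT `*` [set a].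
    by apply/seteqP; split=> [[x y] /=|[x y] [/= _ ->]].
  have E := @product_measure1E _ _ _ _ R (@lebesgue_measure R) (@lebesgue_measure R) _ _ measurableT ms.
  apply: etrans E _.
  by apply: etrans (congr1 (fun x => _ * x)%E leb0) _; exact: mule0.
Qed.

Lemma nac_pt n : nac [set n] = 0%E.
Proof.
apply/eqP; rewrite -measure_le0 -(nac_coset true n.1) le_measure ?inE //.
- exact: measurable_pt.
- exact: measurable_coset.
- by move=> z ->.
Qed.

(** Outside [F], a line parallel to an axis carries no absolutely continuous mass, so only the atoms
    left out of [F] can charge it. *)
Lemma lines_of_discrete (nf : {finite_measure set (R * R)%type -> \bar R}) F (dl : R) :
  (forall A, nf A = nu A) -> (nd (~` [set z | z \in F]) <= dl%:E)%E -> lines nf F dl.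
Proof.
move=> E hF s z [bz zF].
(* The part of [rest F] on the two lines; its indicator dominates the integrand. *)
pose A := rest F `&` ([set z' | co s z' = co s z] `|` [set z' | co s z' = ng (co s z)]).
have mL : measurable ([set z' | co s z' = co s z] `|` [set z' | co s z' = ng (co s z)]).
  by apply: measurableU; exact: measurable_coset.
have mA : measurable A by apply: measurableI => //; exact: measurable_rest.
have cobox (z' : R * R) : Box z' -> co s z' \in `]- pi, pi] by move=> /BoxP/andP[h1 h2]; case: (s).
have mB0 : measurable_fun setT (Bk0 : R -> R).
  apply: (measurable_fun_cvg (fun N => measurable_Bk N)) => x _; exact: Bk_cvg0.
have Bk01 (x : R) : 0 <= Bk0 x <= 1 by rewrite /Bk0; case: eqP; rewrite ?lexx ?ler01.
have mf : measurable_fun setT (fun z' => \1_(rest F) z' * (2^-1 * (Bk0 (co s z - co s z') + Bk0 (co s z + co s z')))).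
  apply: measurable_funM; first by apply: measurable_indic; exact: measurable_rest.
  apply: measurable_funM => //; apply: measurable_funD; apply: measurableT_comp mB0 _.
    by apply: measurable_funB => //; exact: measurable_co.
  by apply: measurable_funD => //; exact: measurable_co.
have fb z' : 0 <= \1_(rest F) z' * (2^-1 * (Bk0 (co s z - co s z') + Bk0 (co s z + co s z'))) <= \1_A z'.
  have /andP[a0 a1] := Bk01 (co s z - co s z'); have /andP[c0 c1] := Bk01 (co s z + co s z').
  have /andP[i0 i1] := indic_bnd (rest F) z'.
  rewrite mulr_ge0 //=; last by lra.
  case: (pselect (rest F z')) => [rz|nrz]; last first.
    by rewrite [X in X * _]indicE memNset // mul0r; case/andP: (indic_bnd A z').
  rewrite [X in X * _]indicE mem_set // mul1r.
  case: (pselect (A z')) => [Az|nA]; first by rewrite indicE mem_set //=; lra.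
  rewrite indicE memNset //= /Bk0.
  case: eqP => [s0|_] /=.
    by case: nA; split=> //; left; rewrite /= (sin_diff_box (cobox _ bz) (cobox _ rz.1) s0).
  case: eqP => [s0|_] /=; last by rewrite addr0 mulr0.
  case: nA; split=> //; right => /=; rewrite addrC in s0.
  exact: (sin_sum_box (cobox _ rz.1) (cobox _ bz) s0).
apply: (@le_trans _ _ (\int[nf]_z' \1_A z')).
  apply: Int_le.
  - apply: (@itg_bounded _ _ _ nf _ 1) => // z'; case/andP: (fb z') => f0 f1.
    by rewrite ger0_norm // (le_trans f1) //; case/andP: (indic_bnd A z').
  - exact: itg_indic.
  - by move=> z'; case/andP: (fb z').
rewrite Int_indic // -lee_fin fineK ?fin_num_measure //.
rewrite E; case: H => _ [_ [_ [_ [_ [_ ->]]]]] //.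
have -> : nac A = 0%E.
  apply/eqP; rewrite -measure_le0 (@le_trans _ _ (nac ([set z' | co s z' = co s z] `|` [set z' | co s z' = ng (co s z)]))) //.
    by rewrite le_measure ?inE //; apply: subIsetr.
  apply: le_trans (measureU2 nac (measurable_coset s (co s z)) (measurable_coset s (ng (co s z)))) _.
  by rewrite [X in (X + _)%E]nac_coset [X in (_ + X)%E]nac_coset adde0.
rewrite add0e; apply: le_trans hF; rewrite le_measure ?inE //.
  by apply: measurableC; exact: measurable_memseq.
by move=> z' [[_ /negP]].
Qed.

(** The countable support is enumerated and closed under negation at each finite stage; continuity
    from above of the finite measure [nd] does the rest. *)
Lemma goodF_exists (dl : R) : 0 < dl ->
  exists F, goodF F /\ (nd (~` [set z | z \in F]) <= dl%:E)%E.
Proof.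
move=> dl0; case: H => _ [_ [_ [[nuT [nB _]] [_ [[S [cS nS]] nuE]]]]].
have [f fi] := countable_injP S cS.
(* Inverse of the injection [f]. The default (0, 0) lies in the box, so including it is harmless. *)
pose e n : R * R := match pselect (exists z, (S `&` Box) z /\ f z = n) with
  | left h => proj1_sig (cid h) | right _ => (0, 0) end.
have bx0 : Box ((0, 0) : R * R).
  by apply/BoxP; rewrite !in_itv /= oppr_lt0 pi_gt0 pi_ge0.
have be n : Box (e n) by rewrite /e; case: pselect => // h; have [[]] := svalP (cid h).
have ef z : (S `&` Box) z -> e (f z) = z.
  move=> sz; rewrite /e; case: pselect => [h|[]]; last by exists z.
  have [[s1 b1] fz] := svalP (cid h); apply: fi => //; rewrite inE //; by case: sz.
pose L n := [seq e i | i <- iota 0 n]; pose F n := undup (L n ++ map (@negm R) (L n)).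
have bL n z : z \in L n -> Box z by case/mapP => i _ ->.
have bF n z : z \in F n -> Box z.
  by rewrite mem_undup mem_cat => /orP[/bL //|/mapP[y /bL yb ->]]; exact: negm_Box.
have gF n : goodF (F n).
  split; [exact: undup_uniq|exact: bF|move=> z].
  rewrite !mem_undup !mem_cat => /orP[zL|/mapP[y yL ->]]; first by rewrite map_f ?orbT.
  by rewrite negmK ?yL //; exact: bL yL.
pose B n := ~` [set z | z \in F n].
have mB n : measurable (B n) by apply: measurableC; exact: measurable_memseq.
have mS : measurable S by apply: countable_measurable => // z; exact: measurable_pt.
have ndBox : nd (~` Box) = 0%E.
  apply/eqP; rewrite -measure_le0 -nB nuE ?leeDr //.
  by apply: measurableC; exact: measurable_Box.
have sub : \bigcap_n B n `<=` ~` S `|` ~` Box.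
  move=> z h; rewrite -setCI => sz; have := h (f z).+1 I; apply => /=.
  rewrite mem_undup mem_cat -{1}(ef z sz) map_f //.
  by rewrite mem_iota add0n leqnn.
have mI : measurable (\bigcap_n B n) by exact: bigcapT_measurable.
have lim0 : nd (\bigcap_n B n) = 0%E.
  apply/eqP; rewrite -measure_le0 (@le_trans _ _ (nd (~` S `|` ~` Box))) //.
    rewrite le_measure ?inE //; apply: measurableU; apply: measurableC => //; exact: measurable_Box.
  apply: le_trans (measureU2 nd (measurableC mS) (measurableC (@measurable_Box R))) _.
  by rewrite [X in (X + _)%E]nS [X in (_ + X)%E]ndBox adde0.
have hc : (nd \o B) n @[n --> \oo] --> nd (\bigcap_n B n).
  apply: nonincreasing_cvg_mu => //.
    by apply: le_lt_trans nd_setT_fin; rewrite le_measure ?inE.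
  move=> n m nm; apply/subsetPset => z /=; apply: contra_not => /=.
  rewrite !mem_undup !mem_cat => /orP[/mapP[i]|/mapP[y /mapP[i]]].
    by rewrite mem_iota => /andP[_ i1] ->; rewrite map_f // mem_iota /=; exact: leq_trans i1 _.
  rewrite mem_iota => /andP[_ i1] -> ->; apply/orP; right; rewrite map_f // map_f // mem_iota /=.
  exact: leq_trans i1 _.
have [N _ hN] : \forall n \near \oo, ((nd \o B) n < dl%:E)%E.
  have := hc [set x | (x < dl%:E)%E]; rewrite lim0; apply; apply: open_nbhs_nbhs; split; first exact: open_ereal_lt_ereal.
  by rewrite /= lte_fin.
exists (F N); split=> //; exact/ltW/(hN N (leqnn N)).
Qed.

Lemma trace_approx k (eps : R) : (2 < k)%N -> 0 < eps -> exists dl, 0 < dl /\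
  forall F, goodF F -> (nd (~` [set z | z \in F]) <= dl%:E)%E ->
  exists M0, forall M, (M0 <= M)%N -> exists N0, forall N, (N0 <= N)%N ->
    whp P eps (fun w => `|\tr ((N%:R^-1 *: WN X N w) ^+ k) - Tk F (U X M w) k| <= eps).
Proof.
move=> k2 e0; have [nf [E nB hc]] := spectral_version.
have [dl [dl0 h]] := trace_approx_atoms gX vX hc nB k2 e0; exists dl; split=> // F gF hF.
by apply: h => //; exact: lines_of_discrete.
Qed.

Lemma fro_tight (e : R) : 0 < e -> exists C, 0 < C /\ forall N, (0 < N)%N ->
  whp P e (fun w => fro (N%:R^-1 *: WN X N w) <= C).
Proof.
move=> e0; have [nf [E nB hc]] := spectral_version.
pose C := 4 * (tmass nf + 1) / e; have m0 := tmass_ge0 nf.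
have C0 : 0 < C by rewrite divr_gt0 // mulr_gt0 //; lra.
exists C; split=> // N N0; have [iX EX] := fro_WX gX hc N0.
apply: whp_markov => //; first by move=> w; exact: fro_ge0.
by apply: le_trans EX _; rewrite /C -mulrA mulVf ?gt_eqF // mulr1; lra.
Qed.

(** A linear combination of Fourier coefficients as one linear combination of the field, hence
    Gaussian. *)
Definition Ucomb (M : nat) (t : seq (R * ((R * R) * bool))) : seq ((int * int) * R) :=
  flatten [seq scl p.1 (Ul M p.2.1 p.2.2) | p <- t].

Lemma lincomb_Ucomb M t w : lincomb X (Ucomb M t) w = \sum_(p <- t) p.1 * U X M w p.2.1 p.2.2.
Proof.
rewrite /Ucomb; elim: t => [|p t IH]; first by rewrite /lincomb !big_nil.
by rewrite /= lincomb_lin IH big_cons.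
Qed.

Lemma tf_Ucomb M t c z : tf (Ucomb M t) c z = \sum_(p <- t) p.1 * tf (Ul M p.2.1 p.2.2) c z.
Proof.
rewrite /Ucomb; elim: t => [|p t IH]; first by rewrite /tf !big_nil.
by rewrite /= tf_lin IH big_cons.
Qed.

(** Limit of the transfer function of [Ul]: half the weight sits at [n], half at its negative. *)
Definition ut (n : R * R) (b c : bool) (z : R * R) : R :=
  2^-1 * ((z == n)%:R * cos (ph c - ph b) + (z == negm n)%:R * cos (ph c + ph b)).

Lemma tf_Ul_bnd M (n : R * R) b c z : (0 < M)%N -> `|tf (Ul M n b) c z| <= 1.
Proof.
move=> M0; rewrite /tf /Ul big_map /=; apply: le_trans (ler_norm_sum _ _ _) _.
rewrite -[leRHS](avg2_cst 1 M0) mulr_sumr; apply: ler_sum => f _.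
rewrite !normrM mulr1 ger0_norm ?exprn_ge0 ?invr_ge0 // -mulrA ler_piMr ?exprn_ge0 ?invr_ge0 //.
by rewrite mulr_ile1 // cos_abs_le1.
Qed.

Lemma tf_Ul_cvg n b c z : Box n -> Box z -> tf (Ul M n b) c z @[M --> \oo] --> ut n b c z.
Proof.
move=> bn bz; have /BoxP/andP[n1 n2] := bn; have /BoxP/andP[z1 z2] := bz.
have E M : tf (Ul M n b) c z = 2^-1 * (M%:R^-1 ^+ 2 * \sum_(f <- idx M) cos (dot f (z - n) + (ph c - ph b)) +
    M%:R^-1 ^+ 2 * \sum_(f <- idx M) cos (dot f (z + n) + (ph c + ph b))).
  rewrite /tf /Ul big_map /= -mulrDr -big_split mulrCA !mulr_sumr; apply: eq_bigr => f _.
  rewrite /= -mulrA; congr (_ * _); rewrite dotBr dotDr.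
  have -> : dot f z - dot f n + (ph c - ph b) = (dot f z + ph c) - (dot f n + ph b) by ring.
  have -> : dot f z + dot f n + (ph c + ph b) = (dot f z + ph c) + (dot f n + ph b) by ring.
  by rewrite (cosB (dot f z + ph c)) (cosD (dot f z + ph c)); field.
have B2c (w : R * R) (a : R) : (sin (w.1 / 2) != 0) || (sin (w.2 / 2) != 0) ->
    M%:R^-1 ^+ 2 * \sum_(f <- idx M) cos (dot f w + a) @[M --> \oo] --> (0 : R).
  move=> hw; apply/cvgr0Pnorm_lt => e e0; have /cvgr0Pnorm_lt/(_ _ e0) [N _ h] := B2_cvg hw.
  exists N.+1 => // M MM; apply: le_lt_trans (avg2_cos_bound _ _ _) _; first exact: leq_trans MM.
  by have := h M (ltnW MM); rewrite /= ger0_norm // B2_ge0.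
under eq_fun do rewrite E.
apply: cvgM; first exact: cvg_cst.
apply: cvgD.
- case: (eqVneq z n) => [->|zn].
    rewrite mul1r; apply: cvg_near_cst; exists 1%N => // M /= M0.
    under eq_bigr do rewrite subrr /dot !mulr0 addr0 add0r.
    by rewrite avg2_cst.
  rewrite mul0r; apply: B2c; apply: contraNT zn; rewrite negb_or !negbK => /andP[/eqP s1 /eqP s2].
  rewrite [z]surjective_pairing [n]surjective_pairing.
  by rewrite (sin_diff_box z1 n1 s1) (sin_diff_box z2 n2 s2).
- case: (eqVneq z (negm n)) => [->|zn].
    rewrite mul1r; apply: cvg_near_cst; exists 1%N => // M /= M0.
    under eq_bigr do rewrite addrC cos_negm.
    by rewrite avg2_cst.
  rewrite mul0r; apply: B2c; apply: contraNT zn; rewrite negb_or !negbK => /andP[/eqP s1 /eqP s2].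
  by rewrite [z]surjective_pairing (sin_sum_box z1 n1 s1) (sin_sum_box z2 n2 s2).
Qed.

Definition utc t c z : R := \sum_(p <- t) p.1 * ut p.2.1 p.2.2 c z.
Definition ug t z : R := utc t false z * utc t false z + utc t true z * utc t true z.

(* the limiting variance of a linear combination of the U's sees only the atoms in F *)
Definition vlim (mu : set (R * R) -> \bar R) (F : seq (R * R)) t : R := \sum_(n <- F) ug t n * fine (mu [set n]).

Lemma ut_support F n b c z : goodF F -> n \in F -> z \notin F -> ut n b c z = 0.
Proof.
case=> _ _ nF nF' zF; rewrite /ut.
have -> : (z == n) = false by apply/negP => /eqP zn; rewrite zn nF' in zF.
have -> : (z == negm n) = false by apply/negP => /eqP zn; rewrite zn nF in zF.
by rewrite !mul0r addr0 mulr0.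
Qed.

Lemma cov_Ucomb_cvg F t : goodF F -> (forall p, p \in t -> p.2.1 \in F) ->
  cov P X (Ucomb M t) (Ucomb M t) @[M --> \oo] --> vlim nd F t.
Proof.
move=> gF tF; have [nf [E nB hc]] := spectral_version.
have [uF bF nF] := gF.
have ug0 z : z \notin F -> ug t z = 0.
  move=> zF; have h c : utc t c z = 0.
    by rewrite /utc big1_seq // => p /andP[_ /tF pF]; rewrite (ut_support _ _ gF pF zF) mulr0.
  by rewrite /ug !h mulr0 addr0.
have ugE z : ug t z = \sum_(n <- F) ug t n * \1_[set n] z.
  case: (boolP (z \in F)) => zF.
    rewrite (bigD1_seq z) //= big1 ?addr0.
      by rewrite indicE mem_set // mulr1.
    by move=> n nz; rewrite indicE memNset ?mulr0 // => zn; rewrite zn eqxx in nz.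
  rewrite ug0 // big1_seq // => n /andP[_ nF']; rewrite indicE memNset ?mulr0 // => zn.
  by rewrite zn nF' in zF.
have -> : vlim nd F t = \int[nf]_z (\1_Box z * ug t z).
  transitivity (\int[nf]_z (\sum_(n <- F) ug t n * \1_[set n] z)).
    rewrite Int_sum; last by move=> n; apply: itgZ; apply: itg_indic; exact: measurable_pt.
    apply: eq_bigr => n _; rewrite IntZ; last by apply: itg_indic; exact: measurable_pt.
    rewrite Int_indic; last exact: measurable_pt.
    (* Single points have no absolutely continuous mass, so [nu] may be replaced by [nd]. *)
    rewrite E; case: H => _ [_ [_ [_ [_ [_ ->]]]]]; last exact: measurable_pt.
    by rewrite nac_pt add0e.
  apply: eq_Rintegral => z _; rewrite -ugE indicE; case: (boolP (z \in Box)); rewrite ?mul1r // => zB.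
  rewrite ug0 ?mul0r //; apply: contraNN zB => /bF; exact: mem_set.
have covE M : cov P X (Ucomb M t) (Ucomb M t) =
   \int[nf]_z (\1_Box z * spec (Ucomb M t) (Ucomb M t) z) by exact: cov_box.
pose K := \sum_(p <- t) `|p.1|; have K0 : 0 <= K by exact: sumr_ge0.
have bt M c z : `|tf (Ucomb M.+1 t) c z| <= K.
  rewrite tf_Ucomb; apply: le_trans (ler_norm_sum _ _ _) _; apply: ler_sum => p _.
  by rewrite normrM ler_piMr // tf_Ul_bnd.
(* The bounds on window averages require a nonempty window. *)
rewrite -(cvg_shiftS (fun M => cov P X (Ucomb M t) (Ucomb M t))).
under eq_fun do rewrite covE.
apply: (@Int_dct _ _ _ nf _ _ (2 * K ^+ 2)).
- move=> M; apply: measurable_funM; first exact: measurable_indicBox.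
  exact: (itg_meas (itg_spec nf _ _)).
- move=> M z; rewrite normrM -[leRHS]mul1r ler_pM //.
    by case/andP: (indic_bnd Box z) => h0 h1; rewrite ger0_norm.
  rewrite /spec; apply: le_trans (ler_normD _ _) _; rewrite !normrM -!expr2.
  have q c : `|tf (Ucomb M.+1 t) c z| ^+ 2 <= K ^+ 2 by rewrite ler_pXn2r ?nnegrE.
  by have := q true; have := q false; lra.
- move=> z; rewrite indicE; case: (boolP (z \in Box)) => [|_]; last first.
    by under eq_fun do rewrite mul0r; rewrite mul0r; exact: cvg_cst.
  rewrite inE => bz; apply: cvgM; first exact: cvg_cst.
  have cc c : tf (Ucomb M.+1 t) c z @[M --> \oo] --> utc t c z.
    rewrite (cvg_shiftS (fun M => tf (Ucomb M t) c z)); under eq_fun do rewrite tf_Ucomb big_seq.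
    rewrite /utc big_seq; apply: (cvg_big add_continuous) => p pt'.
    by apply: cvgM; [exact: cvg_cst|apply: tf_Ul_cvg => //; exact/bF/tF].
  by apply: cvgD; apply: cvgM.
Qed.

(** The law of a centred Gaussian depends only on its variance, and the limiting variance sees only
    the atoms. *)
Lemma cos_Ucomb_cvg F t b : goodF F -> (forall p, p \in t -> p.2.1 \in F) ->
  \int[P]_w cos (\sum_(p <- t) p.1 * U X M w p.2.1 p.2.2 + b) @[M --> \oo] --> gcos b (vlim nd F t).
Proof.
move=> gF tF; have := gcos_cvg (b := b) (cov_Ucomb_cvg gF tF); apply: cvg_trans; apply: near_eq_cvg.
apply: nearW => M; rewrite -cov_sqr -(lincomb_cos gX vX).
by apply: eq_Rintegral => w _; rewrite lincomb_Ucomb.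
Qed.

End SpectralHypotheses.

(** * Existence of the limit *)

Section DistanceMeasurability.
Context {R : realType} d (T : measurableType d).

Lemma measurable_dist_gt (a b : T -> @pmseq R) (eps : R) :
  (forall s j, measurable_fun setT (fun w => side s (a w) j)) ->
  (forall s j, measurable_fun setT (fun w => side s (b w) j)) ->
  measurable [set w | (eps%:E < dist_p 4 (a w) (b w))%E].
Proof.
move=> ma mb.
have m2 (c : T -> @pmseq R) : (forall s j, measurable_fun setT (fun w => side s (c w) j)) ->
    forall j, measurable_fun setT (fun w => (c w).2 j).
  move=> mc j; have := measurable_funN (mc false j).
  by congr measurable_fun; apply/funext => w /=; rewrite opprK.
have ms (u v : T -> nat -> R) : (forall j, measurable_fun setT (fun w => u w j)) ->
    (forall j, measurable_fun setT (fun w => v w j)) ->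
    measurable_fun setT (fun w => (\sum_(0 <= j <oo) (`|u w j - v w j| `^ 4)%:E)%E).
  move=> mu mv; apply: ge0_emeasurable_sum => [k w _ _|k _]; first by rewrite lee_fin powR_ge0.
  apply/measurable_EFinP.
  have -> : (fun w => `|u w k - v w k| `^ 4) = (fun y => y `^ 4) \o (fun w => `|u w k - v w k|) by [].
  apply: measurableT_comp; first exact: measurable_powR.
  by apply: measurableT_comp => //; exact: measurable_funB.
have mf : measurable_fun setT (fun w => dist_p 4 (a w) (b w)).
  pose S w := (\sum_(0 <= j <oo) (`|(a w).1 j - (b w).1 j| `^ 4)%:E +
         \sum_(0 <= j <oo) (`|(a w).2 j - (b w).2 j| `^ 4)%:E)%E.
  have -> : (fun w => dist_p 4 (a w) (b w)) = (fun x => poweR x 4^-1) \o S by [].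
  apply: measurableT_comp; first exact: measurable_poweR.
  apply: emeasurable_funD.
  - by apply: (ms (fun w => (a w).1) (fun w => (b w).1)) => j; [exact: (ma true)|exact: (mb true)].
  - by apply: (ms (fun w => (a w).2) (fun w => (b w).2)) => j; exact: m2.
rewrite -[X in measurable X]setTI; exact: (emeasurable_fun_o_infty measurableT mf).
Qed.

End DistanceMeasurability.

(** * Limits of random spectra with Cauchy traces *)

Section RandomSpectra.
Context {R : realType} d (T : measurableType d) (P : probability T R).
Variable A : forall N : nat, T -> 'M[R]_N.
Hypothesis mA : forall N i j, measurable_fun setT (fun w => A N w i j).
Hypothesis sA : forall N w, (A N w)^T = A N w.
Hypothesis tA : forall e : R, 0 < e -> exists C, 0 < C /\ forall N, (0 < N)%N -> whp P e (fun w => fro (A N w) <= C).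

Lemma ex_uniform (Q : nat -> nat -> Prop) : (forall k, exists N0, forall N, (N0 <= N)%N -> Q k N) ->
  forall K, exists N0, forall k N, (k < K)%N -> (N0 <= N)%N -> Q k N.
Proof.
move=> h; elim=> [|K [N1 IH]]; first by exists 0%N.
have [N2 h2] := h K; exists (maxn N1 N2) => k N; rewrite ltnS geq_max leq_eqVlt.
by move=> /predU1P[->|kK] /andP[n1 n2]; [exact: h2|exact: IH].
Qed.

Lemma EM_dist_whp (xi : T -> @pmseq R) (eps e : R) : 0 < eps -> 0 < e ->
  (forall s j, measurable_fun setT (fun w => side s (xi w) j)) ->
  (forall N : nat, (0 < N)%N -> whp P e (fun w => ~ (eps%:E < dist_p 4 (EM (A N w)) (xi w))%E) ->
    (P [set w | (eps%:E < dist_p 4 (EM (A N w)) (xi w))%E] <= e%:E)%E).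
Proof.
move=> eps0 e0 mxi N N0 h; apply: whp_P h; apply: measurable_dist_gt => //.
by move=> s j; exact: measurable_side_EM.
Qed.

Hypothesis cA : forall k (e : R), (2 < k)%N -> 0 < e -> exists N0, forall N N', (N0 <= N)%N -> (N0 <= N')%N ->
  whp P e (fun w => `|\tr (A N w ^+ k) - \tr (A N' w ^+ k)| <= e).

Lemma sides_cauchy (eta e : R) : 0 < eta -> 0 < e -> exists N0, forall N N', (N0 <= N)%N -> (N0 <= N')%N ->
  whp P e (fun w => forall s j, `|side s (EM (A N w)) j - side s (EM (A N' w)) j| <= eta).
Proof.
move=> eta0 e0; have e4 : 0 < e / 4 by rewrite divr_gt0.
have [C [C0 hC]] := tA e4.
have [K [delta [d0 hK]]] := EM_powersum_close C0 eta0.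
(* The K events on traces share probability e / 2, the two tightness events the other half. *)
pose e' := Num.min delta (e / 2 / K.+1%:R).
have e'0 : 0 < e' by rewrite lt_min d0 !divr_gt0.
have [N0 hN0] : exists N0, forall k N, (k < K)%N -> (N0 <= N)%N -> forall N', (N <= N')%N -> (2 < k)%N ->
    whp P e' (fun w => `|\tr (A N w ^+ k) - \tr (A N' w ^+ k)| <= e').
  apply: (@ex_uniform (fun k N => forall N', (N <= N')%N -> (2 < k)%N ->
    whp P e' (fun w => `|\tr (A N w ^+ k) - \tr (A N' w ^+ k)| <= e'))) => k.
  case: (ltnP 2 k) => k2; last by exists 0%N.
  have [N0 h] := cA k2 e'0; exists N0 => N NN N' NN' _; apply: h => //; exact: leq_trans NN'.
have main N N' : (maxn 1 N0 <= N)%N -> (N <= N')%N ->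
  whp P e (fun w => forall s j, `|side s (EM (A N w)) j - side s (EM (A N' w)) j| <= eta).
  rewrite geq_max => /andP[N1 NN] NN'.
  have N1' : (0 < N')%N by exact: leq_trans N1 NN'.
  have w1 : whp P ((size (iota 0 K))%:R * e') (fun w => forall k, k \in iota 0 K -> (2 < k)%N ->
      `|\tr (A N w ^+ k) - \tr (A N' w ^+ k)| <= e').
    apply: whp_all; first exact: ltW.
    move=> k; rewrite mem_iota add0n /= => kK; case: (ltnP 2 k) => k2; last exact: whp_true (ltW e'0) _.
    have := hN0 k N kK NN N' NN' k2; exact: whp_imp.
  have := whp_and (whp_and (hC N N1) (hC N' N1')) w1.
  move=> /whp_le h; have := h e _; rewrite size_iota.
  have le1 : e / 4 + e / 4 + K%:R * e' <= e.
    have : K%:R * e' <= e / 2.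
      apply: (@le_trans _ _ (K.+1%:R * (e / 2 / K.+1%:R))).
        apply: ler_pM => //; [exact: ltW|by rewrite ler_nat|by rewrite ge_min lexx orbT].
      by rewrite mulrCA mulfV ?mulr1 ?pnatr_eq0.
    lra.
  move=> /(_ le1); apply: whp_imp => w [[f1 f2] hk].
  apply: hK => // k /andP[k2 kK].
  by apply: le_trans (hk k _ k2) _; [rewrite mem_iota|rewrite ge_min lexx].
exists (maxn 1 N0) => N N' hN hN'; case: (leqP N N') => NN; first exact: main.
by have := main _ _ hN' (ltnW NN); apply: whp_imp => w h s j; rewrite distrC.
Qed.

Let hf (m : nat) : R := 2^-1 ^+ m.
Let hfS m : hf m.+1 = hf m / 2. Proof. by rewrite /hf exprS mulrC. Qed.
Let hf0 m : 0 < hf m. Proof. by rewrite exprn_gt0. Qed.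

(** Errors and probabilities of size 2^-m along the subsequence prepare Borel-Cantelli; the last
    clause carries the conclusion to the full sequence. *)
Lemma fast_subsequence : exists phi : nat -> nat, exists E : nat -> set T,
  [/\ forall m, (m < phi m)%N, forall m, measurable (E m), forall m, (P (E m) <= (hf m)%:E)%E,
   (forall m w, ~ E m w -> forall s j, `|side s (EM (A (phi m) w)) j - side s (EM (A (phi m.+1) w)) j| <= hf m) &
   forall m N, (phi m <= N)%N -> whp P (hf m) (fun w => forall s j, `|side s (EM (A N w)) j - side s (EM (A (phi m) w)) j| <= hf m)].
Proof.
have /boolp.choice[n0 hn0] : forall m, exists N0, forall N N', (N0 <= N)%N -> (N0 <= N')%N ->
    whp P (hf m) (fun w => forall s j, `|side s (EM (A N w)) j - side s (EM (A N' w)) j| <= hf m).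
  by move=> m; exact: sides_cauchy.
(* The partial sums dominate every [n0 m], and the successors make them strictly increasing. *)
pose phi m := (\sum_(i < m.+1) (n0 i).+1)%N.
have phiS m : phi m.+1 = (phi m + (n0 m.+1).+1)%N by rewrite /phi big_ord_recr.
have n0phi m : (n0 m <= phi m)%N.
  by rewrite /phi big_ord_recr /=; apply: leq_trans (leq_addl _ _); exact: leqnSn.
have mphi m : (m < phi m)%N.
  elim: m => [|m IH]; first by rewrite /phi big_ord1.
  rewrite phiS addnS ltnS; exact: leq_trans IH (leq_addr _ _).
have ws m : whp P (hf m) (fun w => forall s j, `|side s (EM (A (phi m) w)) j - side s (EM (A (phi m.+1) w)) j| <= hf m).
  by apply: hn0 => //; rewrite phiS; exact: leq_trans (n0phi m) (leq_addr _ _).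
have /boolp.choice[E hE] : forall m, exists E, [/\ measurable E, (P E <= (hf m)%:E)%E &
   forall w, ~ E w -> forall s j, `|side s (EM (A (phi m) w)) j - side s (EM (A (phi m.+1) w)) j| <= hf m].
  by move=> m; exact: ws.
exists phi, E; split=> // m; try by have [] := hE m.
move=> N phN; apply: hn0 => //; exact: leq_trans (n0phi m) phN.
Qed.

Lemma hf_cvg : hf m @[m --> \oo] --> (0 : R).
Proof. by apply: cvg_expr; rewrite ger0_norm ?invr_lt1 // ?ltr1n ?unitfE. Qed.

Lemma geom_tail (u : nat -> R) n : (forall m, (n <= m)%N -> `|u m - u m.+1| <= hf m) ->
  forall m, (n <= m)%N -> forall p, `|u m - u (m + p)%N| <= 2 * hf m - 2 * hf (m + p).
Proof.
move=> h m nm; elim=> [|p IH]; first by rewrite addn0 !subrr normr0.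
have := h (m + p)%N (leq_trans nm (leq_addr _ _)); rewrite addnS => h1.
have -> : u m - u (m + p).+1 = (u m - u (m + p)%N) + (u (m + p)%N - u (m + p).+1) by ring.
apply: le_trans (ler_normD _ _) _; apply: le_trans (lerD IH h1) _.
by rewrite hfS; lra.
Qed.

(** By Borel-Cantelli the ordered eigenvalues are almost surely Cauchy along the subsequence; their
    limits inherit sign and order. *)
Lemma limit_spectrum : exists xi : T -> @pmseq R,
  [/\ forall s j, measurable_fun setT (fun w => side s (xi w) j), forall w, canonical_pm (xi w) &
   forall s j (e : R), 0 < e -> exists N0, forall N, (N0 <= N)%N ->
     whp P e (fun w => `|side s (EM (A N w)) j - side s (xi w) j| <= e)].
Proof.
have [phi [E [mphi mE PE hE cE]]] := fast_subsequence.
pose B := lim_sup_set E.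
have mB : measurable B.
  by apply: bigcapT_measurable => n; apply: bigcup_measurable => k _.
have PB : P B = 0%E.
  apply: lim_sup_set_cvg0 => //.
  have fE n : P (E n) = (fine (P (E n)))%:E by rewrite fineK // fin_num_measure.
  have -> : (\sum_(0 <= n <oo) P (E n) = \sum_(0 <= n <oo) (fine (P (E n)))%:E)%E.
    by apply: eq_eseriesr => n _; exact: fE.
  apply: (@le_lt_trans _ _ 2%:E); last exact: ltry.
  apply: nneseries_le => [n|J]; first exact: fine_ge0.
  rewrite lee_fin; apply: (@le_trans _ _ (\sum_(j < J) hf j)).
    by apply: ler_sum => j _; rewrite -lee_fin -fE.
  have -> : \sum_(j < J) hf j = 2 - 2 * hf J.
    elim: J => [|J IH]; first by rewrite big_ord0 /hf expr0 mulr1 subrr.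
    by rewrite big_ord_recr /= IH hfS; field.
  by rewrite gerBl mulr_ge0 // ltW.
have outB w : ~ B w -> exists n, forall m, (n <= m)%N -> ~ E m w.
  move=> nB; apply: contrapT => h; apply: nB => n _.
  apply: contrapT => h2; apply: h; exists n => m nm Em; apply: h2; by exists m.
(* The indicator forces convergence at every [w], hence a measurable limit that is canonical
   everywhere. *)
pose f s j m w := \1_(~` B) w * side s (EM (A (phi m) w)) j.
have mf s j m : measurable_fun setT (f s j m).
  apply: measurable_funM; first by apply: measurable_indic; exact: measurableC.
  exact: measurable_side_EM.
have cf s j w : cvgn (fun m => f s j m w).
  rewrite /f indicE; case: (boolP (w \in ~` B)) => [|_]; last first.
    by under eq_fun do rewrite mul0r; exact: is_cvg_cst.
  rewrite inE => /outB[n hn]; under eq_fun do rewrite mul1r.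
  have tail := geom_tail (u := fun m => side s (EM (A (phi m) w)) j) (n := n)
    (fun m nm => hE m w (hn m nm) s j).
  apply: cauchy_cvg; apply/cauchy_exP => e e0.
  have e2 : 0 < e / 2 by rewrite divr_gt0.
  have /cvgr0Pnorm_lt/(_ _ e2) [n1 _ h1] := hf_cvg.
  exists (side s (EM (A (phi (maxn n n1)) w)) j); exists (maxn n n1) => // m /= nm.
  rewrite /ball /= -(subnKC nm); apply: le_lt_trans (tail _ (leq_maxl _ _) _) _.
  have := h1 (maxn n n1) (leq_maxr _ _); rewrite /= ger0_norm ?(ltW (hf0 _)) //.
  have := hf0 (maxn n n1 + (m - maxn n n1)); lra.
pose L s j w := limn (fun m => f s j m w).
have cL s j w : f s j m w @[m --> \oo] --> L s j w by exact: cf.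
have mL s j : measurable_fun setT (L s j).
  by apply: (measurable_fun_cvg (mf s j)) => w _; exact: cL.
pose xi w : @pmseq R := (fun j => L true j w, fun j => - L false j w).
have sxi s j w : side s (xi w) j = L s j w by case: s => //=; rewrite opprK.
have f0 s j m w : 0 <= f s j m w.
  by rewrite mulr_ge0 // ?side_ge0 //; exact: canonical_EM.
have fS s j m w : f s j.+1 m w <= f s j m w.
  by rewrite ler_wpM2l // side_le //; exact: canonical_EM.
have L0 s j w : 0 <= L s j w by apply: limr_ge; [exact: cf|apply: nearW => m; exact: f0].
have LS s j w : L s j.+1 w <= L s j w.
  by apply: ler_lim; [exact: cf|exact: cf|apply: nearW => m; exact: fS].
exists xi; split.
- by move=> s j; under eq_fun do rewrite sxi; exact: mL.
- move=> w; split=> j /=; first by rewrite L0 LS.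
  by rewrite oppr_le0 lerN2 L0 LS.
move=> s j e e0.
have e3 : 0 < e / 3 by rewrite divr_gt0.
have [m1 hm1] := cvg_whp P e3 (mf s j) (mL s j) (cL s j).
have /cvgr0Pnorm_lt/(_ _ e3) [m2 _ hm2] := hf_cvg.
pose m := maxn m1 m2.
have hm : hf m <= e / 3 by have := hm2 m (leq_maxr _ _); rewrite /= ger0_norm ?(ltW (hf0 _)) // => /ltW.
exists (phi m) => N NN.
have wB : whp P 0 (fun w => ~ B w) by exists B; split=> //; rewrite PB.
have := whp_and (whp_and (whp_le hm (cE m N NN)) (hm1 m (leq_maxl _ _))) wB.
move=> /whp_le => /(_ e) h; have : e / 3 + e / 3 + 0 <= e by lra.
move=> /h; apply: whp_imp => w [[h1 h2] nB].
have := h1 s j; move: h2; rewrite /f indicE mem_set // mul1r sxi.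
set a := side s (EM (A (phi m) w)) j; set b := side s _ j; move=> h2 h3.
have -> : b - L s j w = (b - a) + (a - L s j w) by ring.
apply: le_trans (ler_normD _ _) _; lra.
Qed.

(** A Fatou argument in probability: each partial sum of squares of the limit is compared with that
    of one matrix, with a bound independent of [J]. *)
Lemma tight_limit (xi : T -> @pmseq R) :
  (forall s j, measurable_fun setT (fun w => side s (xi w) j)) -> (forall w, canonical_pm (xi w)) ->
  (forall s j (e : R), 0 < e -> exists N0, forall N, (N0 <= N)%N ->
     whp P e (fun w => `|side s (EM (A N w)) j - side s (xi w) j| <= e)) ->
  forall e : R, 0 < e -> exists C, 0 < C /\ whp P e (fun w => l2pm C (xi w)).
Proof.
move=> mxi cxi hxi e e0; have e2 : 0 < e / 2 by rewrite divr_gt0.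
have [C [C0 hC]] := tA e2.
(* From b^2 <= 2 a^2 + 2 (a - b)^2 come the factor 2 and, for the accumulated error, the added 1. *)
pose S J := [set w | 2 * C + 1 < pL (fun x => x ^+ 2) (xi w) J].
have mS J : measurable (S J).
  apply: measurable_gt; under eq_fun do rewrite pL_sqr_side.
  by apply: measurable_sum => j; apply: measurable_funD; exact: measurable_funX.
have PS J : (P (S J) <= e%:E)%E.
  apply: whp_P => //.
  (* The first bound keeps the 2 J events within probability e / 2, the second makes 4 J e'^2 <=
     1. *)
  pose e' := Num.min (e / 2 / (2 * J.+1%:R)) (Num.sqrt (4 * J.+1%:R))^-1.
  have e'0 : 0 < e' by rewrite lt_min !(divr_gt0, invr_gt0, sqrtr_gt0, mulr_gt0).
  have [N0 hN0] : exists N0, forall k N, (k < J)%N -> (N0 <= N)%N -> forall s,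
      whp P e' (fun w => `|side s (EM (A N w)) k - side s (xi w) k| <= e').
    apply: (@ex_uniform (fun k N => forall s,
      whp P e' (fun w => `|side s (EM (A N w)) k - side s (xi w) k| <= e'))) => k.
    have [N1 h1] := hxi true k e' e'0; have [N2 h2] := hxi false k e' e'0.
    exists (maxn N1 N2) => N; rewrite geq_max => /andP[n1 n2] [|]; [exact: h1|exact: h2].
  pose N := maxn 1 N0.
  have ws s : whp P ((size (iota 0 J))%:R * e') (fun w => forall k, k \in iota 0 J ->
      `|side s (EM (A N w)) k - side s (xi w) k| <= e').
    apply: whp_all; first exact: ltW.
    by move=> k; rewrite mem_iota add0n /= => kJ; apply: hN0 => //; exact: leq_maxr.
  have := whp_and (hC N (leq_maxl _ _)) (whp_and (ws true) (ws false)).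
  move=> /whp_le => /(_ e) h; have : e / 2 + ((size (iota 0 J))%:R * e' + (size (iota 0 J))%:R * e') <= e.
    rewrite size_iota.
    have : J%:R * e' <= e / 4.
      apply: (@le_trans _ _ (J.+1%:R * (e / 2 / (2 * J.+1%:R)))).
        apply: ler_pM => //; [exact: ltW|by rewrite ler_nat|by rewrite ge_min lexx].
      by rewrite le_eqVlt; apply/orP; left; apply/eqP; field; rewrite addrC natr1 pnatr_eq0.
    lra.
  move=> /h; apply: whp_imp => w [fw [h1 h2]] /=; rewrite /S /= => bad.
  have lE := l2pm_EM (sA N w) fw; have [_ /(_ J)] := lE.
  move: bad; rewrite !pL_sqr_side => bad good.
  suff : \sum_(j < J) (side true (xi w) j ^+ 2 + side false (xi w) j ^+ 2) <= 2 * C + 1.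
    by move=> h3; move: (lt_le_trans bad h3); rewrite ltxx.
  apply: (@le_trans _ _ (\sum_(j < J) (2 * (side true (EM (A N w)) j ^+ 2 + side false (EM (A N w)) j ^+ 2) + 4 * e' ^+ 2))).
    apply: ler_sum => j _.
    have sq (a b : R) : `|a - b| <= e' -> b ^+ 2 <= 2 * a ^+ 2 + 2 * e' ^+ 2.
      move=> ab; have : (a - b) ^+ 2 <= e' ^+ 2.
        by rewrite -(real_normK (num_real (a - b))) ler_pXn2r // nnegrE ltW.
      have := sqr_ge0 (2 * a - b); nra.
    have mj : (j : nat) \in iota 0 J by rewrite mem_iota add0n /=.
    by have := sq _ _ (h1 _ mj); have := sq _ _ (h2 _ mj); lra.
  rewrite big_split /= -mulr_sumr sumr_const card_ord -(mulr_natl (4 * _) J).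
  apply: lerD; first by rewrite ler_pM2l.
  have : e' ^+ 2 <= (4 * J.+1%:R)^-1.
    have p4 : 0 <= 4 * J.+1%:R :> R by rewrite mulr_ge0.
    rewrite -[X in X^-1](sqr_sqrtr p4) -exprVn ler_pXn2r ?nnegrE ?invr_ge0 ?sqrtr_ge0 ?(ltW e'0) //.
    by rewrite ge_min lexx orbT.
  move=> h3; apply: (@le_trans _ _ (J.+1%:R * (4 * (4 * J.+1%:R)^-1))).
    apply: ler_pM; [by []|by rewrite mulr_ge0 ?sqr_ge0|by rewrite ler_nat|by rewrite ler_pM2l].
  by rewrite le_eqVlt; apply/orP; left; apply/eqP; field; rewrite addrC natr1 pnatr_eq0.
exists (2 * C + 1); split; first by lra.
exists (\bigcup_J S J); split.
- exact: bigcupT_measurable.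
- have cS : (P \o S) J @[J --> \oo] --> P (\bigcup_J S J).
    apply: nondecreasing_cvg_mu => //; first exact: bigcupT_measurable.
    move=> n m nm; apply/subsetPset => w; rewrite /S /= => h; apply: lt_le_trans h _.
    by apply: pL_mono => // x; exact: sqr_ge0.
  by apply: (cvge_to_le cS); apply: nearW => J; exact: PS.
- move=> w nS; split=> // J; rewrite leNgt; apply/negP => h; by apply: nS; exists J.
Qed.

(** Failure of square summability lies in sets of probability 2^-n for every n, hence in a null
    set. *)
Lemma random_pm_of_limit (xi : T -> @pmseq R) :
  (forall s j, measurable_fun setT (fun w => side s (xi w) j)) -> (forall w, canonical_pm (xi w)) ->
  (forall e : R, 0 < e -> exists C, 0 < C /\ whp P e (fun w => l2pm C (xi w))) ->
  random_pm_C2 P xi.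
Proof.
move=> mxi cxi hxi; split.
  move=> j; split; first exact: (mxi true j).
  by have := measurable_funN (mxi false j); congr measurable_fun; apply/funext => w /=; rewrite opprK.
have /boolp.choice[E hE] : forall n : nat, exists E, [/\ measurable E, (P E <= (hf n)%:E)%E & forall w, ~ E w -> in_C 2 (xi w)].
  move=> n; have [C [C0 [E [mE PE h]]]] := hxi _ (hf0 n); exists E; split=> // w nE; exact: l2pm_in_C2 (h w nE).
exists (\bigcap_n E n); split.
- by apply: bigcapT_measurable => n; have [] := hE n.
- apply/eqP; rewrite -measure_le0; apply/lee_addgt0Pr => e e0; rewrite add0e.
  have /cvgr0Pnorm_lt/(_ _ e0) [n _ /(_ n (leqnn n))] := hf_cvg.
  rewrite /= ger0_norm ?(ltW (hf0 _)) // => hn.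
  apply: (@le_trans _ _ (P (E n))).
    rewrite le_measure ?inE //; [|by have [] := hE n|by move=> w; apply].
    by apply: bigcapT_measurable => k; have [] := hE k.
  by have [_ PE _] := hE n; apply: le_trans PE _; rewrite lee_fin ltW.
- move=> w nC n _; apply: contrapT => nE; apply: nC; by have [_ _ h] := hE n; exact: h.
Qed.

Lemma conv_of_sides (xi : T -> @pmseq R) :
  (forall s j, measurable_fun setT (fun w => side s (xi w) j)) ->
  (forall e : R, 0 < e -> exists C, 0 < C /\ whp P e (fun w => l2pm C (xi w))) ->
  (forall s j (e : R), 0 < e -> exists N0, forall N, (N0 <= N)%N ->
     whp P e (fun w => `|side s (EM (A N w)) j - side s (xi w) j| <= e)) ->
  forall eps : R, 0 < eps ->
    (fun N : nat => P [set w | (eps%:E < dist_p 4 (EM (A N w)) (xi w))%E]) @ \oo --> 0%E.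
Proof.
move=> mxi hxi cxi eps eps0.
have main (e : R) : 0 < e -> exists N0, forall N, (N0 <= N)%N ->
    (P [set w | (eps%:E < dist_p 4 (EM (A N w)) (xi w))%E] <= e%:E)%E.
  move=> e0; have e3 : 0 < e / 3 by rewrite divr_gt0.
  have [C1 [C10 h1]] := tA e3; have [C2 [C20 h2]] := hxi _ e3.
  pose C := Num.max C1 C2; pose D := eps / 2; have D0 : 0 < D by rewrite divr_gt0.
  have D4 : 0 < D ^+ 4 by rewrite exprn_gt0.
  (* Makes the tail in [dist4_trunc] at most D^4 / 2. *)
  pose J := Num.truncn (16 * C ^+ 2 / (D ^+ 4 / 2)).
  have hJ : 16 * C ^+ 2 / J.+1%:R <= D ^+ 4 / 2.
    rewrite ler_pdivrMr // [leRHS]mulrC -ler_pdivrMr ?divr_gt0 //; exact/ltW/truncnS_gt.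
  (* The bounds give eta^4 <= eta, a contribution at most D^4 / 2 from the first [J] entries, and
     total probability at most e / 3 for the events on both sides. *)
  pose eta := Num.min 1 (Num.min (D ^+ 4 / (4 * J.+1%:R)) (e / 6 / J.+1%:R)).
  have eta0 : 0 < eta by rewrite !lt_min ltr01 !(divr_gt0, mulr_gt0).
  have [N0 hN0] : exists N0, forall k N, (k < J)%N -> (N0 <= N)%N -> forall s,
      whp P eta (fun w => `|side s (EM (A N w)) k - side s (xi w) k| <= eta).
    apply: (@ex_uniform (fun k N => forall s,
      whp P eta (fun w => `|side s (EM (A N w)) k - side s (xi w) k| <= eta))) => k.
    have [N1 n1] := cxi true k eta eta0; have [N2 n2] := cxi false k eta eta0.
    exists (maxn N1 N2) => N; rewrite geq_max => /andP[g1 g2] [|]; [exact: n1|exact: n2].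
  exists (maxn 1 N0) => N; rewrite geq_max => /andP[N1 NN].
  apply: EM_dist_whp => //.
  have ws s : whp P ((size (iota 0 J))%:R * eta) (fun w => forall k, k \in iota 0 J ->
      `|side s (EM (A N w)) k - side s (xi w) k| <= eta).
    apply: whp_all; first exact: ltW.
    by move=> k; rewrite mem_iota add0n /= => kJ; apply: hN0.
  have := whp_and (whp_and (h1 N N1) h2) (whp_and (ws true) (ws false)).
  move=> /whp_le => /(_ e) h.
  have le1 : e / 3 + e / 3 + ((size (iota 0 J))%:R * eta + (size (iota 0 J))%:R * eta) <= e.
    rewrite size_iota.
    have : J%:R * eta <= e / 6.
      apply: (@le_trans _ _ (J.+1%:R * (e / 6 / J.+1%:R))).
        apply: ler_pM => //; [exact: ltW|by rewrite ler_nat|by rewrite !ge_min lexx !orbT].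
      by rewrite mulrCA mulfV ?mulr1 ?pnatr_eq0.
    lra.
  move: le1 => /h; apply: whp_imp => w [[f1 f2] [s1 s2]] /=; apply/negP; rewrite -leNgt.
  have -> : eps = 2 * D by rewrite /D; field.
  apply: dist4_le; first exact: ltW.
  have l1 : l2pm C (EM (A N w)) by apply: l2pm_EM => //; apply: le_trans f1 _; rewrite le_max lexx.
  have l2 : l2pm C (xi w) by apply: l2pm_le f2; rewrite le_max lexx orbT.
  move=> J'; apply: le_trans (dist4_trunc (eta := eta) (J := J) l1 l2 (ltW eta0) _ J') _.
    by move=> [|] j jJ; [apply: s1|apply: s2]; rewrite mem_iota.
  have e4 : eta ^+ 4 <= D ^+ 4 / (4 * J.+1%:R).
    apply: (@le_trans _ _ (eta ^+ 1)); last by rewrite expr1 !ge_min lexx orbT.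
    by apply: ler_wiXn2l => //; [exact: ltW|rewrite ge_min lexx].
  have : J%:R * (2 * eta ^+ 4) <= D ^+ 4 / 2.
    apply: (@le_trans _ _ (J.+1%:R * (2 * (D ^+ 4 / (4 * J.+1%:R))))).
      apply: ler_pM; [by []|by rewrite mulr_ge0 ?exprn_ge0 ?(ltW eta0)|by rewrite ler_nat|by rewrite ler_pM2l].
    by rewrite le_eqVlt; apply/orP; left; apply/eqP; field; rewrite addrC natr1 pnatr_eq0.
  by move=> h5; apply: le_trans (lerD h5 hJ) _; rewrite -splitr.
have mS N : measurable [set w | (eps%:E < dist_p 4 (EM (A N w)) (xi w))%E].
  by apply: measurable_dist_gt => // s j; exact: measurable_side_EM.
apply/fine_cvgP; split; first by apply: nearW => N; exact: fin_num_measure.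
apply/cvgr0Pnorm_le => e e0; have [N0 h] := main _ e0; exists N0 => // N /= NN.
by rewrite ger0_norm ?fine_ge0 // -lee_fin fineK ?h // fin_num_measure.
Qed.

End RandomSpectra.

(** * Existence for the given process *)

Section Existence.
Context {R : realType} d (T : measurableType d) (P : probability T R).
Variable X : int -> int -> T -> R.
Variables nu nac nd : {measure set (R * R)%type -> \bar R}.
Hypothesis H : thm_hyps P X nu nac nd.

Definition WA (N : nat) (w : T) : 'M[R]_N := N%:R^-1 *: WN X N w.

Lemma WA_sym N w : (WA N w)^T = WA N w.
Proof. by rewrite /WA linearZ /= WN_sym. Qed.

Lemma measurable_WA N i j : measurable_fun setT (fun w => WA N w i j).
Proof.
have gX : centered_gaussian P X by case: H.
under eq_fun do rewrite mxE; apply: measurable_funM => //; exact: (measurable_WN gX).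
Qed.

(** The traces for N and N' are both compared with the same function of the Fourier coefficients
    over one fixed window. *)
Lemma trace_cauchy k (e : R) : (2 < k)%N -> 0 < e -> exists N0, forall N N', (N0 <= N)%N -> (N0 <= N')%N ->
  whp P e (fun w => `|\tr (WA N w ^+ k) - \tr (WA N' w ^+ k)| <= e).
Proof.
move=> k2 e0; have e2 : 0 < e / 2 by rewrite divr_gt0.
have [dl [dl0 h]] := trace_approx H k2 e2.
have [F [gF hF]] := goodF_exists H dl0.
have [M0 hM] := h F gF hF; have [N0 hN] := hM M0 (leqnn _).
exists N0 => N N' NN NN'; have := whp_and (hN N NN) (hN N' NN').
rewrite -splitr; apply: whp_imp => w [h1 h2]; rewrite /WA.
move: h1 h2; set a := \tr _; set b := \tr _; set t := Tk _ _ _ => h1 h2.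
have -> : a - b = (a - t) - (b - t) by ring.
apply: le_trans (ler_normB _ _) _; lra.
Qed.

Lemma exists_limit : exists xi : T -> pmseq, random_pm_C2 P xi /\ EM_conv_prob P X xi.
Proof.
have [xi [mxi cxi hxi]] := limit_spectrum measurable_WA WA_sym (fro_tight H) trace_cauchy.
have tl := tight_limit WA_sym (fro_tight H) mxi cxi hxi.
exists xi; split; first exact: (random_pm_of_limit mxi cxi tl).
exact: (conv_of_sides measurable_WA WA_sym (fro_tight H) mxi tl hxi).
Qed.

End Existence.

(** * Trigonometric polynomials and laws *)

Section TrigBounds.
Context {R : realType}.

Lemma cos_lip (x y : R) : `|cos x - cos y| <= `|x - y|.
Proof.
wlog xy : x y / x < y.
  move=> h; case: (ltP x y) => [xy|]; first exact: h.
  rewrite le_eqVlt => /predU1P[->|yx]; first by rewrite !subrr.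
  by rewrite distrC [leRHS]distrC; exact: h.
have der (z : R) : z \in `]x, y[ -> is_derive z (1 : R) cos (- sin z) by move=> _; exact: is_derive_cos.
have [|c _ E] := MVT xy der.
  by apply: continuous_subspaceT; exact: continuous_cos.
rewrite distrC E [leRHS]distrC normrM normrN ler_piMl //; exact: sin_max.
Qed.

Lemma sin_close (y : R) : `|y - sin y| <= y ^+ 2.
Proof.
wlog y0 : y / 0 < y.
  move=> h; case: (ltrgtP y 0) => [yn|yp|->]; [|exact: h|by rewrite sin0 subrr normr0 expr0n].
  have := h (- y); rewrite oppr_gt0 => /(_ yn); rewrite sinN sqrrN.
  by have -> : - y - - sin y = - (y - sin y) by [ring|]; rewrite normrN.
have der (z : R) : z \in `]0, y[ -> is_derive z (1 : R) (fun z => z - sin z) (1 - cos z).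
  by move=> _; apply: is_derive_eq.
have [|c cy E] := MVT y0 der.
  apply: continuous_subspaceT => z; apply: cvgB; [exact: cvg_id|exact: continuous_sin].
move: cy; rewrite in_itv /= => /andP[c0 cy].
move: E; rewrite sin0 !subr0 => ->; rewrite normrM (gtr0_norm y0) expr2.
rewrite ler_wpM2r ?(ltW y0) // -cos0; apply: le_trans (cos_lip _ _) _.
by rewrite sub0r normrN gtr0_norm // ltW.
Qed.

(** Approximates the identity uniformly on bounded sets by a bounded trigonometric function. *)
Definition damp (n : nat) (x : R) : R := n.+1%:R * sin (x / n.+1%:R).

Lemma damp_close n x : `|x - damp n x| <= x ^+ 2 / n.+1%:R.
Proof.
have n0 : n.+1%:R != 0 :> R by rewrite pnatr_eq0.
have -> : x - damp n x = n.+1%:R * (x / n.+1%:R - sin (x / n.+1%:R)) by rewrite /damp; field.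
rewrite normrM normr_nat; apply: le_trans (ler_wpM2l _ (sin_close _)) _ => //.
by rewrite le_eqVlt; apply/orP; left; apply/eqP; field.
Qed.

Lemma damp_cvg x : damp n x @[n --> \oo] --> x.
Proof.
apply/cvgrPdist_le => e e0; near=> n.
apply: le_trans (damp_close _ _) _; rewrite ler_pdivrMr // -ler_pdivrMl //.
apply: (@le_trans _ _ n%:R); last by rewrite ler_nat.
near: n; exact: nbhs_infty_ger.
Unshelve. all: by end_near. Qed.

Lemma damp_le n x Q : `|x| <= Q -> `|damp n x| <= Q + Q ^+ 2.
Proof.
move=> xQ; have -> : damp n x = x - (x - damp n x) by ring.
apply: le_trans (ler_normB _ _) _; apply: lerD => //; apply: le_trans (damp_close _ _) _.
apply: (@le_trans _ _ (x ^+ 2)); first by rewrite ler_pdivrMr // ler_peMr ?sqr_ge0 // ler1n.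
by rewrite -real_normK ?num_real // ler_pXn2r ?nnegrE // (le_trans _ xQ).
Qed.

Lemma measurable_sin_comp d (T : measurableType d) (f : T -> R) :
  measurable_fun setT f -> measurable_fun setT (fun w => sin (f w)).
Proof. by move=> mf; apply: (measurableT_comp (f := sin)) => //; exact: measurable_sinR. Qed.

Lemma measurable_cos_comp d (T : measurableType d) (f : T -> R) :
  measurable_fun setT f -> measurable_fun setT (fun w => cos (f w)).
Proof. by move=> mf; apply: (measurableT_comp (f := cos)) => //; exact: measurable_cosR. Qed.

Lemma measurable_damp d (T : measurableType d) n (f : T -> R) :
  measurable_fun setT f -> measurable_fun setT (fun w => damp n (f w)).
Proof. by move=> mf; apply: measurable_funM => //; apply: measurable_sin_comp; exact: measurable_funM. Qed.

End TrigBounds.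

(** * Trigonometric polynomials and their uniform limits *)

Section TrigPolynomials.
Context {R : realType} {I : eqType}.
Variable S : seq I.
Implicit Types (v : I -> R) (h : (I -> R) -> R).

Definition lin (t : seq (R * I)) v : R := \sum_(p <- t) p.1 * v p.2.
Definition trig (s : seq (R * seq (R * I) * R)) v : R := \sum_(x <- s) x.1.1 * cos (lin x.1.2 v + x.2).
Definition okt (t : seq (R * I)) := all (fun p => p.2 \in S) t.
Definition oks (s : seq (R * seq (R * I) * R)) := all (fun x => okt x.1.2) s.
(** Only coordinates in [S] may occur in frequencies, since the laws are compared on those alone. *)
Definition TP h := exists2 s, oks s & forall v, h v = trig s v.

Lemma TP_cst c : TP (fun=> c).
Proof.
by exists [:: (c, [::], 0)] => // v; rewrite /trig big_seq1 /lin big_nil addr0 cos0 mulr1.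
Qed.

Lemma TP_D h h' : TP h -> TP h' -> TP (fun v => h v + h' v).
Proof.
move=> [s os E] [s' os' E']; exists (s ++ s'); first by rewrite /oks all_cat; apply/andP.
by move=> v; rewrite E E' /trig big_cat.
Qed.

Lemma lin_cat t t' v : lin (t ++ t') v = lin t v + lin t' v.
Proof. by rewrite /lin big_cat. Qed.

Definition negt (t : seq (R * I)) : seq (R * I) := [seq (- p.1, p.2) | p <- t].

Lemma lin_neg t v : lin (negt t) v = - lin t v.
Proof. by rewrite /lin big_map -sumrN; apply: eq_bigr => p _; rewrite /= mulNr. Qed.

Lemma TP_M h h' : TP h -> TP h' -> TP (fun v => h v * h' v).
Proof.
move=> [s os E] [s' os' E'].
pose m (x y : R * seq (R * I) * R) : seq (R * seq (R * I) * R) :=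
  [:: (x.1.1 * y.1.1 / 2, x.1.2 ++ y.1.2, x.2 + y.2); (x.1.1 * y.1.1 / 2, x.1.2 ++ negt y.1.2, x.2 - y.2)].
exists (flatten [seq m x y | x <- s, y <- s']).
  rewrite /oks; apply/allP => z /flattenP[l /allpairsP[[x y] /= [xs ys ->]]].
  have ox : okt x.1.2 by exact: (allP os).
  have oy : okt y.1.2 by exact: (allP os').
  rewrite !inE => /orP[/eqP ->|/eqP ->] /=; rewrite /okt all_cat -/(okt _) ox //=.
  by rewrite all_map; apply/allP => p py /=; exact: (allP oy).
move=> v; rewrite E E' /trig big_flatten /= big_allpairs_dep /= mulr_suml; apply: eq_bigr => x _.
rewrite mulr_sumr; apply: eq_bigr => y _; rewrite /m !big_cons big_nil /= !lin_cat lin_neg addr0.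
set a := lin x.1.2 v; set b := lin y.1.2 v.
have -> : a + b + (x.2 + y.2) = (a + x.2) + (b + y.2) by ring.
have -> : a - b + (x.2 - y.2) = (a + x.2) - (b + y.2) by ring.
by rewrite (cosB (a + x.2)) (cosD (a + x.2)); field.
Qed.

Lemma TP_damp n i : i \in S -> TP (fun v => damp n (v i)).
Proof.
move=> iS; exists [:: (- n.+1%:R, [:: (n.+1%:R^-1, i)], pi / 2)]; first by rewrite /oks /okt /= iS.
move=> v; rewrite /trig /lin !big_seq1 /= cosDpihalf mulrNN /damp; congr (_ * sin _).
by rewrite mulrC.
Qed.

Lemma TP_ext h h' : (forall v, h v = h' v) -> TP h -> TP h'.
Proof. by move=> hh [s os E]; exists s => // v; rewrite -hh. Qed.

Lemma TP_X h n : TP h -> TP (fun v => h v ^+ n).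
Proof.
move=> Th; elim: n => [|n IH]; first by apply: TP_ext (TP_cst 1) => v; rewrite expr0.
by apply: TP_ext (TP_M Th IH) => v; rewrite exprS.
Qed.

Lemma TP_sum (J : Type) (s : seq J) (g : J -> (I -> R) -> R) : (forall j, TP (g j)) ->
  TP (fun v => \sum_(j <- s) g j v).
Proof.
move=> Tg; elim: s => [|j s IH]; first by apply: TP_ext (TP_cst 0) => v; rewrite big_nil.
by apply: TP_ext (TP_D (Tg j) IH) => v; rewrite big_cons.
Qed.

Lemma TP_horner (p : {poly R}) h : TP h -> TP (fun v => p.[h v]).
Proof.
move=> Th; apply: (@TP_ext (fun v => \sum_(i < size p) p`_i * h v ^+ i)).
  by move=> v; rewrite horner_coef.
by apply: TP_sum => i; apply: TP_M; [exact: TP_cst|exact: TP_X].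
Qed.

Lemma TP_bnd h : TP h -> exists2 K, 0 < K & forall v, `|h v| <= K.
Proof.
move=> [s _ E]; exists (1 + \sum_(x <- s) `|x.1.1|).
  by rewrite ltr_pwDl // sumr_ge0.
move=> v; rewrite E; apply: le_trans (ler_norm_sum _ _ _) _; rewrite -[leLHS]add0r; apply: lerD => //.
by apply: ler_sum => x _; rewrite normrM ler_piMr // cos_abs_le1.
Qed.

Lemma measurable_lin d (T : measurableType d) (V : T -> I -> R) t :
  (forall i, measurable_fun setT (fun w => V w i)) -> measurable_fun setT (fun w => lin t (V w)).
Proof. by move=> mV; apply: measurable_sum => p; exact: measurable_funM. Qed.

Lemma measurable_TP d (T : measurableType d) (V : T -> I -> R) h : TP h ->
  (forall i, measurable_fun setT (fun w => V w i)) -> measurable_fun setT (fun w => h (V w)).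
Proof.
move=> [s _ E] mV; under eq_fun do rewrite E.
apply: measurable_sum => x; apply: measurable_funM => //; apply: measurable_cos_comp.
by apply: measurable_funD => //; exact: measurable_lin.
Qed.

(** Bounded uniform limits of trigonometric polynomials, that is, almost periodic functions of
    finitely many coordinates. *)
Definition UTP h := (exists2 K, 0 < K & forall v, `|h v| <= K) /\
  forall e, 0 < e -> exists2 h', TP h' & forall v, `|h v - h' v| <= e.

Lemma UTP_ext h h' : (forall v, h v = h' v) -> UTP h -> UTP h'.
Proof.
move=> hh [[K K0 hK] ah]; split; first by exists K => // v; rewrite -hh.
by move=> e e0; have [g Tg hg] := ah e e0; exists g => // v; rewrite -hh.
Qed.

Lemma UTP_cst c : UTP (fun=> c).
Proof.
split; first by exists (`|c| + 1) => [|v]; [rewrite ltr_wpDl|rewrite lerDl].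
by move=> e e0; exists (fun=> c) => [|v]; [exact: TP_cst|rewrite subrr normr0 ltW].
Qed.

(** The range of [h] is bounded, so Weierstrass replaces [g] by a polynomial, and trigonometric
    polynomials form an algebra. *)
Lemma UTP_lip h (g : R -> R) (L : R) : TP h -> 0 <= L -> (forall x y, `|g x - g y| <= L * `|x - y|) ->
  UTP (fun v => g (h v)).
Proof.
move=> Th L0 gl; have [K K0 hK] := TP_bnd Th; split.
  exists (`|g 0| + L * K + 1) => [|v]; first by rewrite ltr_wpDl // addr_ge0 // mulr_ge0 // ltW.
  have := gl (h v) 0; rewrite subr0 => h1.
  have h2 : L * `|h v| <= L * K by rewrite ler_wpM2l.
  have -> : g (h v) = (g (h v) - g 0) + g 0 by rewrite subrK.
  by apply: le_trans (ler_normD _ _) _; lra.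
move=> e e0; have [p hp] := weierstrass L0 K0 e0 (fun x y _ _ => gl x y).
by exists (fun v => p.[h v]); [exact: TP_horner|move=> v; exact: hp].
Qed.

Lemma UTP_M h h' : UTP h -> UTP h' -> UTP (fun v => h v * h' v).
Proof.
move=> [[K K0 hK] ah] [[K' K0' hK'] ah']; split.
  by exists (K * K') => [|v]; [rewrite mulr_gt0|rewrite normrM ler_pM].
move=> e e0; pose e1 := Num.min 1 (e / (K + K' + 1)).
have D0 : 0 < K + K' + 1 by rewrite !addr_gt0.
have e10 : 0 < e1 by rewrite lt_min ltr01 divr_gt0.
have [g Tg hg] := ah e1 e10; have [g' Tg' hg'] := ah' e1 e10.
exists (fun v => g v * g' v); first exact: TP_M.
move=> v; have -> : h v * h' v - g v * g' v = (h v - g v) * h' v + g v * (h' v - g' v) by ring.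
have gK : `|g v| <= K + 1.
  have -> : g v = h v - (h v - g v) by ring.
  apply: le_trans (ler_normB _ _) _; apply: lerD => //.
  by apply: le_trans (hg v) _; rewrite ge_min lexx.
apply: le_trans (ler_normD _ _) _; rewrite !normrM.
apply: (@le_trans _ _ (e1 * K' + (K + 1) * e1)); first by apply: lerD; apply: ler_pM.
have -> : e1 * K' + (K + 1) * e1 = e1 * (K + K' + 1) by ring.
by rewrite -ler_pdivlMr // ge_min lexx orbT.
Qed.

Lemma UTP_prod (s : seq I) (g : I -> (I -> R) -> R) : (forall i, i \in s -> UTP (g i)) ->
  UTP (fun v => \prod_(i <- s) g i v).
Proof.
elim: s => [|i s IH] hs; first by apply: UTP_ext (UTP_cst 1) => v; rewrite big_nil.
apply: (@UTP_ext (fun v => g i v * \prod_(j <- s) g j v)); first by move=> v; rewrite big_cons.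
by apply: UTP_M; [apply: hs; exact: mem_head|apply: IH => j js; apply: hs; rewrite inE js orbT].
Qed.

(* Polynomials are not uniformly almost periodic; replacing each coordinate x by n sin (x / n) makes them so. *)
Definition dampable (g : (I -> R) -> R) := [/\ forall n, TP (fun v => g (fun i => damp n (v i))),
  (forall Q e, 0 < Q -> 0 < e -> exists n0, forall n v, (n0 <= n)%N -> (forall i, i \in S -> `|v i| <= Q) ->
     `|g v - g (fun i => damp n (v i))| <= e) &
  forall Q, 0 < Q -> exists2 K, 0 < K & forall v, (forall i, i \in S -> `|v i| <= Q) -> `|g v| <= K].

Lemma dampable_ext g g' : (forall v, g v = g' v) -> dampable g -> dampable g'.
Proof. by move=> /funext ->. Qed.

Lemma dampable_cst c : dampable (fun=> c).
Proof.
split; first by move=> n; exact: TP_cst.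
  by move=> Q e _ e0; exists 0%N => n v _ _; rewrite subrr normr0 ltW.
by move=> Q _; exists (`|c| + 1) => [|v _]; [rewrite ltr_wpDl|rewrite lerDl].
Qed.

Lemma dampable_coord i : i \in S -> dampable (fun v => v i).
Proof.
move=> iS; split; first by move=> n; exact: TP_damp.
  move=> Q e Q0 e0; exists (Num.truncn (Q ^+ 2 / e)) => n v hn hv.
  apply: le_trans (damp_close _ _) _; rewrite ler_pdivrMr // mulrC -ler_pdivrMr //.
  apply: (@le_trans _ _ (Q ^+ 2 / e)).
    rewrite ler_pM2r ?invr_gt0 // -real_normK ?num_real // ler_pXn2r ?nnegrE ?(ltW Q0) //; exact: hv.
  apply: le_trans (ltW (truncnS_gt _)) _; by rewrite ler_nat ltnS.
by move=> Q Q0; exists Q => // v; apply.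
Qed.

Lemma dampable_D g g' : dampable g -> dampable g' -> dampable (fun v => g v + g' v).
Proof.
move=> [a b c] [a' b' c']; split; first by move=> n; exact: TP_D (a n) (a' n).
  move=> Q e Q0 e0; have e2 : 0 < e / 2 by rewrite divr_gt0.
  have [n1 h1] := b Q _ Q0 e2; have [n2 h2] := b' Q _ Q0 e2.
  exists (maxn n1 n2) => n v; rewrite geq_max => /andP[m1 m2] hv.
  have := h1 n v m1 hv; have := h2 n v m2 hv.
  set x := g' v; set y := g' _; set z := g v; set u := g _ => k1 k2.
  have -> : z + x - (u + y) = (z - u) + (x - y) by ring.
  by apply: le_trans (ler_normD _ _) _; lra.
move=> Q Q0; have [K K0 hK] := c Q Q0; have [K' K0' hK'] := c' Q Q0.
exists (K + K') => [|v hv]; first by rewrite addr_gt0.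
by apply: le_trans (ler_normD _ _) _; apply: lerD; [exact: hK|exact: hK'].
Qed.

Lemma dampable_M g g' : dampable g -> dampable g' -> dampable (fun v => g v * g' v).
Proof.
move=> [a b c] [a' b' c']; split; first by move=> n; exact: TP_M (a n) (a' n).
  move=> Q e Q0 e0.
  (* The damped argument may leave the ball of radius [Q], but by [damp_le] not this larger one. *)
  have Q1 : 0 < Q + Q ^+ 2 by rewrite addr_gt0 // exprn_gt0.
  have [K K0 hK] := c _ Q1; have [K' K0' hK'] := c' _ Q0.
  have D0 : 0 < K + K' by rewrite addr_gt0.
  have e1 : 0 < e / (K + K') by rewrite divr_gt0.
  have [n1 h1] := b Q _ Q0 e1; have [n2 h2] := b' Q _ Q0 e1.
  exists (maxn n1 n2) => n v; rewrite geq_max => /andP[m1 m2] hv.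
  have := h1 n v m1 hv; have := h2 n v m2 hv; have := hK' v hv.
  have := hK (fun i => damp n (v i)) (fun i iS => damp_le n (hv i iS)).
  set x := g' v; set y := g' _; set z := g v; set u := g _ => k3 k4 k1 k2.
  have -> : z * x - u * y = (z - u) * x + u * (x - y) by ring.
  apply: le_trans (ler_normD _ _) _; rewrite !normrM.
  apply: (@le_trans _ _ (e / (K + K') * K' + K * (e / (K + K')))); first by apply: lerD; apply: ler_pM.
  by rewrite le_eqVlt; apply/orP; left; apply/eqP; field; rewrite gt_eqF.
move=> Q Q0; have [K K0 hK] := c Q Q0; have [K' K0' hK'] := c' Q Q0.
exists (K * K') => [|v hv]; first by rewrite mulr_gt0.
by rewrite normrM; apply: ler_pM => //; [exact: hK|exact: hK'].
Qed.

Lemma dampable_sum (J : Type) (s : seq J) (g : J -> (I -> R) -> R) : (forall j, dampable (g j)) ->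
  dampable (fun v => \sum_(j <- s) g j v).
Proof.
move=> Tg; elim: s => [|j s IH]; first by apply: dampable_ext (dampable_cst 0) => v; rewrite big_nil.
by apply: dampable_ext (dampable_D (Tg j) IH) => v; rewrite big_cons.
Qed.

End TrigPolynomials.

Lemma measurable_orthant (R : realType) (I : eqType) (s : seq I) (a : I -> R) d (T : measurableType d) (W : T -> I -> R) :
  (forall i, measurable_fun setT (fun w => W w i)) -> measurable [set w | forall i, i \in s -> W w i <= a i].
Proof.
move=> mW; elim: s => [|i s IH]; first by rewrite (_ : [set w | _] = setT) //; apply/seteqP; split.
rewrite (_ : [set w | _] = [set w | W w i <= a i] `&` [set w | forall j, j \in s -> W w j <= a j]).
  by apply: measurableI => //; exact: measurable_le_set.
apply/seteqP; split=> w /=; first by move=> h; split; [apply: h; exact: mem_head|move=> j js; apply: h; rewrite inE js orbT].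
by move=> [h1 h2] j; rewrite inE => /predU1P[->|/h2].
Qed.

(** * Comparing laws through cosines of linear forms *)

Section CompareLaws.
Context {R : realType} {I : eqType} (S : seq I).
Context d (T : measurableType d) (P : probability T R) d' (T' : measurableType d') (P' : probability T' R).

Section Sequences.
Variables (V : nat -> T -> I -> R) (V' : nat -> T' -> I -> R).
Hypothesis mV : forall M i, measurable_fun setT (fun w => V M w i).
Hypothesis mV' : forall M i, measurable_fun setT (fun w => V' M w i).
Hypothesis hV : forall t b, okt S t -> exists l : R,
  \int[P]_w cos (lin t (V M w) + b) @[M --> \oo] --> l /\ \int[P']_w cos (lin t (V' M w) + b) @[M --> \oo] --> l.

Definition agree (h : (I -> R) -> R) := forall e : R, 0 < e -> exists M0, forall M, (M0 <= M)%N ->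
  `|\int[P]_w h (V M w) - \int[P']_w h (V' M w)| <= e.

Lemma agree_TP h : TP S h -> agree h.
Proof.
move=> [s os E].
have itc (d0 : measure_display) (T0 : measurableType d0) (P0 : probability T0 R) (W : T0 -> I -> R) t b :
    (forall i, measurable_fun setT (fun w => W w i)) -> itg P0 (fun w => cos (lin t (W w) + b)).
  move=> mW; apply: (@itg_bounded _ _ _ P0 _ 1) => [|w]; last exact: cos_abs_le1.
  by apply: measurable_cos_comp; apply: measurable_funD => //; exact: measurable_lin.
have IE (d0 : measure_display) (T0 : measurableType d0) (P0 : probability T0 R) (W : T0 -> I -> R) :
    (forall i, measurable_fun setT (fun w => W w i)) ->
    \int[P0]_w h (W w) = \sum_(x <- s) x.1.1 * \int[P0]_w cos (lin x.1.2 (W w) + x.2).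
  move=> mW; under eq_Rintegral do rewrite E.
  rewrite Int_sum; last by move=> x; apply: itgZ; exact: itc.
  by apply: eq_bigr => x _; rewrite IntZ //; exact: itc.
have [l [h1 h2]] : exists l : R, \int[P]_w h (V M w) @[M --> \oo] --> l /\ \int[P']_w h (V' M w) @[M --> \oo] --> l.
  have -> : (fun M => \int[P]_w h (V M w)) = (fun M => \sum_(x <- s) x.1.1 * \int[P]_w cos (lin x.1.2 (V M w) + x.2)).
    by apply/funext => M; exact: (IE _ _ P (V M)).
  have -> : (fun M => \int[P']_w h (V' M w)) = (fun M => \sum_(x <- s) x.1.1 * \int[P']_w cos (lin x.1.2 (V' M w) + x.2)).
    by apply/funext => M; exact: (IE _ _ P' (V' M)).
  elim: s os {E IE} => [_|x s IH /= /andP[ox os]].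
    by exists 0; split; under eq_fun do rewrite big_nil; exact: cvg_cst.
  have [l [h1 h2]] := IH os; have [l0 [k1 k2]] := hV x.2 ox.
  exists (x.1.1 * l0 + l); split; under eq_fun do rewrite big_cons.
  - by apply: cvgD => //; apply: cvgM => //; exact: cvg_cst.
  - by apply: cvgD => //; apply: cvgM => //; exact: cvg_cst.
move=> e e0; have : (\int[P]_w h (V M w) - \int[P']_w h (V' M w)) @[M --> \oo] --> (0 : R).
  by rewrite -(subrr l); exact: cvgB.
by move=> /cvgr0Pnorm_le/(_ _ e0) [M0 _ hM]; exists M0.
Qed.

Lemma Int_unif (d0 : measure_display) (T0 : measurableType d0) (P0 : probability T0 R) (f g : T0 -> R) (e : R) :
  itg P0 f -> itg P0 g -> (forall w, `|f w - g w| <= e) -> `|\int[P0]_w f w - \int[P0]_w g w| <= e.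
Proof.
move=> fi gi fg; rewrite -IntB //; apply: le_trans (Int_bound (C := e) _ _ _) _.
- exact: (itg_meas (itgB fi gi)).
- exact: fg.
- by rewrite /tmass; have /= -> := @probability_setT _ _ _ P0; rewrite mulr1.
Qed.

Lemma agree_UTP h : UTP S h -> (forall M, measurable_fun setT (fun w => h (V M w))) ->
  (forall M, measurable_fun setT (fun w => h (V' M w))) -> agree h.
Proof.
move=> [[K K0 hK] ah] m m' e e0; have e3 : 0 < e / 3 by rewrite divr_gt0.
have [g Tg hg] := ah _ e3; have [M0 hM] := agree_TP Tg e3; have [K' K0' hK'] := TP_bnd Tg.
exists M0 => M MM; have k := hM M MM.
have k1 : `|\int[P]_w h (V M w) - \int[P]_w g (V M w)| <= e / 3.
  apply: Int_unif => // [|].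
    by apply: (@itg_bounded _ _ _ P _ K).
  by apply: (@itg_bounded _ _ _ P _ K') => //; exact: measurable_TP Tg _.
have k2 : `|\int[P']_w h (V' M w) - \int[P']_w g (V' M w)| <= e / 3.
  apply: Int_unif => // [|].
    by apply: (@itg_bounded _ _ _ P' _ K).
  by apply: (@itg_bounded _ _ _ P' _ K') => //; exact: measurable_TP Tg _.
rewrite distrC in k2; apply: le_trans (ler_dist3 k1 k k2) _.
by rewrite le_eqVlt; apply/orP; left; apply/eqP; field.
Qed.

Hypothesis tV : forall i, i \in S -> forall e : R, 0 < e -> exists Q M0, 0 < Q /\ forall M, (M0 <= M)%N ->
  whp P e (fun w => `|V M w i| <= Q).
Hypothesis tV' : forall i, i \in S -> forall e : R, 0 < e -> exists Q M0, 0 < Q /\ forall M, (M0 <= M)%N ->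
  whp P' e (fun w => `|V' M w i| <= Q).

Lemma tight_all (d0 : measure_display) (T0 : measurableType d0) (P0 : probability T0 R) (W : nat -> T0 -> I -> R) (s : seq I) :
  (forall i, i \in s -> forall e : R, 0 < e -> exists Q M0, 0 < Q /\ forall M, (M0 <= M)%N ->
    whp P0 e (fun w => `|W M w i| <= Q)) ->
  forall e : R, 0 < e -> exists Q M0, 0 < Q /\ forall M, (M0 <= M)%N ->
    whp P0 e (fun w => forall i, i \in s -> `|W M w i| <= Q).
Proof.
elim: s => [|i s IH] hs e e0; first by exists 1, 0%N; split=> // M _; apply: whp_true (ltW e0) _.
have e2 : 0 < e / 2 by rewrite divr_gt0.
have [Q1 [M1 [Q10 h1]]] := hs i (mem_head _ _) _ e2.
have [|Q2 [M2 [Q20 h2]]] := IH _ _ e2.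
  by move=> j js; apply: hs; rewrite inE js orbT.
exists (Q1 + Q2), (maxn M1 M2); split; first by rewrite addr_gt0.
move=> M; rewrite geq_max => /andP[m1 m2]; have := whp_and (h1 M m1) (h2 M m2).
rewrite -splitr; apply: whp_imp => w [k1 k2] j; rewrite inE => /predU1P[->|js].
  by apply: le_trans k1 _; rewrite lerDl ltW.
by apply: le_trans (k2 j js) _; rewrite lerDr ltW.
Qed.

(** Damping turns the cosine into an almost periodic function. It is accurate only on bounded sets,
    so tightness of both sequences is needed. *)
Lemma agree_cos_dampable g b : dampable S g -> (forall M, measurable_fun setT (fun w => g (V M w))) ->
  (forall M, measurable_fun setT (fun w => g (V' M w))) -> agree (fun v => cos (g v + b)).
Proof.
move=> [ga gb gc] m m' e e0.
(* The errors add up to 3 e1 + e1 + 3 e1. *)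
pose e1 := e / 9; have e10 : 0 < e1 by rewrite divr_gt0.
have [Q [M1 [Q0 h1]]] := tight_all tV e10; have [Q' [M1' [Q0' h1']]] := tight_all tV' e10.
have Q2 : 0 < Q + Q' by rewrite addr_gt0.
have [n hn] := gb _ _ Q2 e10.
pose gn v := g (fun i => damp n (v i)).
have Ug : UTP S (fun v => cos (gn v + b)).
  apply: (@UTP_lip _ _ S gn (fun x => cos (x + b)) 1 (ga n)) => // x y.
  rewrite mul1r; apply: le_trans (cos_lip _ _) _.
  by have -> : x + b - (y + b) = x - y by ring.
have mgn (d0 : measure_display) (T0 : measurableType d0) (W : T0 -> I -> R) :
    (forall i, measurable_fun setT (fun w => W w i)) -> measurable_fun setT (fun w => cos (gn (W w) + b)).
  move=> mW; apply: measurable_cos_comp; apply: measurable_funD => //; exact: measurable_TP (ga n) mW.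
have [M2 h2] := agree_UTP Ug (fun M => mgn _ _ _ (mV M)) (fun M => mgn _ _ _ (mV' M)) e10.
exists (maxn M1 (maxn M1' M2)) => M; rewrite !geq_max => /andP[m1 /andP[m1' m2]].
have k := h2 M m2.
have close v : (forall i, i \in S -> `|v i| <= Q + Q') -> `|cos (g v + b) - cos (gn v + b)| <= e1.
  move=> hv; apply: le_trans (cos_lip _ _) _.
  by have -> : g v + b - (gn v + b) = g v - gn v by [ring|]; exact: hn.
have k1 : `|\int[P]_w cos (g (V M w) + b) - \int[P]_w cos (gn (V M w) + b)| <= e1 + 2 * e1.
  apply: Ex_close; rewrite ?(ltW e10) //.
  - by apply: measurable_cos_comp; exact: measurable_funD.
  - exact: mgn.
  - by move=> w; exact: cos_abs_le1.
  - by move=> w; exact: cos_abs_le1.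
  - apply: whp_imp (h1 M m1) => w hw; apply: close => i iS; apply: le_trans (hw i iS) _.
    by rewrite lerDl ltW.
have k2 : `|\int[P']_w cos (g (V' M w) + b) - \int[P']_w cos (gn (V' M w) + b)| <= e1 + 2 * e1.
  apply: Ex_close; rewrite ?(ltW e10) //.
  - by apply: measurable_cos_comp; exact: measurable_funD.
  - exact: mgn.
  - by move=> w; exact: cos_abs_le1.
  - by move=> w; exact: cos_abs_le1.
  - apply: whp_imp (h1' M m1') => w hw; apply: close => i iS; apply: le_trans (hw i iS) _.
    by rewrite lerDr ltW.
rewrite distrC in k2; apply: le_trans (ler_dist3 k1 k k2) _.
rewrite /e1 -subr_ge0; have -> : e - (e / 9 + 2 * (e / 9) + e / 9 + (e / 9 + 2 * (e / 9))) = 2 * (e / 9) by field.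
by rewrite mulr_ge0 // divr_ge0 // ltW.
Qed.

End Sequences.

Section Orthants.
Variables (V : T -> I -> R) (V' : T' -> I -> R).
Hypothesis mV : forall i, measurable_fun setT (fun w => V w i).
Hypothesis mV' : forall i, measurable_fun setT (fun w => V' w i).
Hypothesis hV : forall t b, okt S t -> \int[P]_w cos (lin t (V w) + b) = \int[P']_w cos (lin t (V' w) + b).
Variable a : I -> R.

(** The sequential statement applied to constant sequences. *)
Lemma Int_UTP_eq h : UTP S h -> measurable_fun setT (fun w => h (V w)) ->
  measurable_fun setT (fun w => h (V' w)) -> \int[P]_w h (V w) = \int[P']_w h (V' w).
Proof.
move=> Uh m m'; apply/eqP; rewrite -subr_eq0 -normr_le0; apply/ler_addgt0Pr => e e0; rewrite add0r.
have [|M0 /(_ M0 (leqnn _))] := @agree_UTP (fun=> V) (fun=> V') (fun=> mV) (fun=> mV') _ h Uh (fun=> m) (fun=> m') e e0; last by [].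
by move=> t b ot; exists (\int[P]_w cos (lin t (V w) + b)); split; last rewrite hV //; exact: cvg_cst.
Qed.

(** A continuous indicator of x <= a i. The damping index tends to infinity first, at fixed [r];
    then [r] does, and the exact orthant is recovered. *)
Let psi (r : nat) (i : I) (x : R) : R := 1 - ramp (a i) r.+1%:R^-1 x.

Let psi01 r i x : 0 <= psi r i x <= 1.
Proof. by rewrite /psi subr_ge0 ramp_le1 /= gerBl ramp_ge0. Qed.

Let psi_lip r i x y : `|psi r i x - psi r i y| <= r.+1%:R * `|x - y|.
Proof.
rewrite /psi; have -> : 1 - ramp (a i) r.+1%:R^-1 x - (1 - ramp (a i) r.+1%:R^-1 y) =
  - (ramp (a i) r.+1%:R^-1 x - ramp (a i) r.+1%:R^-1 y) by ring.
by rewrite normrN -[X in X * _]invrK; apply: ramp_lip; rewrite invr_gt0.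
Qed.

Let psi_cont r i : continuous (psi r i).
Proof.
move=> x; apply/cvgrPdist_le => e e0; near=> y.
apply: le_trans (psi_lip r i x y) _; rewrite -ler_pdivlMl //.
near: y; apply: cvgr_dist_le; first exact: cvg_id.
by rewrite mulr_gt0 // invr_gt0.
Unshelve. all: by end_near. Qed.

Let mpsi r i (d0 : measure_display) (T0 : measurableType d0) (f : T0 -> R) :
  measurable_fun setT f -> measurable_fun setT (fun w => psi r i (f w)).
Proof.
move=> mf; apply: (measurableT_comp (f := psi r i)) => //; apply: continuous_measurable_fun.
exact: psi_cont.
Qed.

Let prod01 (s : seq I) (g : I -> R) : (forall i, 0 <= g i <= 1) -> `|\prod_(i <- s) g i| <= 1.
Proof.
move=> h; rewrite normr_prod; elim: s => [|i s IH]; first by rewrite big_nil.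
rewrite big_cons; have n1 : `|g i| <= 1 by case/andP: (h i) => h0 h1; rewrite ger0_norm.
by apply: mulr_ile1 => //; exact: prodr_ge0.
Qed.

Let mprod (d0 : measure_display) (T0 : measurableType d0) (s : seq I) (g : I -> T0 -> R) :
  (forall i, measurable_fun setT (g i)) -> measurable_fun setT (fun w => \prod_(i <- s) g i w).
Proof.
move=> mg; elim: s => [|i s IH]; first by under eq_fun do rewrite big_nil; exact: measurable_cst.
by under eq_fun do rewrite big_cons; exact: measurable_funM.
Qed.

Let damped_eq r n : \int[P]_w (\prod_(i <- S) psi r i (damp n (V w i))) =
  \int[P']_w (\prod_(i <- S) psi r i (damp n (V' w i))).
Proof.
apply: (@Int_UTP_eq (fun v => \prod_(i <- S) psi r i (damp n (v i)))).
- apply: (@UTP_prod _ _ S S (fun i v => psi r i (damp n (v i)))) => i iS.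
  by apply: (@UTP_lip _ _ S (fun v => damp n (v i)) (psi r i) r.+1%:R) => //; exact: TP_damp.
- by apply: mprod => i; apply: mpsi; exact: measurable_damp.
- by apply: mprod => i; apply: mpsi; exact: measurable_damp.
Qed.

Let damped_cvg (d0 : measure_display) (T0 : measurableType d0) (P0 : probability T0 R) (W : T0 -> I -> R) r :
  (forall i, measurable_fun setT (fun w => W w i)) ->
  \int[P0]_w (\prod_(i <- S) psi r i (damp n (W w i))) @[n --> \oo] --> \int[P0]_w (\prod_(i <- S) psi r i (W w i)).
Proof.
move=> mW; apply: (@Int_dct _ _ _ P0 _ _ 1).
- by move=> n; apply: mprod => i; apply: mpsi; exact: measurable_damp.
- by move=> n w; exact: prod01.
- move=> w; apply: (cvg_big mul_continuous) => i _.
  by apply: (cvg_comp (fun n => damp n (W w i)) (psi r i)); [exact: damp_cvg|exact: psi_cont].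
Qed.

Let soft_eq r : \int[P]_w (\prod_(i <- S) psi r i (V w i)) = \int[P']_w (\prod_(i <- S) psi r i (V' w i)).
Proof.
have c1 := @damped_cvg _ _ P V r mV.
have c2 := @damped_cvg _ _ P' V' r mV'.
move: c1; under eq_fun do rewrite damped_eq.
by move=> c1; exact: (cvg_unique _ c1 c2).
Qed.

Let hard_cvg (d0 : measure_display) (T0 : measurableType d0) (P0 : probability T0 R) (W : T0 -> I -> R) :
  (forall i, measurable_fun setT (fun w => W w i)) ->
  \int[P0]_w (\prod_(i <- S) psi r i (W w i)) @[r --> \oo] -->
  fine (P0 [set w | forall i, i \in S -> W w i <= a i]).
Proof.
move=> mW.
have mE := measurable_orthant S a mW.
rewrite -Int_indic //; apply: (@Int_dct _ _ _ P0 _ _ 1).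
- by move=> r; apply: mprod => i; exact: mpsi.
- by move=> r w; exact: prod01.
- move=> w.
  have -> : \1_[set w | forall i, i \in S -> W w i <= a i] w = \prod_(i <- S) (W w i <= a i)%R%:R :> R.
    rewrite indicE; case: (boolP (w \in _)).
      by rewrite inE /= => h; rewrite big1_seq // => i /andP[_ /h ->].
    rewrite notin_setE /= => h.
    have [i iS hi] : exists2 i, i \in S & ~~ (W w i <= a i).
      by apply: contrapT => h2; apply: h => i iS; apply/negPn/negP => h3; apply: h2; exists i.
    by rewrite (big_rem i) //= (negbTE hi) mul0r.
  apply: (cvg_big mul_continuous) => i _; rewrite /psi.
  have r0 (r : nat) : 0 < r.+1%:R^-1 :> R by rewrite invr_gt0.
  case: (leP (W w i) (a i)) => h /=.
    by under eq_fun do rewrite (ramp0 (r0 _) h) subr0; exact: cvg_cst.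
  have dd : 0 < W w i - a i by rewrite subr_gt0.
  apply: cvg_near_cst; exists (Num.truncn (W w i - a i)^-1) => // r /= hr.
  rewrite (ramp1 (r0 r)) ?subrr // -lerBrDl invf_ple ?posrE //.
  by apply: le_trans (ltW (truncnS_gt _)) _; rewrite ler_nat ltnS.
Qed.

Lemma orthant_eq : P [set w | forall i, i \in S -> V w i <= a i] = P' [set w | forall i, i \in S -> V' w i <= a i].
Proof.
have c1 := @hard_cvg _ _ P V mV; have c2 := @hard_cvg _ _ P' V' mV'.
move: c1; under eq_fun do rewrite soft_eq.
move=> c1; have E : fine (P [set w | forall i, i \in S -> V w i <= a i]) = fine (P' [set w | forall i, i \in S -> V' w i <= a i]).
  exact: (cvg_unique _ c1 c2).
rewrite -(fineK (fin_num_measure P _ (measurable_orthant S a mV))).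
by rewrite -(fineK (fin_num_measure P' _ (measurable_orthant S a mV'))) E.
Qed.

End Orthants.

End CompareLaws.

(** * The law of the limit *)

Section LimitVersion.
Context {R : realType} d (T : measurableType d) (P : probability T R).
Variable X : int -> int -> T -> R.
Variables nu nac nd : {measure set (R * R)%type -> \bar R}.
Hypothesis H : thm_hyps P X nu nac nd.

Let gX : centered_gaussian P X := H.1.

(** Square summability at every point makes linear statistics defined everywhere, without
    exceptional sets. *)
Definition limit_version (xi : T -> @pmseq R) := [/\ forall s j, measurable_fun setT (fun w => side s (xi w) j),
  forall w, exists C, l2pm C (xi w) &
  forall e : R, 0 < e -> exists N0, forall N, (N0 <= N)%N ->
    whp P e (fun w => forall s j, `|side s (EM (WA X N w)) j - side s (xi w) j| <= e)].

Lemma measurable_side_rand (xi : T -> @pmseq R) : random_pm_C2 P xi ->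
  forall s j, measurable_fun setT (fun w => side s (xi w) j).
Proof.
move=> [m _] [|] j; have [m1 m2] := m j; first exact: m1.
by apply: (measurableT_comp (f := fun x : R => - x)) => //; exact: measurable_funN.
Qed.

(** On the exceptional null set the measure is replaced by the one without nonzero points. *)
Lemma good_version (xi : T -> @pmseq R) : random_pm_C2 P xi -> EM_conv_prob P X xi ->
  exists xi0, limit_version xi0 /\ exists N, [/\ measurable N, P N = 0%E & forall w, ~ N w -> xi0 w = xi w].
Proof.
move=> rxi cxi; have mxi := measurable_side_rand rxi.
have [_ [N [mN PN hN]]] := rxi.
pose xi0 w : @pmseq R := if pselect (N w) then (fun=> 0, fun=> 0) else xi w.
have x0 w : ~ N w -> xi0 w = xi w by rewrite /xi0; case: pselect.
exists xi0; split; last by exists N.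
have hs s j w : side s (xi0 w) j = \1_(~` N) w * side s (xi w) j.
  rewrite /xi0 indicE; case: pselect => Nw.
    by rewrite memNset ?mul0r; [case: s => //=; rewrite oppr0|move=> /(_ Nw)].
  by rewrite mem_set // mul1r.
split.
- move=> s j; under eq_fun do rewrite hs.
  by apply: measurable_funM => //; apply: measurable_indic; exact: measurableC.
- move=> w; rewrite /xi0; case: pselect => Nw.
    exists 0; split; first by split=> j /=; rewrite lexx.
    by move=> J; rewrite /pL big1 // => i _; rewrite expr0n addr0.
  by apply: in_C2_l2pm; apply: contrapT => h; apply: Nw; exact: hN.
- move=> e e0.
  have mS M : measurable [set w | (e%:E < dist_p 4 (EM (WA X M w)) (xi w))%E].
    apply: measurable_dist_gt => // s j; apply: measurable_side_EM; last exact: WA_sym.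
    exact: (measurable_WA H).
  have /fine_cvgP[_ /cvgr0Pnorm_le/(_ _ e0) [N0 _ h]] := cxi e e0.
  exists N0 => M NM.
  have PS : (P [set w | (e%:E < dist_p 4 (EM (WA X M w)) (xi w))%E] <= e%:E)%E.
    have := h M NM; rewrite /= ger0_norm ?fine_ge0 // => h1.
    by rewrite -[X in (X <= _)%E](fineK (fin_num_measure P _ (mS M))) lee_fin.
  have wN : whp P 0 (fun w => ~ N w) by exists N; split=> //; rewrite PN.
  have := whp_and (whp_of_P (mS M) PS) wN; rewrite addr0; apply: whp_imp => w [/= k1 k2] s j.
  rewrite x0 //; apply: dist4_side; first exact: ltW.
  by rewrite leNgt; apply/negP.
Qed.

Variable xi : T -> @pmseq R.
Hypothesis hxi : limit_version xi.

Lemma limit_version_canonical w : canonical_pm (xi w).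
Proof. by have [_ /(_ w)[C []]] := hxi. Qed.

Lemma limit_version_tight (e : R) : 0 < e -> exists C, 0 < C /\ whp P e (fun w => l2pm C (xi w)).
Proof.
have [m _ c] := hxi; move: e; apply: (tight_limit (@WA_sym _ _ _ X) (fro_tight H) m limit_version_canonical).
move=> s j e e0; have [N0 h] := c e e0; exists N0 => N NN.
by apply: whp_imp (h N NN) => w; apply.
Qed.

Lemma vanish0_continuous t l (f : R -> R) : vanish0 t l f -> continuous f.
Proof.
move=> [_ l0 _ fl] x; apply/cvgrPdist_le => e e0.
have l1 : 0 < l + 1 by rewrite ltr_wpDl.
near=> y.
apply: le_trans (fl x y) _; apply: (@le_trans _ _ ((l + 1) * `|x - y|)).
  by rewrite ler_wpM2r // lerDl.
rewrite -ler_pdivlMl //; near: y; apply: cvgr_dist_le; first exact: cvg_id.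
by rewrite mulr_gt0 // invr_gt0.
Unshelve. all: by end_near. Qed.

Lemma measurable_lstat t l f : vanish0 t l f -> measurable_fun setT (fun w => lstat f (xi w)).
Proof.
move=> vf; have [m lx _] := hxi.
have mf : measurable_fun setT f by apply: continuous_measurable_fun; exact: vanish0_continuous vf.
apply: (@measurable_fun_cvg _ _ _ _ (fun J w => pL f (xi w) J)); last first.
  by move=> w _; have [C hC] := lx w; exact: lstat_cvg vf hC.
move=> J; apply: measurable_sum => j; apply: measurable_funD; apply: (measurableT_comp (f := f)) => //.
  exact: (m true j).
have -> : (fun w => (xi w).2 j) = (fun w => - side false (xi w) j) by apply/funext => w /=; rewrite opprK.
by apply: (measurableT_comp (f := fun x : R => - x)) => //; exact: measurable_funN.
Qed.

Definition Tq (q : {poly R}) F (u : R * R -> bool -> R) : R := \sum_(k < size q) q`_k * Tk F u k.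

Lemma ex_uniform_pos (Q : nat -> R -> Prop) :
  (forall k e e', e' <= e -> Q k e -> Q k e') -> (forall k, exists dl, 0 < dl /\ Q k dl) ->
  forall K, exists dl, 0 < dl /\ forall k, (k < K)%N -> Q k dl.
Proof.
move=> mono h; elim=> [|K [d1 [d10 IH]]]; first by exists 1.
have [d2 [d20 h2]] := h K; exists (Num.min d1 d2); split; first by rewrite lt_min d10.
move=> k; rewrite ltnS leq_eqVlt => /predU1P[->|kK].
  by apply: mono h2; rewrite ge_min lexx orbT.
by apply: mono (IH k kK); rewrite ge_min lexx.
Qed.

(** [C1] is announced before [C] and [q], so that two processes can be treated with one common
    polynomial. The three errors are those of the limit, of the polynomial and of the traces. *)
Lemma stat_approx t l f (e : R) : vanish0 t l f -> 0 < e -> exists C1, 0 < C1 /\ forall C, C1 <= C ->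
  forall q : {poly R}, (forall k, (k < 4)%N -> q`_k = 0) ->
  (forall n (A : 'M[R]_n), A^T = A -> fro A <= C -> `|lstat f (EM A) - ptr q A| <= e) ->
  exists dl, 0 < dl /\ forall F, goodF F -> (nd (~` [set z | z \in F]) <= dl%:E)%E ->
  exists M0, forall M, (M0 <= M)%N -> whp P e (fun w => `|lstat f (xi w) - Tq q F (U X M w)| <= 3 * e).
Proof.
move=> vf e0; have e4 : 0 < e / 4 by rewrite divr_gt0.
have [C1 [C10 hC1]] := fro_tight H e4; have [C2 [C20 hC2]] := limit_version_tight e4.
exists (Num.max C1 C2); split; first by rewrite lt_max C10.
move=> C; rewrite ge_max => /andP[CC1 CC2] q q4 hq.
have C0 : 0 < C by exact: lt_le_trans C10 CC1.
pose S := \sum_(k < size q) `|q`_k|; have S0 : 0 <= S by exact: sumr_ge0.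
(* Keeps the trace events within probability e / 4 and the weighted trace errors within [e]. *)
pose e2 := Num.min (e / 4 / (size q).+1%:R) (e / (S + 1)).
have S1 : 0 < S + 1 by rewrite ltr_wpDl.
have e20 : 0 < e2 by rewrite lt_min !divr_gt0.
pose Q k (F : seq (R * R)) N M := whp P e2 (fun w => `|\tr (WA X N w ^+ k) - Tk F (U X M w) k| <= e2).
have [dl [dl0 hdl]] : exists dl, 0 < dl /\ forall k, (k < size q)%N -> (2 < k)%N ->
    forall F, goodF F -> (nd (~` [set z | z \in F]) <= dl%:E)%E ->
    exists M0, forall M, (M0 <= M)%N -> exists N0, forall N, (N0 <= N)%N -> Q k F N M.
  apply: (@ex_uniform_pos (fun k dl => (2 < k)%N -> forall F, goodF F -> (nd (~` [set z | z \in F]) <= dl%:E)%E ->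
    exists M0, forall M, (M0 <= M)%N -> exists N0, forall N, (N0 <= N)%N -> Q k F N M)).
    by move=> k a b ba h k2 F gF hF; apply: h => //; apply: le_trans hF _; rewrite lee_fin.
  move=> k; case: (ltnP 2 k) => k2; last by exists 1.
  by have [dl [dl0 h]] := trace_approx H k2 e20; exists dl.
exists dl; split=> // F gF hF.
have [M0 hM0] : exists M0, forall k M, (k < size q)%N -> (M0 <= M)%N -> (2 < k < size q)%N ->
    exists N0, forall N, (N0 <= N)%N -> Q k F N M.
  apply: (@ex_uniform (fun k M => (2 < k < size q)%N -> exists N0, forall N, (N0 <= N)%N -> Q k F N M)) => k.
  case: (boolP (2 < k < size q)%N) => [/andP[k2 kq]|_]; last by exists 0%N.
  by have [M0 h] := hdl k kq k2 F gF hF; exists M0 => M MM _; exact: h.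
exists M0 => M MM.
have [N1 hN1] : exists N0, forall k N, (k < size q)%N -> (N0 <= N)%N -> (2 < k < size q)%N -> Q k F N M.
  apply: (@ex_uniform (fun k N => (2 < k < size q)%N -> Q k F N M)) => k.
  case: (boolP (2 < k < size q)%N) => [/andP[k2 kq]|_]; last by exists 0%N.
  have [|N0 h] := hM0 k M kq MM; first by rewrite k2.
  by exists N0 => N NN _; exact: h.
have [t0 l0 _ _] := vf.
pose L := l / t ^+ 2 * (2 * C); have L0 : 0 <= L by rewrite mulr_ge0 ?divr_ge0 ?sqr_ge0 // mulr_ge0 // ltW.
pose eta := Num.min (e / 4) (e / (L + 1)).
have L1 : 0 < L + 1 by rewrite ltr_wpDl.
have eta0 : 0 < eta by rewrite lt_min e4 divr_gt0.
have [_ _ cx] := hxi; have [N2 hN2] := cx eta eta0.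
pose N := maxn 1 (maxn N1 N2).
have NN1 : (N1 <= N)%N by rewrite /N !leq_max leqnn orbT.
have NN2 : (N2 <= N)%N by rewrite /N !leq_max leqnn !orbT.
have w3 : whp P (e / 4) (fun w => forall s j, `|side s (EM (WA X N w)) j - side s (xi w) j| <= eta).
  by apply: whp_le (hN2 N NN2); rewrite ge_min lexx.
have wk : whp P ((size (iota 0 (size q)))%:R * e2) (fun w => forall k, k \in iota 0 (size q) -> (2 < k)%N ->
    `|\tr (WA X N w ^+ k) - Tk F (U X M w) k| <= e2).
  apply: whp_all; first exact: ltW.
  move=> k; rewrite mem_iota add0n /= => kq; case: (ltnP 2 k) => k2; last exact: whp_true (ltW e20) _.
  by have := hN1 k N kq NN1; rewrite k2 kq => /(_ isT); apply: whp_imp.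
have := whp_and (whp_and (hC1 N (leq_maxl _ _)) hC2) (whp_and w3 wk).
move=> /whp_le => /(_ e) h.
have le1 : e / 4 + e / 4 + (e / 4 + (size (iota 0 (size q)))%:R * e2) <= e.
  rewrite size_iota.
  have : (size q)%:R * e2 <= e / 4.
    apply: (@le_trans _ _ ((size q).+1%:R * (e / 4 / (size q).+1%:R))).
      by apply: ler_pM; [by []|exact: ltW|by rewrite ler_nat|rewrite ge_min lexx].
    by rewrite mulrCA mulfV ?mulr1 ?pnatr_eq0.
  lra.
move: le1 => /h; apply: whp_imp => w [[f1 f2] [hs hk]].
have sA := WA_sym X N w.
have a1 : `|lstat f (EM (WA X N w)) - lstat f (xi w)| <= e.
  apply: le_trans (lstat_lip vf (l2pm_EM sA (le_trans f1 CC1)) (l2pm_le CC2 f2) hs) _.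
  have -> : l / t ^+ 2 * eta * (2 * C) = eta * L by rewrite /L; ring.
  apply: (@le_trans _ _ (e / (L + 1) * (L + 1))); last by rewrite mulfVK // gt_eqF.
  apply: ler_pM => //; [exact: ltW|by rewrite ge_min lexx orbT|by rewrite lerDl].
have a2 := hq _ _ sA (le_trans f1 CC1).
have a3 : `|ptr q (WA X N w) - Tq q F (U X M w)| <= e.
  rewrite /ptr /Tq -sumrB; apply: le_trans (ler_norm_sum _ _ _) _.
  apply: (@le_trans _ _ (\sum_(k < size q) `|q`_k| * e2)).
    apply: ler_sum => k _; rewrite -mulrBr normrM.
    case: (ltnP 2 k) => k2; last by rewrite q4 ?normr0 ?mul0r //; exact: leq_ltn_trans k2 _.
    by rewrite ler_wpM2l //; apply: hk => //; rewrite mem_iota /=.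
  rewrite -mulr_suml -/S; apply: (@le_trans _ _ ((S + 1) * (e / (S + 1)))).
    by apply: ler_pM; [by []|exact: ltW|rewrite lerDl|rewrite ge_min lexx orbT].
  by rewrite mulrCA mulfV ?mulr1 // gt_eqF.
rewrite distrC in a1; apply: le_trans (ler_dist3 a1 a2 a3) _.
by rewrite le_eqVlt; apply/orP; left; apply/eqP; ring.
Qed.

Lemma measurable_Tq q F M : measurable_fun setT (fun w => Tq q F (U X M w)).
Proof. by apply: measurable_sum => k; apply: measurable_funM => //; exact: (measurable_Tk gX). Qed.

(** Markov for the second moment, which converges to a finite limiting variance. *)
Lemma U_tight F n b : goodF F -> n \in F -> forall e : R, 0 < e -> exists Q M0, 0 < Q /\ forall M, (M0 <= M)%N ->
  whp P e (fun w => `|U X M w n b| <= Q).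
Proof.
move=> gF nF e e0.
have tF p : p \in [:: (1 : R, (n, b))] -> p.2.1 \in F by rewrite inE => /eqP ->.
have /cvgrPdist_le/(_ _ ltr01) [M0 _ hM] := cov_Ucomb_cvg H gF tF.
set L := vlim nd F _ in hM.
have aL : 0 < `|L| + 1 by rewrite ltr_wpDl.
pose a := (`|L| + 1) / e; have a0 : 0 < a by rewrite divr_gt0.
exists (a + 1), M0; split; first by rewrite addr_gt0.
move=> M MM; have := hM M MM; rewrite /= distrC => hc.
have E w : lincomb X (Ucomb M [:: (1, (n, b))]) w = U X M w n b.
  by rewrite lincomb_Ucomb big_seq1 mul1r.
have w1 : whp P e (fun w => lincomb X (Ucomb M [:: (1, (n, b))]) w ^+ 2 <= a).
  apply: whp_markov => //.
  - exact: (lincomb_itg2 gX).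
  - by move=> w; exact: sqr_ge0.
  - rewrite cov_sqr /a mulfVK ?gt_eqF //; have := ler_norm L; move: hc; rewrite ler_norml => /andP[_].
    set c := cov _ _ _ _; lra.
apply: whp_imp w1 => w; rewrite E => h.
rewrite -ler_sqr ?nnegrE ?addr_ge0 ?(ltW a0) // real_normK ?num_real //; apply: le_trans h _.
by rewrite -subr_ge0; have -> : (a + 1) ^+ 2 - a = a ^+ 2 + a + 1 by [ring|]; rewrite !addr_ge0 ?sqr_ge0 ?(ltW a0).
Qed.

End LimitVersion.

(** * Limiting traces as polynomials in the Fourier coefficients *)

Section DampableTraces.
Context {R : realType} (F : seq (R * R)).

Definition uidx : seq ((R * R) * bool) := [seq (n, b) | n <- F, b <- [:: false; true]].

Lemma row_idx (r : 'I_(size (rows F))) : (row r).1.2 \in uidx.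
Proof.
have /flattenP[l /mapP[n nF ->]] : row r \in rows F by exact: mem_nth.
rewrite !inE => h; apply/allpairsP; exists (row r).1.2 => /=; split; last by case: (_.1.2).
  by move: h; do 7?[case/orP]; move=> /eqP ->.
by rewrite !inE; case: (_.1.2.2).
Qed.

Lemma dampable_Gam k (r r' : 'I_(size (rows F))) :
  dampable uidx (fun v => (Gam F (fun n b => v (n, b)) ^+ k) r r').
Proof.
elim: k r r' => [|k IH] r r'.
  by apply: dampable_ext (dampable_cst uidx ((1 : 'M[R]_(size (rows F))) r r')) => v; rewrite expr0.
apply: (@dampable_ext _ _ uidx (fun v => \sum_l Gam F (fun n b => v (n, b)) r l * (Gam F (fun n b => v (n, b)) ^+ k) l r')).
  by move=> v; rewrite exprS -mulmxE mxE.
apply: dampable_sum => l; apply: dampable_M; last exact: IH.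
set c := (2^-1 * (avl ((row r).1.1.2.1 - (row l).1.1.1.1) (ph (row r).1.1.2.2 - ph (row l).1.1.1.2) +
   avl ((row r).1.1.2.1 + (row l).1.1.1.1) (ph (row r).1.1.2.2 + ph (row l).1.1.1.2))).
apply: (@dampable_ext _ _ uidx (fun v => ((row l).2 * v (row l).1.2) * c)).
  by move=> v; rewrite mxE /cf -surjective_pairing.
apply: dampable_M; last exact: dampable_cst.
by apply: dampable_M; [exact: dampable_cst|apply: dampable_coord; exact: row_idx].
Qed.

Lemma dampable_Tq (q : {poly R}) : dampable uidx (fun v => Tq q F (fun n b => v (n, b))).
Proof.
apply: dampable_sum => k; apply: dampable_M; first exact: dampable_cst.
by apply: dampable_sum => r; exact: dampable_Gam.
Qed.

End DampableTraces.

(** * Recovering the entries from linear statistics *)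

Section LstatLinear.
Context {R : realType}.

Lemma lstat_lin C t l f t' l' f' (a : R) xi : vanish0 t l f -> vanish0 t' l' f' -> l2pm C xi ->
  lstat (fun x => a * f x + f' x) xi = a * lstat f xi + lstat f' xi.
Proof.
move=> vf vf' hx; have c1 := lstat_cvg vf hx; have c2 := lstat_cvg vf' hx.
have c3 := lstat_cvg (vanish0_lin a vf vf') hx.
have c4 : pL (fun x => a * f x + f' x) xi J @[J --> \oo] --> a * lstat f xi + lstat f' xi.
  have -> : pL (fun x => a * f x + f' x) xi = (fun J => a * pL f xi J + pL f' xi J).
    apply/funext => J; rewrite /pL mulr_sumr -big_split /=; apply: eq_bigr => j _; ring.
  by apply: cvgD => //; apply: cvgM => //; exact: cvg_cst.
exact: (cvg_unique _ c3 c4).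
Qed.

Lemma lstat_0 C (xi : @pmseq R) : l2pm C xi -> lstat (fun=> 0) xi = 0.
Proof.
move=> hx; have c := lstat_cvg vanish0_0 hx.
have c0 : pL (fun=> 0 : R) xi J @[J --> \oo] --> (0 : R).
  have -> : pL (fun=> 0 : R) xi = (fun=> 0) by apply/funext => J; rewrite /pL big1 // => j _; rewrite addr0.
  exact: cvg_cst.
exact: (cvg_unique _ c c0).
Qed.

(** A linear combination of statistics is the statistic of one function. As in the Cramer-Wold
    device, one-dimensional information thus yields joint laws. *)
Lemma lstat_combination (I : Type) (phi : I -> R -> R) (t : seq (R * I)) :
  (forall i, exists t0 l0, vanish0 t0 l0 (phi i)) ->
  exists t0 l0 f, vanish0 t0 l0 f /\ forall C xi, l2pm C xi ->
    lstat f xi = \sum_(p <- t) p.1 * lstat (phi p.2) xi.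
Proof.
move=> vphi; elim: t => [|p t [t1 [l1 [f1 [v1 E1]]]]].
  exists 1, 0, (fun=> 0); split; first exact: vanish0_0.
  by move=> C xi hx; rewrite big_nil (lstat_0 hx).
have [t2 [l2 v2]] := vphi p.2.
exists (Num.min t2 t1), (`|p.1| * l2 + l1), (fun x => p.1 * phi p.2 x + f1 x); split.
  exact: vanish0_lin.
by move=> C xi hx; rewrite (lstat_lin _ v2 v1 hx) big_cons (E1 _ _ hx).
Qed.

(** The ramps start strictly above [t], because a threshold must be positive while [t] may be 0. *)
Lemma side_le_ramps C (xi : @pmseq R) j (t : R) : l2pm C xi -> 0 <= t ->
  (side true xi j <= t) <-> (forall m : nat,
    lstat (fun x => ramp (t + m.+1%:R^-1) m.+1%:R^-1 (sgnR true * x)) xi <= j%:R).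
Proof.
move=> hx t0; have m0 (m : nat) : 0 < m.+1%:R^-1 :> R by rewrite invr_gt0.
have tm0 (m : nat) : 0 < t + m.+1%:R^-1 by rewrite ltr_wpDl.
split=> [h m|h]; first by apply: lstat_ramp_le (tm0 m) (m0 m) hx _; apply: le_trans h _; rewrite lerDl ltW.
rewrite leNgt; apply/negP => lt; have d0 : 0 < side true xi j - t by rewrite subr_gt0.
pose m := Num.truncn (2 / (side true xi j - t)).
have hm : 2 * m.+1%:R^-1 <= side true xi j - t.
  rewrite ler_pdivrMr // mulrC -ler_pdivrMr //; exact/ltW/truncnS_gt.
have := h m; have : j.+1%:R <= lstat (fun x => ramp (t + m.+1%:R^-1) m.+1%:R^-1 (sgnR true * x)) xi.
  apply: lstat_ramp_ge (tm0 m) (m0 m) hx _.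
  have key (x y : R) : 2 * x <= y - t -> t + x + x <= y by move=> *; lra.
  exact: key hm.
by move=> h1 h2; have := le_trans h1 h2; rewrite ler_nat ltnn.
Qed.

(** Here each ramp ends exactly at [s]; the denominator [m.+2] keeps its start positive. *)
Lemma side_ge_ramps C (xi : @pmseq R) j (s : R) : l2pm C xi -> 0 < s ->
  (s <= side false xi j) <-> (forall m : nat,
    j.+1%:R <= lstat (fun x => ramp (s - s / m.+2%:R) (s / m.+2%:R) (sgnR false * x)) xi).
Proof.
move=> hx s0; have m0 (m : nat) : 0 < s / m.+2%:R by rewrite divr_gt0.
have tm0 (m : nat) : 0 < s - s / m.+2%:R.
  by rewrite subr_gt0 ltr_pdivrMr // ltr_pMr // ltr1n.
split=> [h m|h]; first by apply: lstat_ramp_ge (tm0 m) (m0 m) hx _; rewrite subrK.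
rewrite leNgt; apply/negP => lt; have d0 : 0 < s - side false xi j by rewrite subr_gt0.
pose m := Num.truncn (s / (s - side false xi j)).
have hm : s / m.+2%:R <= s - side false xi j.
  rewrite ler_pdivrMr // mulrC -ler_pdivrMr //; apply: le_trans (ltW (truncnS_gt _)) _.
  by rewrite ler_nat leqnSn.
have := h m; have : lstat (fun x => ramp (s - s / m.+2%:R) (s / m.+2%:R) (sgnR false * x)) xi <= j%:R.
  by apply: lstat_ramp_le (tm0 m) (m0 m) hx _; rewrite lerBrDr addrC -lerBrDr.
by move=> h1 h2; have := le_trans h2 h1; rewrite ler_nat ltnn.
Qed.

(* For i = ((j, side), (t, h)) the ramp statistic counts the entries of that side above t, so
   comparing it with rthr i locates entry j; the sign makes both comparisons upper bounds. *)
Definition rphi (i : ((nat * bool) * (R * R))%type) (x : R) : R :=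
  if (0 < i.2.1) && (0 < i.2.2) then sgnR i.1.2 * ramp i.2.1 i.2.2 (sgnR i.1.2 * x) else 0.
Definition rthr (i : ((nat * bool) * (R * R))%type) : R := if i.1.2 then i.1.1%:R else - i.1.1.+1%:R.

Lemma rphi_vanish0 i : exists t l, vanish0 t l (rphi i).
Proof.
case: (boolP ((0 < i.2.1) && (0 < i.2.2))) => [/andP[t0 h0]|/negbTE E]; last first.
  by exists 1, 0; rewrite (_ : rphi i = fun=> 0) ; [exact: vanish0_0|apply/funext => x; rewrite /rphi E].
have -> : rphi i = (fun x => sgnR i.1.2 * ramp i.2.1 i.2.2 (sgnR i.1.2 * x) + 0).
  by apply/funext => x; rewrite /rphi t0 h0 addr0.
have v := vanish0_lin (sgnR i.1.2) (vanish0_ramp i.1.2 t0 h0) (@vanish0_0 R).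
by exists (Num.min i.2.1 1), (`|sgnR i.1.2| * i.2.2^-1 + 0).
Qed.

Lemma lstat_rphi C (xi : @pmseq R) i : l2pm C xi -> 0 < i.2.1 -> 0 < i.2.2 ->
  lstat (rphi i) xi = sgnR i.1.2 * lstat (fun x => ramp i.2.1 i.2.2 (sgnR i.1.2 * x)) xi.
Proof.
move=> hx t0 h0.
have -> : rphi i = (fun x => sgnR i.1.2 * ramp i.2.1 i.2.2 (sgnR i.1.2 * x) + 0).
  by apply/funext => x; rewrite /rphi t0 h0 addr0.
rewrite (lstat_lin _ (vanish0_ramp i.1.2 t0 h0) vanish0_0 hx).
by rewrite (lstat_0 hx) addr0.
Qed.

Variables (n : nat) (t s : nat -> R).

(** For [s j >= 0] no ramp is listed, since the entry is nonpositive and the condition holds by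
    itself. *)
Definition rlist (m : nat) : seq ((nat * bool) * (R * R)) :=
  flatten [seq ((j, true), (t j + m'.+1%:R^-1, m'.+1%:R^-1)) ::
    (if s j < 0 then [:: ((j, false), (- s j - (- s j) / m'.+2%:R, - s j / m'.+2%:R))] else [::])
    | j <- iota 0 n, m' <- iota 0 m].

Lemma rlist_mem m i : i \in rlist m -> forall m', (m <= m')%N -> i \in rlist m'.
Proof.
move=> /flattenP[l /allpairsP[[j k] /= [jn km ->]] il] m' mm'.
apply/flattenP; eexists; last exact: il.
apply/allpairsP; exists (j, k) => /=; split=> //.
by move: km; rewrite !mem_iota !add0n /= => km; exact: leq_trans km mm'.
Qed.

Lemma rlist_event C (xi : @pmseq R) : l2pm C xi -> (forall j, (j < n)%N -> 0 <= t j) ->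
  (forall m i, i \in rlist m -> lstat (rphi i) xi <= rthr i) <->
  (forall j, (j < n)%N -> xi.1 j <= t j /\ xi.2 j <= s j).
Proof.
move=> hx t0; have [cx _] := hx; split=> [h j jn|h m i].
  have hmem (k : nat) : forall i, i \in (((j, true), (t j + k.+1%:R^-1, k.+1%:R^-1)) ::
    (if s j < 0 then [:: ((j, false), (- s j - (- s j) / k.+2%:R, - s j / k.+2%:R))] else [::])) -> i \in rlist k.+1.
    move=> i il; apply/flattenP; eexists; last exact: il.
    by apply/allpairsP; exists (j, k); split; [by rewrite mem_iota add0n|by rewrite mem_iota add0n /= ltnS|by []].
  split.
    apply/(side_le_ramps j hx (t0 j jn)) => k.
    have := h k.+1 _ (hmem k _ (mem_head _ _)).
    rewrite (lstat_rphi hx) /rthr /= ?mul1r ?invr_gt0 //.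
    by rewrite ltr_wpDl ?t0 ?invr_gt0.
  have [s0|s0] := ltP (s j) 0; last first.
    by apply: le_trans s0; have [_ /(_ j)[]] := cx.
  have ns0 : 0 < - s j by rewrite oppr_gt0.
  rewrite -lerN2; apply/(side_ge_ramps j hx ns0) => k.
  have := h k.+1 ((j, false), (- s j - (- s j) / k.+2%:R, - s j / k.+2%:R)).
  move=> /(_ _)/wrap[]; first by apply: hmem; rewrite s0 inE mem_head orbT.
  rewrite (lstat_rphi hx) /rthr /=; [|by rewrite subr_gt0 ltr_pdivrMr // ltr_pMr // ltr1n|by rewrite divr_gt0].
  by rewrite mulN1r lerN2.
move=> /flattenP[l /allpairsP[[j k] /= [jn km ->]]]; rewrite mem_iota add0n /= in jn.
have [h1 h2] := h j jn; rewrite inE => /predU1P[->|].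
  rewrite (lstat_rphi hx) /rthr /=; [|by rewrite ltr_wpDl ?t0 ?invr_gt0|by rewrite invr_gt0].
  by rewrite mul1r; apply: (side_le_ramps j hx (t0 j jn)).1.
case: ifP => // s0; rewrite inE => /eqP ->.
have ns0 : 0 < - s j by rewrite oppr_gt0.
rewrite (lstat_rphi hx) /rthr /=; [|by rewrite subr_gt0 ltr_pdivrMr // ltr_pMr // ltr1n|by rewrite divr_gt0].
by rewrite mulN1r lerN2; apply: (side_ge_ramps j hx ns0).1; rewrite /= lerN2.
Qed.

End LstatLinear.

(** * Equality of finite-dimensional distributions *)

Section SameLaw.
Context {R : realType}.

Lemma measurable_event d (T : measurableType d) (xi : T -> @pmseq R) n (t s : nat -> R) :
  (forall s j, measurable_fun setT (fun w => side s (xi w) j)) ->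
  measurable [set w | forall j, (j < n)%N -> (xi w).1 j <= t j /\ (xi w).2 j <= s j].
Proof.
move=> mx.
have -> : [set w | forall j, (j < n)%N -> (xi w).1 j <= t j /\ (xi w).2 j <= s j] =
    \bigcap_(j in [set j | (j < n)%N]) ([set w | side true (xi w) j <= t j] `&` [set w | - side false (xi w) j <= s j]).
  apply/seteqP; split=> w /= h j jn; have [h1 h2] := h j jn; split=> //=; first by rewrite opprK.
  by move: h2; rewrite /= opprK.
apply: fin_bigcap_measurable => [|j _]; first exact: finite_II.
 apply: measurableI; apply: measurable_le_set => //.
by apply: (measurableT_comp (f := fun x : R => - x)) => //; exact: measurable_funN.
Qed.

Lemma null_modification d (T : measurableType d) (P : probability T R) (A B N : set T) :
  measurable A -> measurable B -> measurable N -> P N = 0%E -> (forall w, ~ N w -> A w <-> B w) -> P A = P B.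
Proof.
move=> mA mB mN PN h.
have le (A' B' : set T) : measurable A' -> measurable B' -> (forall w, ~ N w -> A' w -> B' w) -> (P A' <= P B')%E.
  move=> mA' mB' hh; apply: (@le_trans _ _ (P (B' `|` N))).
    rewrite le_measure ?inE //; first exact: measurableU.
    by move=> w Aw; case: (pselect (N w)) => Nw; [right|left; exact: hh].
  by apply: le_trans (measureU2 P mB' mN) _; rewrite [X in (_ + X)%E]PN adde0.
by apply/eqP; rewrite eq_le !le // => w /h [].
Qed.

Context d (T : measurableType d) (P : probability T R) (X : int -> int -> T -> R).
Variables (nu nac nd : {measure set (R * R)%type -> \bar R}).
Context d' (T' : measurableType d') (P' : probability T' R) (X' : int -> int -> T' -> R).
Variables (nu' nac' nd' : {measure set (R * R)%type -> \bar R}).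
Hypothesis H : thm_hyps P X nu nac nd.
Hypothesis H' : thm_hyps P' X' nu' nac' nd'.
Hypothesis ndE : forall A, measurable A -> nd A = nd' A.
Variables (xi : T -> @pmseq R) (xi' : T' -> @pmseq R).
Hypothesis hxi : limit_version P X xi.
Hypothesis hxi' : limit_version P' X' xi'.

Lemma vlimE F t : vlim nd F t = vlim nd' F t.
Proof. by apply: eq_bigr => n _; rewrite ndE //; exact: measurable_pt. Qed.

(** Both processes are approximated by the same polynomial in Fourier coefficients at the same
    frequencies, possible because the discrete parts agree; only then are Gaussian variances
    compared. *)
Lemma cos_stat_eq t l f b : vanish0 t l f ->
  \int[P]_w cos (lstat f (xi w) + b) = \int[P']_w cos (lstat f (xi' w) + b).
Proof.
move=> vf; apply/eqP; rewrite -subr_eq0 -normr_le0; apply/ler_addgt0Pr => e0 e00; rewrite add0r.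
(* Each process costs 3 e + 2 e, the comparison between them e. *)
pose e := e0 / 11; have ep : 0 < e by rewrite divr_gt0.
have [C1 [C10 h1]] := stat_approx H hxi vf ep; have [C2 [C20 h2]] := stat_approx H' hxi' vf ep.
have C0 : 0 < Num.max C1 C2 by rewrite lt_max C10.
have [q [q4 hq]] := lstat_ptr vf C0 ep.
have [|dl1 [dl10 k1]] := h1 (Num.max C1 C2) _ q q4 hq; first by rewrite le_max lexx.
have [|dl2 [dl20 k2]] := h2 (Num.max C1 C2) _ q q4 hq; first by rewrite le_max lexx orbT.
have dl0 : 0 < Num.min dl1 dl2 by rewrite lt_min dl10.
have [F [gF hF]] := goodF_exists H dl0.
have hF1 : (nd (~` [set z | z \in F]) <= dl1%:E)%E by apply: le_trans hF _; rewrite lee_fin ge_min lexx.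
have hF2 : (nd' (~` [set z | z \in F]) <= dl2%:E)%E.
  rewrite -ndE; last by apply: measurableC; exact: measurable_memseq.
  by apply: le_trans hF _; rewrite lee_fin ge_min lexx orbT.
have [M1 g1] := k1 F gF hF1; have [M2 g2] := k2 F gF hF2.
have gX : centered_gaussian P X by case: H.
have gX' : centered_gaussian P' X' by case: H'.
pose V M w (i : ((R * R) * bool)%type) := U X M w i.1 i.2.
pose V' M w (i : ((R * R) * bool)%type) := U X' M w i.1 i.2.
have idxF i : i \in uidx F -> i.1 \in F by move=> /allpairsP[[n c] /= [nF _ ->]].
have [M3 g3] : exists M0, forall M, (M0 <= M)%N ->
    `|\int[P]_w cos (Tq q F (U X M w) + b) - \int[P']_w cos (Tq q F (U X' M w) + b)| <= e.
  have := @agree_cos_dampable _ _ (uidx F) _ _ P _ _ P' V V' _ _ _ _ _ _ b (dampable_Tq F q) _ _ e ep.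
  apply.
  - by move=> M i; exact: (measurable_U gX).
  - by move=> M i; exact: (measurable_U gX').
  - move=> t0 b0 ot; exists (gcos b0 (vlim nd F t0)).
    have tF p : p \in t0 -> p.2.1 \in F by move=> /(allP ot) /idxF.
    by split; [exact: (cos_Ucomb_cvg H)|rewrite vlimE; exact: (cos_Ucomb_cvg H')].
  - by move=> i /idxF iF; exact: (U_tight H _ gF iF).
  - by move=> i /idxF iF; exact: (U_tight H' _ gF iF).
  - by move=> M; exact: (measurable_Tq H).
  - by move=> M; exact: (measurable_Tq H').
pose M := maxn M1 (maxn M2 M3).
have w1 := g1 M (leq_maxl _ _).
have w2 : whp P' e (fun w => `|lstat f (xi' w) - Tq q F (U X' M w)| <= 3 * e) by apply: g2; rewrite /M !leq_max leqnn orbT.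
have a3 := g3 M; have {}a3 := a3 ltac:(by rewrite /M !leq_max leqnn !orbT).
have e30 : 0 <= 3 * e by rewrite mulr_ge0 // ltW.
have cl (x y : R) : `|x - y| <= 3 * e -> `|cos (x + b) - cos (y + b)| <= 3 * e.
  by move=> h; apply: le_trans (cos_lip _ _) _; have -> : x + b - (y + b) = x - y by ring.
have a1 : `|\int[P]_w cos (lstat f (xi w) + b) - \int[P]_w cos (Tq q F (U X M w) + b)| <= 3 * e + 2 * e.
  apply: Ex_close => //; rewrite ?(ltW ep) //.
  - by apply: measurable_cos_comp; apply: measurable_funD => //; exact: (measurable_lstat hxi vf).
  - by apply: measurable_cos_comp; apply: measurable_funD => //; exact: (measurable_Tq H).
  - by move=> w; exact: cos_abs_le1.
  - by move=> w; exact: cos_abs_le1.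
  - by apply: whp_imp w1 => w; exact: cl.
have a2 : `|\int[P']_w cos (lstat f (xi' w) + b) - \int[P']_w cos (Tq q F (U X' M w) + b)| <= 3 * e + 2 * e.
  apply: Ex_close => //; rewrite ?(ltW ep) //.
  - by apply: measurable_cos_comp; apply: measurable_funD => //; exact: (measurable_lstat hxi' vf).
  - by apply: measurable_cos_comp; apply: measurable_funD => //; exact: (measurable_Tq H').
  - by move=> w; exact: cos_abs_le1.
  - by move=> w; exact: cos_abs_le1.
  - by apply: whp_imp w2 => w; exact: cl.
rewrite distrC in a2; apply: le_trans (ler_dist3 a1 a3 a2) _.
by rewrite /e le_eqVlt; apply/orP; left; apply/eqP; field.
Qed.

Lemma same_law_versions : same_law P xi P' xi'.
Proof.
move=> n t s.
(* A negative threshold for a nonnegative entry makes both events empty. *)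
have [t0|] := pselect (forall j, (j < n)%N -> 0 <= t j); last first.
  move=> /existsNP[j /not_implyP[jn /negP tj]]; rewrite -ltNge in tj.
  have E (d0 : measure_display) (T0 : measurableType d0) (P0 : probability T0 R) X0 (x : T0 -> @pmseq R) :
      limit_version P0 X0 x -> [set w | forall j, (j < n)%N -> (x w).1 j <= t j /\ (x w).2 j <= s j] = set0.
    move=> hx; apply/seteqP; split=> w //= /(_ j jn)[h1 _].
    have [/(_ j)[h2 _] _] := limit_version_canonical hx w.
    by have := le_lt_trans (le_trans h2 h1) tj; rewrite ltxx.
  by rewrite (E _ _ _ _ _ hxi) (E _ _ _ _ _ hxi') !measure0.
pose V w i := lstat (rphi i) (xi w); pose V' w i := lstat (rphi i) (xi' w).
have mV i : measurable_fun setT (fun w => V w i).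
  by have [t1 [l1 v]] := @rphi_vanish0 R i; exact: (measurable_lstat hxi v).
have mV' i : measurable_fun setT (fun w => V' w i).
  by have [t1 [l1 v]] := @rphi_vanish0 R i; exact: (measurable_lstat hxi' v).
have hV tt b : \int[P]_w cos (lin tt (V w) + b) = \int[P']_w cos (lin tt (V' w) + b).
  have [t1 [l1 [f [vf E]]]] := lstat_combination tt (@rphi_vanish0 R).
  rewrite -[LHS](_ : \int[P]_w cos (lstat f (xi w) + b) = _); last first.
    by apply: eq_Rintegral => w _; have [_ /(_ w)[C hC] _] := hxi; rewrite (E _ _ hC).
  rewrite (cos_stat_eq b vf).
  by apply: eq_Rintegral => w _; have [_ /(_ w)[C hC] _] := hxi'; rewrite (E _ _ hC).
(* Decreasing events given by finitely many statistics, whose intersection is the event on the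
   entries. *)
pose A m := [set w | forall i, i \in rlist n t s m -> V w i <= rthr i].
pose A' m := [set w | forall i, i \in rlist n t s m -> V' w i <= rthr i].
have PA m : P (A m) = P' (A' m).
  by apply: (orthant_eq mV mV') => tt b _; exact: hV.
have mA m : measurable (A m) by exact: measurable_orthant.
have mA' m : measurable (A' m) by exact: measurable_orthant.
have IA : \bigcap_m A m = [set w | forall j, (j < n)%N -> (xi w).1 j <= t j /\ (xi w).2 j <= s j].
  apply/seteqP; split=> w /= h; have [_ /(_ w)[C hC] _] := hxi.
    by apply/(rlist_event s hC t0) => m i im; exact: (h m I).
  by move=> m _ i im; exact: ((rlist_event s hC t0).2 h m i im).
have IA' : \bigcap_m A' m = [set w | forall j, (j < n)%N -> (xi' w).1 j <= t j /\ (xi' w).2 j <= s j].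
  apply/seteqP; split=> w /= h; have [_ /(_ w)[C hC] _] := hxi'.
    by apply/(rlist_event s hC t0) => m i im; exact: (h m I).
  by move=> m _ i im; exact: ((rlist_event s hC t0).2 h m i im).
have c1 : (P \o A) m @[m --> \oo] --> P (\bigcap_m A m).
  apply: nonincreasing_cvg_mu => //.
  - by apply: le_lt_trans (probability_le1 P (mA 0%N)) _; exact: ltry.
  - exact: bigcapT_measurable.
  - by move=> m m' mm; apply/subsetPset => w h i im; apply: h; exact: rlist_mem im _ mm.
have c2 : (P' \o A') m @[m --> \oo] --> P' (\bigcap_m A' m).
  apply: nonincreasing_cvg_mu => //.
  - by apply: le_lt_trans (probability_le1 P' (mA' 0%N)) _; exact: ltry.
  - exact: bigcapT_measurable.
  - by move=> m m' mm; apply/subsetPset => w h i im; apply: h; exact: rlist_mem im _ mm.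
rewrite -IA -IA'; move: c1.
have -> : P \o A = P' \o A' by apply/funext => m; exact: PA.
by move=> c1; exact: (cvg_unique _ c1 c2).
Qed.

End SameLaw.

Section LawDetermined.
Context {R : realType}.
Context d (T : measurableType d) (P : probability T R) (X : int -> int -> T -> R).
Variables (nu nac nd : {measure set (R * R)%type -> \bar R}).
Context d' (T' : measurableType d') (P' : probability T' R) (X' : int -> int -> T' -> R).
Variables (nu' nac' nd' : {measure set (R * R)%type -> \bar R}).

Lemma law_determined (xi : T -> @pmseq R) (xi' : T' -> @pmseq R) :
  thm_hyps P X nu nac nd -> thm_hyps P' X' nu' nac' nd' ->
  (forall A, measurable A -> nd A = nd' A) ->
  random_pm_C2 P xi -> EM_conv_prob P X xi -> random_pm_C2 P' xi' -> EM_conv_prob P' X' xi' ->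
  same_law P xi P' xi'.
Proof.
move=> H H' ndE r c r' c' n t s.
have [x0 [v0 [N [mN PN E]]]] := good_version H r c.
have [x0' [v0' [N' [mN' PN' E']]]] := good_version H' r' c'.
have m0 := measurable_side_rand r; have m0' := measurable_side_rand r'.
have [mv _ _] := v0; have [mv' _ _] := v0'.
rewrite (@null_modification _ _ _ P _ [set w | forall j, (j < n)%N -> (x0 w).1 j <= t j /\ (x0 w).2 j <= s j] N) //.
- rewrite (same_law_versions H H' ndE v0 v0' n t s).
  apply: (@null_modification _ _ _ P' _ _ N') => //; try exact: measurable_event.
  by move=> w /E' h /=; rewrite h.
- exact: measurable_event.
- exact: measurable_event.
- by move=> w /E h /=; rewrite h.
Qed.

End LawDetermined.

Theorem mainTheorem6 (R : realType) :
  (forall (d : measure_display) (T : measurableType d) (P : probability T R)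
          (X : int -> int -> T -> R) (nu nac nd : {measure set (R * R)%type -> \bar R}),
      thm_hyps P X nu nac nd ->
      exists xi : T -> pmseq, random_pm_C2 P xi /\ EM_conv_prob P X xi) /\
  (forall (d : measure_display) (T : measurableType d) (P : probability T R)
          (X : int -> int -> T -> R) (nu nac nd : {measure set (R * R)%type -> \bar R})
          (xi : T -> pmseq)
          (d' : measure_display) (T' : measurableType d') (P' : probability T' R)
          (X' : int -> int -> T' -> R) (nu' nac' nd' : {measure set (R * R)%type -> \bar R})
          (xi' : T' -> pmseq),
      thm_hyps P X nu nac nd -> thm_hyps P' X' nu' nac' nd' ->
      (forall A, measurable A -> nd A = nd' A) ->
      random_pm_C2 P xi -> EM_conv_prob P X xi ->
      random_pm_C2 P' xi' -> EM_conv_prob P' X' xi' ->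
      same_law P xi P' xi').
Proof.
split; first by move=> d T P X nu nac nd H; exact: exists_limit H.
move=> d T P X nu nac nd xi d' T' P' X' nu' nac' nd' xi' H H' ndE r c r' c'.
exact: law_determined H H' ndE r c r' c'.
Qed.
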